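(* Fix $x\in\Sigma$ and assume that $\mathcal A(x)=\{j\in S:x_j=0\}\neq\varnothing$. Let $B=S\setminus\mathcal A(x)$ and assume $|B|\ge2$. Then the measure $\mathbb{P}^B_x$ starts at $x_B$ and solves the $\mathfrak{L}_B$-martingale problem on $C(\mathbb{R}_+,\Sigma_B)$: for every $H\in\mathcal D_{B,B}$, the process $$H(X_t)-\int_0^t(\mathfrak{L}_BH)(X_s)\,ds,\qquad t\ge0,$$ is a $\mathbb{P}^B_x$-martingale with respect to the filtration generated by the coordinate process.
   Context: Setting. $S=\{1,\dots,L\}$ is a finite set; $r(j,k)\ge 0$, $j,k\in S$, with $r(j,j)=0$, are the jump rates of an irreducible continuous-time Markov chain on $S$; $\lambda(j)=\sum_k r(j,k)$; $\mathbf m=(m_j)_{j\in S}$ is a (nonzero, hence strictly positive) invariant measure, i.e. $\sum_{j} m_j r(j,k)=m_k\lambda(k)$ for all $k$ (neither a probability nor reversible in general); $b>1$ is fixed. $\Sigma=\{x\in\mathbb{R}^S: x_j\ge 0,\ \sum_{j\in S}x_j=1\}$. $\{\mathbf e_j\}$ denotes the canonical basis and $\mathbf v_j=\sum_{k\in S}r(j,k)(\mathbf e_k-\mathbf e_j)$. $C^n(\Sigma)$ is the set of $n$-times continuously differentiable functions on $\Sigma$ (up to the boundary; only derivatives tangent to $\Sigma$ are used; same for $\Sigma_B$ below). $\mathcal D_S$ is the set of $H\in C^2(\Sigma)$ such that for every $j\in S$ the map $x\mapsto \frac{\mathbf v_j\cdot\nabla H(x)}{x_j}\mathbf 1\{x_j>0\}$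 (equal to $0$ when $x_j=0$) is continuous on $\Sigma$. For $F\in C^2(\Sigma)$, $$(\mathfrak{L}F)(x)=b\sum_{j\in S}\mathbf 1\{x_j\ne 0\}\frac{m_j}{x_j}\,\mathbf v_j\cdot\nabla F(x)+\frac12\sum_{j,k\in S}m_j r(j,k)(\partial_{x_k}-\partial_{x_j})^2F(x).$$ A probability $\mathbb{P}$ on $C(\mathbb{R}_+,\Sigma)$ (continuous paths, coordinate maps $X_t$, $\mathcal F_t=\sigma(X_s:s\le t)$) starts at $x$ if $\mathbb{P}[X_0=x]=1$ and is a solution of the $\mathfrak{L}$-martingale problem if for every $H\in\mathcal D_S$, $H(X_t)-\int_0^t(\mathfrak{L}H)(X_s)\,ds$ is a $\mathbb{P}$-martingale w.r.t. $(\mathcal F_t)$. For each $x\in\Sigma$ there is exactly one solution starting at $x$, denoted $\mathbb{P}_x$. For $B\subseteq S$ with at least two elements: the trace on $B$ of the chain has rates $r^B(j,k)=\lambda(j)\,\mathbf P_j[T_k=T_B^+]$ for $j\ne k\in B$, $r^B(j,j)=0$, where $\mathbf P_j$ is the law of the chain with rates $r$ started at $j$, $T_k$ is the hitting time of $k$ and $T^+_B$ the return time to $B$ (first time after the first jump at which the chain is in $B$). $\Sigma_B=\{x\in\mathbb{R}_+^B:\sum_{j\in B}x_j=1\}$; $\mathbf v^B_j=\sum_{k\in B}r^B(j,k)(\mathbf e_k-\mathbf e_j)\in\mathbb{R}^B$; $\mathcal D_{B,B}$ is the set of $H\in C^2(\Sigma_B)$ such that for every $j\in B$ the map $x\mapsto\frac{\mathbf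 v^B_j\cdot\nabla H(x)}{x_j}\mathbf 1\{x_j>0\}$ is continuous on $\Sigma_B$; and for $f\in C^2(\Sigma_B)$, $x\in\Sigma_B$, $$(\mathfrak{L}_Bf)(x)=b\sum_{j\in B}\frac{m_j}{x_j}\mathbf 1\{x_j>0\}\,\mathbf v_j^B\cdot\nabla f(x)+\frac12\sum_{j,k\in B}m_jr^B(j,k)(\partial_{x_k}-\partial_{x_j})^2f(x).$$ For $x\in\Sigma$, $x_B$ denotes the coordinates of $x$ in $B$. If $B=\{j:x_j>0\}$, then $\mathbb{P}_x$ is concentrated on trajectories whose coordinates outside $B$ vanish at all times (the process is absorbed at the boundary), so identifying $\{y\in\Sigma:y_j=0\ \forall j\notin B\}$ with $\Sigma_B$, it is concentrated on $C(\mathbb{R}_+,\Sigma_B)$; $\mathbb{P}^B_x$ denotes the restriction of $\mathbb{P}_x$ to $C(\mathbb{R}_+,\Sigma_B)$. *)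

(* Defs.v *)
From HB Require Import structures.
From mathcomp Require Import all_boot all_order all_algebra.
From mathcomp Require Import all_classical all_reals all_analysis.

Set Implicit Arguments.
Unset Strict Implicit.
Unset Printing Implicit Defensive.

Import Order.TTheory GRing.Theory Num.Theory.
Import numFieldNormedType.Exports.

Local Open Scope classical_set_scope.
Local Open Scope ring_scope.

(* Points of R^n are row vectors; the finite set {1, ..., n} is 'I_n. *)

Section simplex.
Context {R : realType} {n : nat}.
Implicit Types (x v : 'rV[R]_n) (H : 'rV[R]_n -> R).

Definition simplex : set 'rV[R]_n :=
  [set x | (forall j, 0 <= x 0 j) /\ \sum_j x 0 j = 1].

Definition open_simplex : set 'rV[R]_n :=
  [set x | simplex x /\ forall j, 0 < x 0 j].

Definition tangent v : Prop := \sum_j v 0 j = 0.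

(* Derivative of H along the tangent vector v, as a function on the closed
   simplex: the continuous extension of the directional derivative from the
   relative interior. It only depends on the values of H on the simplex. *)
Definition tderiv v H x : R :=
  lim ('D_v H y @[y --> within open_simplex (nbhs x)]).

(* C^k up to the boundary. Requiring tderiv v H to be continuous on the simplex
   and equal to 'D_v H on the relative interior says that 'D_v H extends
   continuously to the simplex, so the limits in tderiv do exist. *)
Fixpoint Cn (k : nat) H : Prop :=
  {within simplex, continuous H} /\
  (if k is k'.+1 then
     forall v, tangent v ->
       (forall x, open_simplex x -> is_derive x v H (tderiv v H x)) /\
       Cn k' (tderiv v H)
   else True).

Definition ebase (j : 'I_n) : 'rV[R]_n := delta_mx 0 j.

End simplex.

Section generator.
Context {R : realType} {n : nat}.
Variables (b : R) (m : 'I_n -> R) (r : 'I_n -> 'I_n -> R).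
Implicit Types (x : 'rV[R]_n) (H : 'rV[R]_n -> R).

Definition jump_vector (j : 'I_n) : 'rV[R]_n :=
  \sum_k r j k *: (ebase k - ebase j).

Definition gen_domain : set ('rV[R]_n -> R) :=
  [set H | Cn 2 H /\ forall j, {within simplex, continuous (fun x =>
    if 0 < x 0 j then tderiv (jump_vector j) H x / x 0 j else 0)}].

Definition gen H x : R :=
  b * (\sum_j (if x 0 j != 0 then m j / x 0 j * tderiv (jump_vector j) H x
               else 0)) +
  2^-1 * (\sum_j \sum_k m j * r j k *
    tderiv (ebase k - ebase j) (tderiv (ebase k - ebase j) H) x).

End generator.

(* Continuous paths from R_+ to the simplex, encoded as functions on R that are
   constant on the negative half-line. The guard (0 < n)%N only makes this
   type inhabited when n = 0, where the simplex is empty. *)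
Record cpath (R : realType) (n : nat) := CPath {
  path_fun :> R -> 'rV[R]_n;
  path_continuous : continuous path_fun;
  path_simplex : forall t, (0 < n)%N -> simplex (path_fun t);
  path_neg : forall t, t <= 0 -> path_fun t = path_fun 0 }.

Section path_space.
Context {R : realType} {n : nat}.

Lemma path_eqP (w w' : cpath R n) : (forall t, w t = w' t) -> w = w'.
Proof.
case: w w' => [w c s z] [w' c' s' z'] /= /funext e.
subst w'; congr CPath; exact: Prop_irrelevance.
Qed.

Fact path_pt_simplex :
  (0 < n)%N -> simplex (const_mx n%:R^-1 : 'rV[R]_n).
Proof.
move=> n0; split=> [j|]; first by rewrite mxE invr_ge0.
under eq_bigr do rewrite mxE.
rewrite sumr_const card_ord -[_ *+ n]mulr_natl mulfV// pnatr_eq0 -lt0n //.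
Qed.

Definition path_pt : cpath R n :=
  @CPath R n (fun=> const_mx n%:R^-1) (@cst_continuous _ _ _)
    (fun=> path_pt_simplex) (fun _ _ => erefl).

HB.instance Definition _ := gen_eqMixin (cpath R n).
HB.instance Definition _ := gen_choiceMixin (cpath R n).
HB.instance Definition _ := isPointed.Build (cpath R n) path_pt.

Definition coord_events (I : set R) : set (set (cpath R n)) :=
  [set E | exists (s : R) (j : 'I_n) (A : set R), [/\ I s, measurable A &
                             E = [set w : cpath R n | A (w s 0 j)]]].

HB.instance Definition _ := Measurable.copy (cpath R n)
  (g_sigma_algebraType (coord_events [set s | 0 <= s])).

Lemma measurable_coord (t : R) j (A : set R) :
  measurable A -> measurable [set w : cpath R n | A (w t 0 j)].
Proof.
move=> mA; apply: sub_sigma_algebra.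
have [t0|/ltW t0] := leP 0 t; first by exists t, j, A.
exists 0, j, A; split => //=.
by apply/seteqP; split => w /=; rewrite path_neg.
Qed.

(* F_t = sigma (X_s : 0 <= s <= t) *)
Definition coord_filtration (t : R) : set (set (cpath R n)) :=
  <<s coord_events [set s | 0 <= s <= t] >>.

End path_space.

Definition martingale (R : realType) (d : measure_display)
    (Omega : measurableType d) (P : {measure set Omega -> \bar R})
    (F : R -> set (set Omega)) (M : R -> Omega -> R) : Prop :=
  forall t, 0 <= t ->
  [/\ P.-integrable setT (EFin \o M t),
      forall A, measurable A -> F t (M t @^-1` A) &
      forall s, 0 <= s <= t -> forall A, F s A ->
        (\int[P]_(w in A) (M t w)%:E = \int[P]_(w in A) (M s w)%:E)%E].

Section martingale_problem.
Context {R : realType} {n : nat}.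
Variables (b : R) (m : 'I_n -> R) (r : 'I_n -> 'I_n -> R).
Implicit Type P : {measure set (cpath R n) -> \bar R}.

Definition starts_at (x : 'rV[R]_n) P : Prop := P [set w | w 0 = x] = 1%E.

Definition solves_mp P : Prop :=
  forall H, gen_domain r H ->
  martingale P coord_filtration (fun t w =>
    H (w t) - \int[lebesgue_measure]_(s in `[0, t]) gen b m r H (w s)).

(* Uniqueness is stated on measurable sets: the function underlying a measure
   is unconstrained elsewhere. *)
Definition is_unique_solution (x : 'rV[R]_n) (P : probability (cpath R n) R)
    : Prop :=
  [/\ starts_at x P, solves_mp P &
      forall Q : probability (cpath R n) R,
        starts_at x Q -> solves_mp Q -> forall A, measurable A -> Q A = P A].

End martingale_problem.

(* The coordinates in B : {set 'I_n} are indexed by 'I_#|B| through enum_val. *)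
Section faces.
Context {R : realType} {n : nat}.
Variable B : {set 'I_n}.

Definition restr_coord (x : 'rV[R]_n) : 'rV[R]_#|B| :=
  \row_i x 0 (enum_val i).

Definition extend_coord (y : 'rV[R]_#|B|) : 'rV[R]_n :=
  \row_j \sum_(i < #|B| | enum_val i == j) y 0 i.

Definition face_paths : set (cpath R n) :=
  [set w : cpath R n | forall t j, j \notin B -> w t 0 j = 0].

Lemma extend_coord_in y i : extend_coord y 0 (enum_val i) = y 0 i.
Proof.
rewrite mxE (big_pred1 i)// => k.
by apply/eqP/eqP => [/enum_val_inj|->].
Qed.

Lemma extend_coord_out y j : j \notin B -> extend_coord y 0 j = 0.
Proof.
move=> jB; rewrite mxE big_pred0// => i; apply/negP => /eqP ij.
by move: jB; rewrite -ij enum_valP.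
Qed.

Lemma extend_coord_inj : injective extend_coord.
Proof.
move=> y y' e; apply/rowP => i.
by rewrite -extend_coord_in e extend_coord_in.
Qed.

Lemma restr_coordK (x : 'rV[R]_n) : (forall j, j \notin B -> x 0 j = 0) ->
  extend_coord (restr_coord x) = x.
Proof.
move=> x0; apply/rowP => j; have [jB|jB] := boolP (j \in B); last first.
  by rewrite extend_coord_out ?x0.
by rewrite -(enum_rankK_in jB jB) extend_coord_in mxE.
Qed.

(* The image of A under the identification of C(R_+, Sigma_B) with the set of
   paths whose coordinates outside B vanish. *)
Definition face_image (A : set (cpath R #|B|)) : set (cpath R n) :=
  [set w : cpath R n |
    exists2 u : cpath R #|B|, A u & forall t, w t = extend_coord (u t)].

Lemma face_image_inj (w : cpath R n) (u u' : cpath R #|B|) :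
  (forall t, w t = extend_coord (u t)) ->
  (forall t, w t = extend_coord (u' t)) -> u = u'.
Proof.
by move=> e e'; apply: path_eqP => t; apply: extend_coord_inj; rewrite -e e'.
Qed.

Lemma restr_coord_simplex (x : 'rV[R]_n) : (forall j, j \notin B -> x 0 j = 0) ->
  simplex x -> simplex (restr_coord x).
Proof.
move=> x0 [xge0 x1]; split=> [i|]; first by rewrite mxE.
rewrite -{}x1 (bigID (mem B))/= [X in _ + X]big1 ?addr0; last first.
  by move=> j /x0.
rewrite [RHS]big_enum_val; apply: eq_bigr => i _; by rewrite mxE.
Qed.

Lemma restr_path_subproof (w : cpath R n) (B0 : (0 < #|B|)%N) :
  face_paths w -> exists u : cpath R #|B|, forall t, w t = extend_coord (u t).
Proof.
move=> wB.
have n0 : (0 < n)%N by rewrite (leq_trans B0)// -[leqRHS]card_ord max_card.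
pose f t := restr_coord (w t).
have cf : continuous f.
  move=> t; apply/cvg_ballP => e e0.
  have /cvg_ballP/(_ e e0) := @path_continuous _ _ w t.
  apply: filterS => s [_ sw]; split=> // i k.
  by rewrite !mxE; exact: sw.
have sf t : (0 < #|B|)%N -> simplex (f t).
  move=> _; apply: restr_coord_simplex; first exact: wB.
  exact: path_simplex.
have nf t : t <= 0 -> f t = f 0 by rewrite /f => /path_neg ->.
by exists (CPath cf sf nf) => t /=; rewrite restr_coordK//; exact: wB.
Qed.

Lemma measurable_face_paths : measurable face_paths.
Proof.
have -> : face_paths = \bigcap_(q in [set: rat])
    \bigcap_(j in [set j | j \notin B]) [set w : cpath R n | w (ratr q) 0 j = 0].
  apply/seteqP; split => [w wB q _ j jB|w wB t j jB]; first exact: wB.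
  apply: contrapT => tj0.
  have cw : continuous (fun s => w s 0 j).
    move=> s; apply: (@continuous_comp _ _ _ w (fun y : 'rV[R]_n => y 0 j)).
      exact: path_continuous.
    exact: coord_continuous.
  have oU : open ((fun s => w s 0 j) @^-1` [set y | y != 0]).
    by apply: open_comp; [move=> s _; exact: cw|exact: open_neq].
  have [|s [/= + [q _ qs]]] := dense_rat _ oU; first by exists t; exact/eqP.
  rewrite -{s}qs.
  by move/eqP; apply; exact: wB.
rewrite -[X in measurable X]setCK setC_bigcap; apply: measurableC.
apply: bigcupT_measurable_rat => q; apply: measurableC.
apply: fin_bigcap_measurable; first exact: finite_finset.
by move=> j _; exact: (measurable_coord _ _ (measurable_set1 0)).
Qed.

Lemma measurable_face_imageT : measurable (face_image setT).
Proof.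
have [B0|] := ltnP 0 #|B|.
  have -> : face_image setT = face_paths; last exact: measurable_face_paths.
  apply/seteqP; split=> [w [u _ wu] t j jB|w /(restr_path_subproof B0)[u wu]].
    by rewrite wu extend_coord_out.
  by exists u.
rewrite leqn0 => /eqP/cards0_eq B0.
have [n0|] := ltnP 0 n.
  suff -> : face_image setT = set0 by [].
  apply/seteqP; split=> // w [u _ wu].
  have [_] := path_simplex w 0 n0.
  rewrite wu big1 => [/esym/eqP|j _]; first by rewrite oner_eq0.
  by rewrite extend_coord_out// B0 inE.
rewrite leqn0 => /eqP n0.
have w0 (w w' : cpath R n) : w = w'.
  by apply: path_eqP => t; apply/rowP => j; have := ltn_ord j; rewrite {2}n0.
have [[w wu]|nw] := pselect (exists w, face_image setT w).
  suff -> : face_image setT = setT by [].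
  by apply/seteqP; split => // w' _; rewrite (w0 w' w).
suff -> : face_image setT = set0 by [].
by apply/seteqP; split => // w wu; apply: nw; exists w.
Qed.

Lemma measurable_face_image A : measurable A -> measurable (face_image A).
Proof.
suff : <<s coord_events [set s | 0 <= s] >> `<=`
  [set A : set (cpath R #|B|) | measurable (face_image A)] by apply.
apply: smallest_sub => [|_ [s [i [E [s0 mE ->]]]]] /=.
  split => /= [|C mC|F mF].
  - suff -> : face_image set0 = set0 by [].
    by apply/seteqP; split => // w [].
  - suff -> : face_image (setT `\` C) = face_image setT `\` face_image C.
      by apply: measurableD => //; exact: measurable_face_imageT.
    apply/seteqP; split=> w /=.
      move=> [u [_ Cu] wu]; split; first by exists u.
      by move=> [u' Cu' wu']; apply: Cu; rewrite (face_image_inj wu wu').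
    move=> [[u _ wu] nC]; exists u => //; split => // Cu; apply: nC.
    by exists u.
  - suff -> : face_image (\bigcup_k F k) = \bigcup_k face_image (F k).
      exact: bigcupT_measurable.
    apply/seteqP; split=> w /=.
      by move=> [u [k _ Fu] wu]; exists k => //; exists u.
    by move=> [k _ [u Fu wu]]; exists u => //; exists k.
have -> : face_image [set w : cpath R #|B| | E (w s 0 i)] =
    face_image setT `&` [set w : cpath R n | E (w s 0 (enum_val i))].
  apply/seteqP; split=> w /=.
    by move=> [u Eu wu]; split; [exists u|rewrite wu extend_coord_in].
  by move=> [[u _ wu] +]; rewrite wu extend_coord_in => Eu; exists u.
by apply: measurableI; [exact: measurable_face_imageT|exact: measurable_coord].
Qed.

(* Restriction of P to C(R_+, Sigma_B); its total mass is P face_paths. *)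
Definition face_law (P : {measure set (cpath R n) -> \bar R})
  (A : set (cpath R #|B|)) : \bar R := P (face_image A).

Variable P : {measure set (cpath R n) -> \bar R}.

Let face_law0 : face_law P set0 = 0%E.
Proof.
rewrite /face_law (_ : face_image _ = set0) ?measure0//.
by apply/seteqP; split => // w [].
Qed.

Let face_law_ge0 A : (0 <= face_law P A)%E.
Proof. exact: measure_ge0. Qed.

Let face_law_sigma_additive : semi_sigma_additive (face_law P).
Proof.
move=> F mF tF mUF; rewrite /face_law.
have -> : face_image (\bigcup_k F k) = \bigcup_k face_image (F k).
  apply/seteqP; split=> w /=.
    by move=> [u [k _ Fu] wu]; exists k => //; exists u.
  by move=> [k _ [u Fu wu]]; exists u => //; exists k.
have mI k : measurable (face_image (F k)) by exact: measurable_face_image.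
apply: measure_semi_sigma_additive => //; last exact: bigcupT_measurable.
apply/trivIsetP => i j _ _ ij; apply/seteqP; split => // w.
move=> [[u Fu wu] [u' Fu' wu']].
rewrite (face_image_inj wu' wu) in Fu'.
have /trivIsetP/(_ i j Logic.I Logic.I ij)/seteqP[/(_ u)] := tF.
by move=> /(_ (conj Fu Fu')).
Qed.

HB.instance Definition _ := isMeasure.Build _ _ _ (face_law P)
  face_law0 face_law_ge0 face_law_sigma_additive.

End faces.

Arguments face_paths {R n} B.

Section chain.
Context {R : realType} {n : nat} (d : measure_display)
  (Omega : measurableType d).
Implicit Types (r : 'I_n -> 'I_n -> R) (X : R -> Omega -> 'I_n).

Definition total_rate r (j : 'I_n) : R := \sum_k r j k.

(* X visits the states Y 0, Y 1, ... and stays tau i in Y i; under P, Y is the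
   jump chain started at j and, given Y, the tau i are independent exponential
   times of parameters total_rate r (Y i). *)
Record jump_hold r (j : 'I_n) (P : probability Omega R) X
    (Y : nat -> Omega -> 'I_n) (tau : nat -> Omega -> R) : Prop := {
  jh_measY : forall i k, measurable [set w | Y i w = k];
  jh_meastau : forall i, measurable_fun setT (tau i);
  jh_gt0 : forall i w, 0 < tau i w;
  jh_nonexpl : forall w, (\sum_(0 <= i < N) tau i w) @[N --> \oo] --> +oo;
  jh_path : forall i w t,
    \sum_(0 <= l < i) tau l w <= t < \sum_(0 <= l < i.+1) tau l w ->
    X t w = Y i w;
  jh_law : forall N (k : nat -> 'I_n) (t : nat -> R), (forall i, 0 <= t i) ->
    P [set w | forall i, (i <= N)%N -> Y i w = k i /\ t i < tau i w] =
    ((k 0 == j)%:R *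
     \prod_(0 <= i < N) (r (k i) (k i.+1) / total_rate r (k i)) *
     \prod_(0 <= i < N.+1) expR (- total_rate r (k i) * t i))%:E }.

Definition markov_chain r j (P : probability Omega R) X : Prop :=
  exists Y tau, jump_hold r j P X Y tau.

(* These times are +oo when the set of times is empty; ereal_inf is a minimum
   otherwise, the paths being right-continuous step functions. *)
Definition hitting_time X (A : {set 'I_n}) (w : Omega) : \bar R :=
  ereal_inf [set t%:E | t in [set t | 0 <= t /\ X t w \in A]].

Definition first_jump X (w : Omega) : \bar R :=
  ereal_inf [set t%:E | t in [set t | 0 <= t /\ X t w != X 0 w]].

Definition return_time X (A : {set 'I_n}) (w : Omega) : \bar R :=
  ereal_inf [set t%:E | t in
    [set t | (first_jump X w <= t%:E)%E /\ X t w \in A]].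

(* total_rate r j * P_j[T_k = T_B^+] for j <> k in B *)
Definition trace_rate r (P : 'I_n -> probability Omega R) X (B : {set 'I_n})
    (i i' : 'I_#|B|) : R :=
  let j := enum_val i in let k := enum_val i' in
  if j == k then 0 else
  total_rate r j *
    fine (P j [set w | hitting_time X [set k] w = return_time X B w]).

End chain.

Definition irreducible_rates (R : realType) (n : nat)
    (r : 'I_n -> 'I_n -> R) : Prop :=
  forall j k, connect (fun j k => 0 < r j k) j k.

Definition invariant_measure (R : realType) (n : nat)
    (r : 'I_n -> 'I_n -> R) (m : 'I_n -> R) : Prop :=
  [/\ forall j, 0 <= m j, exists j, m j != 0 &
      forall k, \sum_j m j * r j k = m k * total_rate r k].

Definition zero_set (R : realType) (n : nat) (x : 'rV[R]_n) : {set 'I_n} :=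
  [set j | x 0 j == 0]%SET.

(* Main.v *)
Require Import Defs.
From HB Require Import structures.
From mathcomp Require Import all_boot all_order all_algebra.
From mathcomp Require Import all_classical all_reals all_analysis.
From mathcomp Require Import ring lra measurable_realfun.

Set Implicit Arguments.
Unset Strict Implicit.
Unset Printing Implicit Defensive.

Import Order.TTheory GRing.Theory Num.Theory.
Import numFieldNormedType.Exports.

Local Open Scope classical_set_scope.
Local Open Scope ring_scope.

(* Every H in the domain on the face of B is approximated by functions F_k in
   the domain on the whole simplex such that F_k -> H and L F_k -> L_B H,
   pointwise and boundedly on the face; the martingale property of F_k under P_x
   then passes to the limit by dominated convergence.

   F_k = H o Psi with Psi x = (x - \sum_j e f_j(x / e) v_j) U and e = e_k -> 0.
   - U_(k, i) is the probability that the chain started at k enters B at i. It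
     maps v_j to the vector v_j^B of the trace for j in B, and to 0 for the other
     j by harmonicity; the rates of the trace are identified through U by a
     first-passage decomposition.
   - f is a C^2 field for which the correction keeps x away from the boundary,
     with D_{v_i} f_j = [i = j] where x_i <= e T / 2, so that D_{v_i} F_k
     vanishes near {x_i = 0}, as the domain requires. f_j / m_j is a smoothed
     maximum, over the proper subsets A of S, of the solutions of the systems
     "equality in the obstacle problem on A, zero off A" for the Laplacian of
     the rates q(i, j) = m_j r(j, i); the exact maximum solves the
     obstacle problem by policy improvement.
   On the face, the drift of F_k stays bounded because D_{v_j^B} H is o(x_j) at
   {x_j = 0}, which also makes the tangential derivatives of D_{v_j^B} H vanish
   there; with summation by parts against the invariant measure, this gives the
   limit of the second-order part of L F_k. *)

(** The map x -> H (x U) alone is not in the domain: for i in B its derivative along v_i is that of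
    H along v_i^B at x U, and coordinate i of x U may stay positive where x_i = 0 but states outside
    B carry mass, so dividing by x_i blows up. The correction must kill the derivative along v_i on
    the strip x_i <= e T / 2 for all i at once, although the strips overlap and the v_i are linearly
    dependent. With z = x / e and p_j = f_j / m_j, the corrected point over e has coordinates z_k +
    Lap p (k), Lap being the Laplacian of q; the obstacle problem asks for the least p >= 0 lifting
    all of them to at least T. Adding h m_i v_i to z and h to p_i leaves z + Lap p unchanged, so
    where equation i is saturated D_{v_i} f_j = [i = j] comes for free. The corrected point is
    interior, so the chain rule never meets the boundary of the simplex. The price is a second
    derivative of f of order 1 / e; it is multiplied by D_{v_j^B} H and lives only where x_j = O(e),
    where this factor is O(e) too. *)

Lemma connect_preserved (T : finType) (e : rel T) (P : T -> Prop) :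
  (forall j k, e j k -> P j -> P k) ->
  forall j k, connect e j k -> P j -> P k.
Proof.
move=> eP j k /connectP[p + ->] {k}.
elim: p j => //= k p IH j /andP[/eP jk /IH pk] Pj; exact: pk (jk Pj).
Qed.

Lemma sum_indicator (R : pzSemiRingType) n (i : 'I_n) (F : 'I_n -> R) :
  \sum_j (j == i)%:R * F j = F i.
Proof.
rewrite (bigD1 i)//= eqxx mul1r big1 ?addr0// => j /negPf ->.
by rewrite mul0r.
Qed.

(** * The obstacle problem *)

Section weighted_laplacian.
Context {R : realType} {n : nat}.
Variable q : 'I_n -> 'I_n -> R.
Hypothesis q_ge0 : forall i j, 0 <= q i j.
Hypothesis q_irr : irreducible_rates q.
Implicit Types (A : {set 'I_n}) (f : 'cV[R]_n).

(** At a negative minimum, which must lie in A, the inequality forces every neighbour to attain the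
    minimum as well; irreducibility carries it to a state outside A, where [f] is nonnegative. *)
Lemma min_principle A (f : 'I_n -> R) : A != finset.setT ->
  (forall j, j \notin A -> 0 <= f j) ->
  (forall j, j \in A -> 0 <= \sum_i q j i * (f j - f i)) ->
  forall j, 0 <= f j.
Proof.
move=> AT fA Lf j0; pose k := [arg min_(k < j0) f k]%O.
have fk j : f k <= f j.
  by rewrite /k; case: Order.TotalTheory.arg_minP => // i _; apply.
have [|k0] := leP 0 (f k); first by move/le_trans; exact.
have prop j i : 0 < q j i -> f j = f k -> f i = f k.
  move=> qji fjk.
  have jA : j \in A by apply: contraTT k0 => /fA; rewrite fjk -leNgt.
  have nn l : true -> 0 <= q j l * (f l - f j).
    by rewrite mulr_ge0// fjk subr_ge0.
  have s0 : \sum_l q j l * (f l - f j) = 0.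
    apply/eqP; rewrite eq_le sumr_ge0// andbT.
    rewrite -oppr_ge0 -sumrN; under eq_bigr do rewrite -mulrN opprB.
    exact: Lf.
  have /eqP := psumr_eq0P nn s0 (erefl : true = true) (i := i).
  by rewrite mulf_eq0 (gt_eqF qji)/= subr_eq0 fjk => /eqP.
have [l lA] : exists l, l \notin A.
  apply/existsP; apply: contraR AT => /existsPn AT.
  by apply/eqP/setP => l; rewrite inE; move: (AT l); rewrite negbK.
have := fA l lA.
by rewrite (connect_preserved prop (q_irr k l) erefl) leNgt k0.
Qed.

(** The Dirichlet problem with interior A as one square matrix: Laplacian rows on A, boundary values
    elsewhere. It serves twice: with the weights m_i r(i, j) for the obstacle problem, and with the
    rates themselves for the entrance law into B. *)
Definition Kmx A : 'M[R]_n :=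
  \matrix_(j, i) if j \in A then (i == j)%:R * (\sum_l q j l) - q j i
                 else (i == j)%:R.

Lemma KmxE A f j : (Kmx A *m f) j 0 =
  if j \in A then \sum_i q j i * (f j 0 - f i 0) else f j 0.
Proof.
rewrite !mxE; case: ifPn => jA.
  under eq_bigr do rewrite mxE jA mulrBl -mulrA.
  rewrite sumrB sum_indicator mulr_suml -sumrB.
  by under eq_bigr do rewrite -mulrBr.
under eq_bigr do rewrite mxE (negPf jA).
exact: sum_indicator.
Qed.

Lemma Kmx_ge0 A f : A != finset.setT ->
  (forall j, 0 <= (Kmx A *m f) j 0) -> forall j, 0 <= f j 0.
Proof.
move=> AT Kf; apply: (min_principle AT) => j jA; have := Kf j.
  by rewrite KmxE (negPf jA).
by rewrite KmxE jA.
Qed.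

Lemma Kmx_unit A : A != finset.setT -> Kmx A \in unitmx.
Proof.
move=> AT; rewrite -unitmx_tr -row_free_unit; apply: inj_row_free => v vK.
have Kv : Kmx A *m v^T = 0 by rewrite -[LHS]trmxK trmx_mul trmxK vK trmx0.
have v_ge0 := @Kmx_ge0 A v^T AT.
have v_le0 := @Kmx_ge0 A (- v^T) AT.
apply/rowP => j; apply/eqP; rewrite eq_le !mxE; apply/andP; split.
  have := v_le0 _ j; rewrite !mxE oppr_ge0; apply => i.
  by rewrite mulmxN Kv oppr0 mxE.
by have := v_ge0 _ j; rewrite !mxE; apply => i; rewrite Kv mxE.
Qed.

Lemma invKmx_ge0 A : A != finset.setT ->
  forall j i, 0 <= invmx (Kmx A) j i.
Proof.
move=> AT j i.
have := @Kmx_ge0 A (invmx (Kmx A) *m delta_mx i 0) AT.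
rewrite mulKVmx ?Kmx_unit// => /(_ _ j).
rewrite -colE mxE; apply => k; rewrite mxE; case: eqP; case: eqP => //=.
Qed.

End weighted_laplacian.

Section obstacle.
Context {R : realType} {n : nat}.
Variable q : 'I_n -> 'I_n -> R.
Hypothesis q_ge0 : forall i j, 0 <= q i j.
Hypothesis q_irr : irreducible_rates q.
Hypothesis q_bal : forall i, \sum_j q j i = \sum_j q i j.
Hypothesis q_gt0 : forall i, 0 < \sum_j q i j.
Variable T : R.
Hypothesis T_gt0 : 0 < T.
Implicit Types (A : {set 'I_n}) (z : 'rV[R]_n) (f : 'cV[R]_n).

Local Notation lap f j := (\sum_i q j i * (f j 0 - f i 0)).

Definition obstacle_rhs A z : 'cV[R]_n :=
  \col_j if j \in A then T - z 0 j else 0.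

Lemma obstacle_rhsE A z j : obstacle_rhs A z j 0 = if j \in A then T - z 0 j else 0.
Proof. by rewrite mxE. Qed.

Let subE f g j : (f - g) j 0 = f j 0 - g j 0.
Proof. by rewrite !mxE. Qed.

Let scaleE c f j : (c *: f) j 0 = c * f j 0.
Proof. by rewrite mxE. Qed.

Definition pol A z : 'cV[R]_n := invmx (Kmx q A) *m obstacle_rhs A z.

Lemma Kmx_pol A z : A != finset.setT -> Kmx q A *m pol A z = obstacle_rhs A z.
Proof. by move=> AT; rewrite /pol mulKVmx// Kmx_unit. Qed.

Lemma pol_in A z j : A != finset.setT -> j \in A ->
  lap (pol A z) j = T - z 0 j.
Proof.
move=> AT jA; have /colP/(_ j) := Kmx_pol z AT.
by rewrite KmxE obstacle_rhsE jA.
Qed.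

Lemma pol_out A z j : A != finset.setT -> j \notin A -> pol A z j 0 = 0.
Proof.
move=> AT jA; have /colP/(_ j) := Kmx_pol z AT.
by rewrite KmxE obstacle_rhsE (negPf jA).
Qed.

(** Crude, but one constant for all policies, depending neither on T nor on z. *)
Definition green_bound : R :=
  \sum_(A : {set 'I_n} | A != finset.setT) \sum_j \sum_i invmx (Kmx q A) j i.

Lemma green_bound_ge0 : 0 <= green_bound.
Proof.
apply: sumr_ge0 => A AT; apply: sumr_ge0 => j _; apply: sumr_ge0 => i _.
exact: invKmx_ge0.
Qed.

Lemma green_row A j : A != finset.setT ->
  \sum_i invmx (Kmx q A) j i <= green_bound.
Proof.
move=> AT; have p A' k : A' != finset.setT ->
    0 <= \sum_i invmx (Kmx q A') k i.
  by move=> AT'; apply: sumr_ge0 => i _; exact: invKmx_ge0.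
rewrite /green_bound (bigD1 A)//=.
apply: (@le_trans _ _ (\sum_k \sum_i invmx (Kmx q A) k i)).
  by rewrite [leRHS](bigD1 j)//= lerDl sumr_ge0// => k _; exact: p.
rewrite lerDl sumr_ge0// => A' /andP[AT' _].
by apply: sumr_ge0 => k _; exact: p.
Qed.

Lemma pol_upper A z j : A != finset.setT -> (forall i, 0 <= z 0 i) ->
  pol A z j 0 <= T * green_bound.
Proof.
move=> AT z0; rewrite mxE.
apply: (@le_trans _ _ (\sum_i T * invmx (Kmx q A) j i)).
  apply: ler_sum => i _; rewrite mxE [leRHS]mulrC.
  apply: ler_wpM2l; first exact: invKmx_ge0.
  by case: ifP => _; [rewrite lerBlDr lerDl|exact: ltW].
by rewrite -mulr_sumr ler_wpM2l ?(ltW T_gt0)// green_row.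
Qed.

(** The row sums of q balance its column sums; for the weights used below this is the invariance of
    m. *)
Lemma sum_lap f : \sum_j lap f j = 0.
Proof.
under eq_bigr do under eq_bigr do rewrite mulrBr.
under eq_bigr do rewrite sumrB; rewrite sumrB [X in _ - X]exchange_big/=.
rewrite -sumrB big1// => i _; rewrite -!mulr_suml.
by rewrite q_bal subrr.
Qed.

(* Policy improvement: the set maximising the total of its policy is optimal. *)
Lemma optimal_policy z : n%:R * T < \sum_j z 0 j ->
  exists A, [/\ A != finset.setT, forall j, 0 <= pol A z j 0 &
    forall l, T - z 0 l <= lap (pol A z) l].
Proof.
move=> Tz; have n0 : (0 < n)%N.
  case: n z Tz => // z; rewrite big_ord0 mul0r ltxx //.
have S0 : (finset.set0 : {set 'I_n}) != finset.setT.
  by apply/eqP => /setP/(_ (Ordinal n0)); rewrite !inE.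
pose A := [arg max_(A > (finset.set0 : {set 'I_n}) | A != finset.setT)
  (\sum_j pol A z j 0)]%O.
have [AT Amax] : A != finset.setT /\ forall A', A' != finset.setT ->
    \sum_j pol A' z j 0 <= \sum_j pol A z j 0.
  by rewrite /A; case: Order.TotalTheory.arg_maxP.
(* A policy dominating A pointwise cannot have a larger total, hence coincides with A. Each
   violation of optimality below yields such a policy with a nonzero residual at l. *)
have improve A' : A' != finset.setT ->
    (forall j, 0 <= (Kmx q A' *m (pol A' z - pol A z)) j 0) ->
    forall j, (Kmx q A' *m (pol A' z - pol A z)) j 0 = 0.
  move=> AT' K0 j; have d0 := Kmx_ge0 q_ge0 q_irr AT' K0.
  suff -> : pol A' z - pol A z = 0 by rewrite mulmx0 mxE.
  apply/colP => k; rewrite [RHS]mxE.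
  have sd : \sum_k (pol A' z - pol A z) k 0 = 0.
    apply/eqP; rewrite eq_le sumr_ge0 ?andbT//.
    by under eq_bigr do rewrite subE; rewrite sumrB subr_le0 Amax.
  exact: (psumr_eq0P (fun k _ => d0 k) sd).
have lapB f g j : lap (f - g) j = lap f j - lap g j.
  rewrite -sumrB; apply: eq_bigr => i _; rewrite !subE; ring.
exists A; split => //.
- move=> l; have [//|lneg] := leP 0 (pol A z l 0).
  have lA : l \in A.
    by apply: contraLR lneg => lA; rewrite pol_out// ltxx.
  (* Dropping l resets the negative value at l to 0 and leaves the equations of the other states of
     A untouched. *)
  have AT' : (A :\ l)%SET != finset.setT.
    by apply/eqP => /setP/(_ l); rewrite !inE eqxx.
  have KE j : (Kmx q (A :\ l)%SET *m (pol (A :\ l)%SET z - pol A z)) j 0 =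
      if j == l then - pol A z l 0 else 0.
    rewrite KmxE !inE; case: eqVneq => [->|jl] /=.
      by rewrite subE pol_out ?add0r// !inE eqxx.
    case: ifPn => jA; first by rewrite lapB !pol_in ?subrr ?inE ?jl.
    by rewrite subE !pol_out ?subr0// !inE (negPf jA) andbF.
  have K0 j : 0 <= (Kmx q (A :\ l)%SET *m (pol (A :\ l)%SET z - pol A z)) j 0.
    by rewrite KE; case: ifP => // _; rewrite oppr_ge0 ltW.
  have /eqP := improve _ AT' K0 l.
  by rewrite KE eqxx oppr_eq0 (lt_eqF lneg).
- move=> l; have [lA|lA] := boolP (l \in A); first by rewrite pol_in.
  have [//|lneg] := leP (T - z 0 l) (lap (pol A z) l).
  (* If l were the only state outside A, the Laplacian would be at most T - z at every state;
     summing, its total 0 would be at most n T - \sum_j z_j, which is negative. *)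
  have AT' : (l |: A)%SET != finset.setT.
    apply: contraPneq Tz => lAT; apply/negP; rewrite -leNgt -subr_ge0.
    have -> : n%:R * T - \sum_j z 0 j = \sum_j (T - z 0 j).
      by rewrite sumrB sumr_const card_ord mulr_natl.
    rewrite -[leLHS](sum_lap (pol A z)); apply: ler_sum => j _.
    have [->|jl] := eqVneq j l; first exact: ltW.
    rewrite pol_in//; have : j \in (l |: A)%SET by rewrite lAT inE.
    by rewrite !inE (negPf jl).
  have KE j : (Kmx q (l |: A)%SET *m (pol (l |: A)%SET z - pol A z)) j 0 =
      if j == l then T - z 0 l - lap (pol A z) l else 0.
    rewrite KmxE !inE; case: eqVneq => [->|jl] /=.
      by rewrite lapB pol_in// !inE eqxx.
    case: ifPn => jA.
      by rewrite lapB !pol_in ?subrr// !inE jA orbT.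
    by rewrite subE !pol_out ?subr0// !inE negb_or jl.
  have K0 j : 0 <= (Kmx q (l |: A)%SET *m (pol (l |: A)%SET z - pol A z)) j 0.
    by rewrite KE; case: ifP => // _; rewrite subr_ge0 ltW.
  have /eqP := improve _ AT' K0 l.
  by rewrite KE eqxx subr_eq0 (gt_eqF lneg).
Qed.

Section optimal.
Variables (z : 'rV[R]_n) (f : 'cV[R]_n).
Hypothesis f_ge0 : forall j, 0 <= f j 0.
Hypothesis f_super : forall l, T - z 0 l <= lap f l.

(** Comparison: [f] is a supersolution of the system of every policy. *)
Lemma pol_le A j : A != finset.setT -> pol A z j 0 <= f j 0.
Proof.
move=> AT; have : 0 <= (f - pol A z) j 0.
  apply: (Kmx_ge0 q_ge0 q_irr AT) => i; rewrite mulmxBr Kmx_pol// subE KmxE obstacle_rhsE.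
  by case: ifPn => _; rewrite ?subr0// subr_ge0 f_super.
by rewrite subE subr_ge0.
Qed.

(** If z_i <= T / 2, a nonnegative supersolution is at least T / (2 \sum_l q i l) at i, whereas a
    policy with i outside A is 0 there. The kernel of A carries this deficit from i to j: such a
    policy is well below [f] at j, unless i has no influence on j. *)
Lemma pol_gap A i j : A != finset.setT -> i \notin A -> z 0 i <= T / 2 ->
  pol A z j 0 + invmx (Kmx q A) j i * (T / (2 * \sum_l q i l)) <= f j 0.
Proof.
move=> AT iA zi.
have fi : T / (2 * \sum_l q i l) <= f i 0.
  have : T / 2 <= f i 0 * \sum_l q i l.
    apply: (@le_trans _ _ (lap f i)).
      by apply: le_trans (f_super i); lra.
    rewrite mulr_sumr; apply: ler_sum => l _; rewrite mulrC ler_wpM2r//.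
    by rewrite lerBlDr lerDl.
  by move=> h; rewrite invfM mulrA ler_pdivrMr ?q_gt0.
set c := T / _ in fi *.
have : 0 <= (f - pol A z - c *: (invmx (Kmx q A) *m delta_mx i 0)) j 0.
  apply: (Kmx_ge0 q_ge0 q_irr AT) => k.
  rewrite !mulmxBr Kmx_pol// -scalemxAr mulKVmx ?Kmx_unit//.
  rewrite !subE KmxE obstacle_rhsE scaleE mxE andbT.
  have [kA|kA] := boolP (k \in A).
    have -> : (k == i) = false by apply: contraNF iA => /eqP <-.
    by rewrite mulr0 subr0 subr_ge0 f_super.
  rewrite subr0; case: eqP => [->|_]; rewrite ?mulr1 ?mulr0 ?subr0//=.
  by rewrite subr_ge0.
rewrite -colE !subE scaleE [col _ _ _ _]mxE; lra.
Qed.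

End optimal.

(** The linear part of the affine map z -> [pol A z]. *)
Definition dpol A (v : 'rV[R]_n) : 'cV[R]_n :=
  invmx (Kmx q A) *m \col_j if j \in A then - v 0 j else 0.

Lemma polD A z v h : pol A (z + h *: v) = pol A z + h *: dpol A v.
Proof.
rewrite /pol /dpol scalemxAr -mulmxDr; congr (_ *m _).
apply/colP => j; rewrite !mxE; case: ifP => _; lra.
Qed.

(* The direction along which moving changes the i-th obstacle equation only. *)
Definition balance_vector (i : 'I_n) : 'rV[R]_n :=
  \row_k (q k i - (k == i)%:R * \sum_l q i l).

End obstacle.

(** * Smoothed maxima *)

Section directional_derivative.
Context {R : realType} {V : normedModType R}.
Implicit Types (f : V -> R) (x v : V).

Lemma is_deriveE f x v d : is_derive x v f d <->
  h^-1 * (f (h *: v + x) - f x) @[h --> 0^'] --> d.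
Proof.
split=> [[fxv <-]|fd]; first exact: fxv.
have fxv : derivable f x v by apply/cvg_ex; exists d.
by split => //; exact: cvg_lim.
Qed.

Lemma is_derive_line f x v t d :
  is_derive (t *: v + x) v f d <-> is_derive t 1 (fun h : R => f (h *: v + x)) d.
Proof.
rewrite is_deriveE; suff -> : is_derive t 1 (fun h : R => f (h *: v + x)) d <->
  h^-1 * (f ((h *: 1 + t) *: v + x) - f (t *: v + x)) @[h --> 0^'] --> d.
  suff -> : (fun h => h^-1 * (f ((h *: 1 + t) *: v + x) - f (t *: v + x))) =
    (fun h => h^-1 * (f (h *: v + (t *: v + x)) - f (t *: v + x))) by [].
  by apply/funext => h; rewrite scalerDl -addrA [h *: 1]mulr1.
split=> [[fxv <-]|fd]; first exact: fxv.
have fxv : derivable (fun h : R => f (h *: v + x)) t 1 by apply/cvg_ex; exists d.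
by split => //; exact: cvg_lim.
Qed.

Lemma is_derive_compR (g : R -> R) f x v a d :
  is_derive (f x) 1 g a -> is_derive x v f d ->
  is_derive x v (fun y => g (f y)) (a * d).
Proof.
move=> ga fd; have := fd; rewrite -[x]add0r -[0](scale0r v).
move=> /is_derive_line f0; apply/is_derive_line.
apply: (@is_derive1_comp _ g (fun h : R => f (h *: v + x))) => //.
by rewrite scale0r add0r.
Qed.

Lemma is_deriveD_pt f g x v a b : is_derive x v f a -> is_derive x v g b ->
  is_derive x v (fun y => f y + g y) (a + b).
Proof. exact: is_deriveD. Qed.

Lemma is_deriveB_pt f g x v a b : is_derive x v f a -> is_derive x v g b ->
  is_derive x v (fun y => f y - g y) (a - b).
Proof. exact: is_deriveB. Qed.

Lemma is_deriveZ_pt f x v c a : is_derive x v f a ->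
  is_derive x v (fun y => c * f y) (c * a).
Proof. exact: is_deriveZ. Qed.

Lemma is_deriveM_pt f g x v a b : is_derive x v f a -> is_derive x v g b ->
  is_derive x v (fun y => f y * g y) (f x * b + g x * a).
Proof. exact: is_deriveM. Qed.

Lemma is_derive_sum_pt m (f : 'I_m -> V -> R) x v (a : 'I_m -> R) :
  (forall i, is_derive x v (f i) (a i)) ->
  is_derive x v (fun y => \sum_i f i y) (\sum_i a i).
Proof.
move=> fa; have := is_derive_sum fa; congr (is_derive _ _ _ _).
by apply/funext => y; rewrite fct_sumE.
Qed.

End directional_derivative.

Section smooth_max.
Context {R : realType}.
Implicit Types s : R.

Definition pospart s : R := Num.max 0 s.

Lemma pospart_pow_derive k s :
  is_derive s 1 (fun u => pospart u ^+ k.+2) (k.+2%:R * pospart s ^+ k.+1).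
Proof.
have [s0|s0|->] := ltgtP s 0.
- rewrite /pospart max_l ?ltW// expr0n/= mulr0.
  apply: (@near_eq_is_derive _ _ _ (cst 0)).
  near=> u; rewrite max_l ?expr0n// ltW//; near: u; exact: lt_nbhsl.
- rewrite /pospart max_r ?ltW//.
  have pw : is_derive s 1 (@GRing.exp R ^~ k.+2) (k.+2%:R * s ^+ k.+1).
    split; first exact: exprn_derivable.
    by rewrite exp_derive [LHS]mulr1.
  apply: (near_eq_is_derive _ pw).
  near=> u; rewrite max_r// ltW//; near: u; exact: lt_nbhsr.
- rewrite /pospart maxxx expr0n/= mulr0; apply/is_deriveE.
  apply/cvgr0Pnorm_le => e e0; near=> h.
  rewrite addr0 [h *: 1]mulr1 maxxx expr0n/= subr0.
  have h0 : h != 0 by near: h; exact: nbhs_dnbhs_neq.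
  have hm : Num.max 0 h <= `|h| by rewrite ge_max normr_ge0 ler_norm.
  have h1 : `|h| < Num.min 1 e.
    near: h; apply: dnbhs0_lt; rewrite lt_min ltr01//.
  rewrite normrM normfV ler_pdivrMl ?normr_gt0// normrX.
  have -> : `|Num.max 0 h| = Num.max 0 h by rewrite ger0_norm// le_max lexx.
  have m0 : 0 <= Num.max 0 h by rewrite le_max lexx.
  move: h1; rewrite lt_min => /andP[h1 he].
  apply: (@le_trans _ _ (`|h| ^+ k.+2)); first by rewrite lerXn2r ?nnegrE.
  rewrite exprS ler_wpM2l// exprS -[leRHS]mulr1 ler_pM ?(ltW he)//.
  exact/exprn_ile1/ltW.
Unshelve. all: by end_near. Qed.

(* A C^2 approximation of the positive part, equal to it off ]-1, 1[. *)
Definition rho s : R :=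
  (pospart (s + 1) ^+ 3 - 2 * pospart s ^+ 3 + pospart (s - 1) ^+ 3) / 6.
Definition rho1 s : R :=
  (pospart (s + 1) ^+ 2 - 2 * pospart s ^+ 2 + pospart (s - 1) ^+ 2) / 2.
(** The hat function on [-1, 1]; [rho] is the convolution of the positive part with it. *)
Definition rho2 s : R := pospart (s + 1) - 2 * pospart s + pospart (s - 1).

Lemma pospart_continuous : continuous pospart.
Proof. by move=> s; apply: continuous_max; [exact: cvg_cst|exact: cvg_id]. Qed.

Lemma rho_derive s : is_derive s 1 rho (rho1 s).
Proof.
have p c : is_derive s 1 (fun u => pospart (u + c) ^+ 3)
    (3%:R * pospart (s + c) ^+ 2 * 1).
  apply: (@is_derive_compR _ R (fun u => pospart u ^+ 3) (fun u => u + c)).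
    exact: pospart_pow_derive.
  exact: is_derive_shift.
have p0 := pospart_pow_derive 1 s.
have -> : rho = fun u => 6^-1 * (pospart (u + 1) ^+ 3
    - 2 * pospart u ^+ 3 + pospart (u + -1) ^+ 3).
  by apply/funext => u; rewrite mulrC.
apply: (is_derive_eq (is_deriveZ_pt 6^-1 (is_deriveD_pt (is_deriveB_pt (p 1)
  (is_deriveZ_pt 2 p0)) (p (-1))))); rewrite /rho1 /=; set a := pospart _; set b := pospart _; set c := pospart _.
by field.
Qed.

Lemma rho1_derive s : is_derive s 1 rho1 (rho2 s).
Proof.
have p c : is_derive s 1 (fun u => pospart (u + c) ^+ 2)
    (2%:R * pospart (s + c) ^+ 1 * 1).
  apply: (@is_derive_compR _ R (fun u => pospart u ^+ 2) (fun u => u + c)).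
    exact: pospart_pow_derive.
  exact: is_derive_shift.
have p0 := pospart_pow_derive 0 s.
have -> : rho1 = fun u => 2^-1 * (pospart (u + 1) ^+ 2
    - 2 * pospart u ^+ 2 + pospart (u + -1) ^+ 2).
  by apply/funext => u; rewrite mulrC.
apply: (is_derive_eq (is_deriveZ_pt 2^-1 (is_deriveD_pt (is_deriveB_pt (p 1)
  (is_deriveZ_pt 2 p0)) (p (-1))))); rewrite /rho2 /=; set a := pospart _; set b := pospart _; set c := pospart _.
by field.
Qed.

Lemma rho2_continuous : continuous rho2.
Proof.
have pc c : continuous (fun u : R => pospart (u + c)).
  move=> u; apply: (@continuous_comp R R R (fun u => u + c) pospart).
    by apply: cvgD; [exact: cvg_id|exact: cvg_cst].
  exact: pospart_continuous.
move=> s; apply: cvgD; last exact: pc.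
apply: cvgB; first exact: pc.
by apply: cvgM; [exact: cvg_cst|exact: pospart_continuous].
Qed.

Let pp0 s : s <= 0 -> pospart s = 0. Proof. by move=> s0; rewrite /pospart max_l. Qed.
Let ppE s : 0 <= s -> pospart s = s. Proof. by move=> s0; rewrite /pospart max_r. Qed.

Lemma rho_high s : 1 <= s -> [/\ rho s = s, rho1 s = 1 & rho2 s = 0].
Proof.
by move=> s1; rewrite /rho /rho1 /rho2 !ppE; try lra; split; field.
Qed.

Lemma rho_low s : s <= -1 -> [/\ rho s = 0, rho1 s = 0 & rho2 s = 0].
Proof.
by move=> s1; rewrite /rho /rho1 /rho2 !pp0; try lra; split; field.
Qed.

Lemma rho_bounds s :
  [/\ pospart s <= rho s, rho s <= pospart s + 1, 0 <= rho1 s <= 1 &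
      `|rho2 s| <= 1].
Proof.
have [s1|s1] := leP 1 s.
  by have [-> -> ->] := rho_high s1; rewrite (ppE (le_trans ler01 s1)) normr0; split; lra.
have [s2|s2] := leP s (-1).
  by have [-> -> ->] := rho_low s2; rewrite (pp0 (le_trans s2 (lerN10 _))) normr0; split; lra.
have pw (h : R) : 0 <= h <= 1 -> [/\ 0 <= h ^+ 2, h ^+ 2 <= 1, 0 <= h ^+ 3 &
    h ^+ 3 <= 1].
  by move=> /andP[h0 h1]; rewrite !exprn_ge0 ?exprn_ile1.
have [s0|s0] := leP 0 s; rewrite /rho /rho1 /rho2.
- have [|h2 h2' h3 h3'] := pw (1 - s); first by lra.
  rewrite (ppE s0) (@ppE (s + 1)) ?(@pp0 (s - 1)); try lra.
  by split; rewrite ?ler_norml; lra.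
- have [|h2 h2' h3 h3'] := pw (s + 1); first by lra.
  rewrite (pp0 (ltW s0)) (@ppE (s + 1)) ?(@pp0 (s - 1)); try lra.
  by split; rewrite ?ler_norml; lra.
Qed.

End smooth_max.

Section smooth_max_family.
Context {R : realType} {I : eqType}.
Implicit Types (s : seq I) (l d e : I -> R).

(** This iterates max(a, b) = a + (b - a)^+ with [rho] in place of the positive part, at a cost of
    at most 1 per entry. The value 0 of the empty list takes part in the maximum. *)
Fixpoint softmax s l : R :=
  if s is i :: s' then l i + rho (softmax s' l - l i) else 0.

(* First and second derivatives of softmax s l when d and e are the derivatives of
   l along two directions and the second derivatives of l vanish. *)
Fixpoint softmax1 s l d : R :=
  if s is i :: s' then d i + rho1 (softmax s' l - l i) * (softmax1 s' l d - d i) else 0.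

Fixpoint softmax2 s l d e : R :=
  if s is i :: s' then
    rho2 (softmax s' l - l i) * (softmax1 s' l e - e i) * (softmax1 s' l d - d i) +
    rho1 (softmax s' l - l i) * softmax2 s' l d e
  else 0.

Lemma softmax_ge_cons i s l : l i <= softmax (i :: s) l /\ softmax s l <= softmax (i :: s) l.
Proof.
have [h _ _ _] := rho_bounds (softmax s l - l i); move: h => /=.
by rewrite /pospart ge_max => /andP[h1 h2]; split; lra.
Qed.

Lemma softmax_ge0 s l : 0 <= softmax s l.
Proof.
by elim: s => // i s IH; apply: le_trans IH _; have [] := softmax_ge_cons i s l.
Qed.

Lemma softmax_ge s l i : i \in s -> l i <= softmax s l.
Proof.
elim: s => // k s IH; rewrite in_cons => /orP[/eqP ->|/IH li].
  by have [] := softmax_ge_cons k s l.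
by apply: le_trans li _; have [] := softmax_ge_cons k s l.
Qed.

Lemma softmax_le s l M : 0 <= M -> {in s, forall i, l i <= M} ->
  softmax s l <= M + (size s)%:R.
Proof.
move=> M0; elim: s => [|i s IH] lM; first by rewrite addr0.
have {}IH : softmax s l <= M + (size s)%:R.
  by apply: IH => k ks; rewrite lM// in_cons ks orbT.
have li : l i <= M by rewrite lM// mem_head.
have [_ h _ _] := rho_bounds (softmax s l - l i).
rewrite /= -[(size s).+1%:R]natr1; have := ler0n R (size s); set N := (size s)%:R in IH *.
by move: h; rewrite /pospart; have [_|_] := leP 0 (softmax s l - l i) => h N0; lra.
Qed.

Lemma softmax1_le s l d C : 0 <= C -> (forall i, `|d i| <= C) -> `|softmax1 s l d| <= C.
Proof.
move=> C0 dC; elim: s => [|i s IH] /=; first by rewrite normr0.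
have [_ _ /andP[r0 r1] _] := rho_bounds (softmax s l - l i).
move: IH (dC i); set x := softmax1 _ _ _; set y := d i; set r := rho1 _ in r0 r1 *.
rewrite !ler_norml => /andP[x1 x2] /andP[y1 y2].
by apply/andP; split; nra.
Qed.

Lemma softmax2_le s l d e C : 0 <= C -> (forall i, `|d i| <= C) ->
  (forall i, `|e i| <= C) -> `|softmax2 s l d e| <= (size s)%:R * (2 * C) ^+ 2.
Proof.
move=> C0 dC eC; elim: s => [|i s IH] /=; first by rewrite normr0 mul0r.
have [_ _ /andP[r0 r1] r2] := rho_bounds (softmax s l - l i).
rewrite -natr1 [leRHS]mulrDl mul1r [leRHS]addrC.
apply: (le_trans (ler_normD _ _)); apply: lerD; last first.
  rewrite normrM ger0_norm// -[leRHS]mul1r ler_pM//.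
have b f : (forall i, `|f i| <= C) -> `|softmax1 s l f - f i| <= 2 * C.
  move=> fC; apply: (le_trans (ler_normB _ _)).
  by have := softmax1_le s l C0 fC; have := fC i; lra.
by rewrite expr2 !normrM -[leRHS]mul1r -mulrA !ler_pM// ?mulr_ge0// b.
Qed.

(* Entries far below the maximum do not contribute to the derivatives. *)
Lemma softmax_dominant s l d e t dl el :
  0 <= t \/ dl = 0 /\ el = 0 ->
  {in s, forall i, l i <= t \/ d i = dl /\ e i = el} ->
  [/\ softmax1 s l d = dl, softmax1 s l e = el & softmax2 s l d e = 0] \/
  softmax s l <= t + 2 * (size s)%:R.
Proof.
move=> t0; elim: s => [|i s IH] H.
  (* The base value 0 acts as one more entry, with zero derivatives: either it lies below t, or its
     derivatives agree with [dl] and [el]. *)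
  by rewrite mulr0 addr0; case: t0 => [|[-> ->]]; [right|left].
have {}IH : [/\ softmax1 s l d = dl, softmax1 s l e = el & softmax2 s l d e = 0] \/
    softmax s l <= t + 2 * (size s)%:R.
  by apply: IH => k ks; apply: H; rewrite in_cons ks orbT.
have {}H := H i (mem_head _ _).
rewrite /= -[(size s).+1%:R]natr1; have := ler0n R (size s); set N := (size s)%:R in IH * => N0.
have [_ rb _ _] := rho_bounds (softmax s l - l i).
(* Three regimes of [rho]: the head wins, the tail wins, or they are within 1 of each other. In the
   last one either both carry the derivatives [dl] and [el], or one of them is below its level and
   the smoothed maximum exceeds that level by at most 2. *)
have [lo|hi] := leP (softmax s l - l i) (-1).
  have [r0 r1 r2] := rho_low lo; rewrite r0 r1 r2 !mul0r !addr0.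
  case: H => [lt|[-> ->]]; [right; lra|by left].
have [hi1|lo1] := leP 1 (softmax s l - l i).
  have [r0 r1 r2] := rho_high hi1; rewrite r0 r1 r2 !mul0r !mul1r add0r.
  case: IH => [[-> -> ->]|le]; [left; split; ring|right; lra].
have pp : pospart (softmax s l - l i) <= 1 by rewrite /pospart ge_max ler01 ltW.
have pp2 : l i + pospart (softmax s l - l i) <= softmax s l + 1.
  by rewrite /pospart; have [_|_] := leP 0 (softmax s l - l i); lra.
case: H => [lt|[de ee]]; first by right; lra.
case: IH => [[-> -> ->]|le]; last by right; lra.
by left; rewrite de ee !subrr !mulr0 !addr0.
Qed.

Context {V : normedModType R}.

Lemma softmax_derive (l : V -> I -> R) d v s x : (forall i, is_derive x v (l ^~ i) (d i)) ->
  is_derive x v (fun y => softmax s (l y)) (softmax1 s (l x) d).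
Proof.
move=> lv; elim: s => [|i s IH] /=; first exact: is_derive_cst.
apply: is_deriveD_pt => //; apply: is_derive_compR; first exact: rho_derive.
Qed.

Variables (l : V -> I -> R) (d e : I -> R) (v w : V).

Lemma softmax1_derive s x : (forall i, is_derive x w (l ^~ i) (e i)) ->
  is_derive x w (fun y => softmax1 s (l y) d) (softmax2 s (l x) d e).
Proof.
move=> lw; elim: s => [|i s IH] /=; first exact: is_derive_cst.
have dr : is_derive x w (fun y => rho1 (softmax s (l y) - l y i))
    (rho2 (softmax s (l x) - l x i) * (softmax1 s (l x) e - e i)).
  apply: is_derive_compR; first exact: rho1_derive.
  apply: is_deriveB_pt => //; exact: softmax_derive.
have dc : is_derive x w (fun=> d i) 0 by exact: is_derive_cst.
apply: (is_derive_eq (is_deriveD_pt dc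
  (is_deriveM_pt dr (is_deriveB_pt IH dc)))).
ring.
Qed.

Lemma softmax_continuous s : (forall i, continuous (l ^~ i)) ->
  [/\ continuous (fun y => softmax s (l y)), continuous (fun y => softmax1 s (l y) d),
      continuous (fun y => softmax1 s (l y) e) &
      continuous (fun y => softmax2 s (l y) d e)].
Proof.
move=> lc.
have rc0 : continuous (@rho R).
  move=> u; apply/differentiable_continuous/derivable1_diffP.
  by case: (rho_derive u).
have rc1 : continuous (@rho1 R).
  move=> u; apply/differentiable_continuous/derivable1_diffP.
  by case: (rho1_derive u).
have comp f : continuous f -> [/\ continuous (fun y : V => rho (f y : R)),
    continuous (fun y => rho1 (f y)) & continuous (fun y => rho2 (f y))].
  move=> fc; split=> u; apply: continuous_comp; do ?exact: fc;
    [exact: rc0|exact: rc1|exact: rho2_continuous].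
elim: s => [|i s [c0 c1 c1' c2]] /=; first by split => u; exact: cst_continuous.
have [] := comp (fun y => softmax s (l y) - l y i).
  by move=> u; apply: cvgB; [exact: c0|exact: lc].
move=> k0 k1 k2; split=> u.
- by apply: cvgD; [exact: lc|exact: k0].
- apply: cvgD; first exact: cvg_cst.
  by apply: cvgM; [exact: k1|apply: cvgB; [exact: c1|exact: cvg_cst]].
- apply: cvgD; first exact: cvg_cst.
  by apply: cvgM; [exact: k1|apply: cvgB; [exact: c1'|exact: cvg_cst]].
- apply: cvgD; last by apply: cvgM; [exact: k1|exact: c2].
  apply: cvgM; last by apply: cvgB; [exact: c1|exact: cvg_cst].
  by apply: cvgM; [exact: k2|apply: cvgB; [exact: c1'|exact: cvg_cst]].
Qed.

End smooth_max_family.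

Lemma exists_strict_ub (R : realType) (I : finType) (F : I -> R) :
  exists2 M, 0 < M & forall i, F i < M.
Proof.
exists (1 + \sum_i `|F i|).
  by rewrite ltr_wpDr// sumr_ge0.
move=> i; rewrite (bigD1 i)//=; apply: (@le_lt_trans _ _ `|F i|).
  exact: ler_norm.
have : 0 <= \sum_(j | j != i) `|F j| by rewrite sumr_ge0.
by move=> h; lra.
Qed.

Lemma cvg_sum_pt (R : realType) (U : Type) (F : set_system U) {FF : Filter F}
    m (f : 'I_m -> U -> R) (l : 'I_m -> R) :
  (forall i, f i x @[x --> F] --> l i) ->
  \sum_i f i x @[x --> F] --> \sum_i l i.
Proof.
elim: m f l => [|m IH] f l fl.
  by under eq_fun do rewrite big_ord0; rewrite big_ord0; exact: cvg_cst.
under eq_fun do rewrite big_ord_recr; rewrite big_ord_recr/=.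
by apply: cvgD => //; apply: IH => i; exact: fl.
Qed.

(** * The smoothed solution of the obstacle problem *)

Section smoothed_obstacle.
Context {R : realType} {n : nat}.
Variable q : 'I_n -> 'I_n -> R.
Hypothesis q_ge0 : forall i j, 0 <= q i j.
Hypothesis q_irr : irreducible_rates q.
Hypothesis q_bal : forall i, \sum_j q j i = \sum_j q i j.
Hypothesis q_gt0 : forall i, 0 < \sum_j q i j.

Let props := enum [pred A : {set 'I_n} | A != finset.setT].
Let N : R := (size props)%:R.

Let propsP A : (A \in props) = (A != finset.setT).
Proof. by rewrite mem_enum inE. Qed.

Definition envelope T j (z : 'rV[R]_n) := softmax props (fun A => pol q T A z j 0).
Definition envelope1 T j v (z : 'rV[R]_n) :=
  softmax1 props (fun A => pol q T A z j 0) (fun A => dpol q A v j 0).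
Definition envelope2 T j v w (z : 'rV[R]_n) :=
  softmax2 props (fun A => pol q T A z j 0) (fun A => dpol q A v j 0)
    (fun A => dpol q A w j 0).

Let pol_derive T A j v z :
  is_derive z v (fun y => pol q T A y j 0) (dpol q A v j 0).
Proof.
apply/is_deriveE; apply: cvg_near_cst; near=> h.
have E (u u' : 'cV[R]_n) : (u + h *: u') j 0 = u j 0 + h * u' j 0.
  by rewrite !mxE.
rewrite [h *: v + z]addrC polD E addrC addKr mulKf//.
near: h; exact: nbhs_dnbhs_neq.
Unshelve. all: by end_near. Qed.

Lemma envelope_derive T j v z : is_derive z v (envelope T j) (envelope1 T j v z).
Proof. by apply: (softmax_derive (l := fun z A => pol q T A z j 0)) => A. Qed.

Lemma envelope1_derive T j v w z :
  is_derive z w (envelope1 T j v) (envelope2 T j v w z).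
Proof. by apply: (softmax1_derive (l := fun z A => pol q T A z j 0)) => A. Qed.

Lemma envelope_continuous T j v w : [/\ continuous (envelope T j),
  continuous (envelope1 T j v) & continuous (envelope2 T j v w)].
Proof.
have [|c0 c1 _ c2] := @softmax_continuous R _ _ (fun z A => pol q T A z j 0)
  (fun A => dpol q A v j 0) (fun A => dpol q A w j 0) props; last by split.
move=> A z; have -> : (fun z => pol q T A z j 0) = fun z : 'rV[R]_n =>
    \sum_i invmx (Kmx q A) j i * (if i \in A then T - z 0 i else 0).
  by apply/funext => y; rewrite mxE; apply: eq_bigr => i _; rewrite mxE.
apply: (cvg_sum_pt (FF := nbhs_filter z)) => i; apply: cvgM; first exact: cvg_cst.
case: ifP => _; last exact: cvg_cst.
by apply: cvgB; [exact: cvg_cst|exact: coord_continuous].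
Qed.

Lemma envelope1_bounded T v w : exists C, forall j z,
  `|envelope1 T j v z| <= C /\ `|envelope2 T j v w z| <= C.
Proof.
have [C C0 hC] := exists_strict_ub
  (fun p : {set 'I_n} * 'I_n * bool =>
     `|dpol q p.1.1 (if p.2 then v else w) p.1.2 0|).
have hv j A : `|dpol q A v j 0| <= C by rewrite ltW// (hC (A, j, true)).
have hw j A : `|dpol q A w j 0| <= C by rewrite ltW// (hC (A, j, false)).
exists (C + N * (2 * C) ^+ 2) => j z; split.
  apply: (le_trans (softmax1_le _ _ (ltW C0) (hv j))).
  by rewrite lerDl mulr_ge0 ?sqr_ge0.
by apply: (le_trans (softmax2_le _ _ (ltW C0) (hv j) (hw j))); rewrite lerDr ltW.
Qed.

(** On A, [- balance_vector q i] is the Laplacian of the indicator of i, so the value moves by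
    exactly this indicator, up to the boundary contribution of i when i is outside A. *)
Lemma dpol_bvec A i j : A != finset.setT ->
  dpol q A (balance_vector q i) j 0 = (j == i)%:R - (i \notin A)%:R * invmx (Kmx q A) j i.
Proof.
move=> AT; pose e : 'cV[R]_n := delta_mx i 0.
have -> : dpol q A (balance_vector q i) = invmx (Kmx q A) *m (Kmx q A *m e -
    (i \notin A)%:R *: e).
  congr (_ *m _); apply/colP => k; rewrite -colE !mxE andbT [i == k]eq_sym.
  have [kA|kA] := boolP (k \in A).
    have [ki|ki] := eqVneq k i; last by rewrite mulr0 !mul0r subr0 sub0r subr0.
    by rewrite -ki kA mul0r subr0 opprB.
  have [ki|ki] := eqVneq k i; last by rewrite mulr0 subr0.
  by rewrite -ki kA mulr1 subrr.
rewrite mulmxBr mulKmx ?Kmx_unit// -scalemxAr -colE.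
by rewrite !mxE andbT.
Qed.

Variable T : R.
Hypothesis T_gt0 : 0 < T.
Hypothesis T_gap : forall A i j, A != finset.setT ->
  invmx (Kmx q A) j i = 0 \/
  2 * N + 1 <= invmx (Kmx q A) j i * (T / (2 * \sum_l q i l)).
Hypothesis T_self : forall i, 2 * N + 1 <= T / (2 * \sum_l q i l).
Hypothesis T_pos : forall i, N * \sum_l q i l < T.

Lemma envelope_ge0 j z : 0 <= envelope T j z.
Proof. exact: softmax_ge0. Qed.

Lemma envelope_le j (z : 'rV[R]_n) : (forall i, 0 <= z 0 i) -> envelope T j z <= T * green_bound q + N.
Proof.
move=> z0; apply: softmax_le.
  by apply: mulr_ge0; [exact: ltW|exact: green_bound_ge0].
by move=> A; rewrite propsP => AT; exact: pol_upper.
Qed.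

(** The optimal policy lifts coordinate k to at least T. The smoothed maximum exceeds it by an
    amount between 0 and N in each entry, which lowers the Laplacian by at most N \sum_l q k l, less
    than T. *)
Lemma envelope_pos (z : 'rV[R]_n) k : (forall i, 0 <= z 0 i) -> n%:R * T < \sum_j z 0 j ->
  0 < z 0 k + \sum_i q k i * (envelope T k z - envelope T i z).
Proof.
move=> z0 Tz; have [A [AT A0 AS]] := optimal_policy q_ge0 q_irr q_bal Tz.
set f := pol q T A z in A0 AS.
have fl j : f j 0 <= envelope T j z.
  by apply: (@softmax_ge _ _ props (fun A => pol q T A z j 0)); rewrite propsP.
have fu j : envelope T j z <= f j 0 + N.
  apply: softmax_le => // A'; rewrite propsP => AT'.
  exact: (pol_le q_ge0 q_irr A0 AS).
apply: (@lt_le_trans _ _ (T - N * \sum_l q k l)); first by rewrite subr_gt0.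
apply: (@le_trans _ _ (z 0 k + \sum_i q k i * (f k 0 - f i 0 - N))).
  under [X in _ <= _ + X]eq_bigr do rewrite mulrBr.
  by rewrite sumrB -mulr_suml; have := AS k; lra.
rewrite lerD2l; apply: ler_sum => i _; rewrite ler_wpM2l//.
by have := fl k; have := fu i; lra.
Qed.

(** At j, each policy either moves like the indicator of i or lies too far below the maximum to
    enter the derivative of the smoothed maximum. *)
Lemma envelope1_bvec (z : 'rV[R]_n) i j : (forall i, 0 <= z 0 i) -> n%:R * T < \sum_j z 0 j ->
  z 0 i <= T / 2 -> envelope1 T j (balance_vector q i) z = (j == i)%:R.
Proof.
move=> z0 Tz zi.
have [A [AT A0 AS]] := optimal_policy q_ge0 q_irr q_bal Tz.
set f := pol q T A z in A0 AS.
have fl : f j 0 <= envelope T j z.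
  by apply: (@softmax_ge _ _ props (fun A => pol q T A z j 0)); rewrite propsP.
(* The loss in [softmax_dominant] is 2 N; the extra 1 makes the final contradiction strict. *)
pose t := f j 0 - (2 * N + 1).
have n0 : finset.set0 != [set: 'I_n]%SET.
  by apply/eqP => /setP/(_ i); rewrite !inE.
(* The gap relative to the empty policy, whose value is 0 and whose kernel is the identity. For j =
   i it puts the base value 0 of the maximum below t. *)
have fi : T / (2 * \sum_l q i l) <= f i 0.
  have := @pol_gap _ _ _ q_ge0 q_irr q_gt0 _ _ _ A0 AS _ i i n0.
  rewrite inE => /(_ isT zi); rewrite pol_out ?inE// add0r.
  suff -> : invmx (Kmx q finset.set0) = 1%:M by rewrite mxE eqxx mul1r.
  suff -> : Kmx q finset.set0 = 1%:M by rewrite invmx1.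
  by apply/matrixP => a b; rewrite !mxE inE eq_sym.
have base : 0 <= t \/ (j == i)%:R = 0 :> R /\ (j == i)%:R = 0 :> R.
  have [ji|ji] := eqVneq j i; last by right.
  by left; rewrite /t ji subr_ge0; apply: le_trans fi.
have [|[d1 _ _]|] := @softmax_dominant R _ props (fun A => pol q T A z j 0)
  (fun A => dpol q A (balance_vector q i) j 0) (fun A => dpol q A (balance_vector q i) j 0)
  t (j == i)%:R (j == i)%:R base.
  move=> A'; rewrite propsP => AT'; rewrite dpol_bvec//.
  have [iA|iA] := boolP (i \in A'); first by right; rewrite mul0r subr0.
  rewrite mul1r; have [->|gap] := T_gap i j AT'; first by right; rewrite subr0.
  left; rewrite lerBrDr.
  by have := pol_gap q_ge0 q_irr q_gt0 A0 AS j AT' iA zi; apply: le_trans; rewrite lerD2l.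
  by [].
rewrite -/N -/(envelope T j z) => le; exfalso.
by move: fl le; rewrite /t; lra.
Qed.

(** With so much mass at j, imposing the equation at j requires a value so negative that the base
    value 0 hides it; the policies with j outside A are constantly 0 at j. The smoothed maximum is
    therefore flat there. *)
Lemma envelope1_far (z : 'rV[R]_n) j v w : (forall i, 0 <= z 0 i) ->
  T + (\sum_l q j l) * (T * green_bound q + 2 * N + 1) <= z 0 j ->
  envelope1 T j v z = 0 /\ envelope2 T j v w z = 0.
Proof.
move=> z0 zj.
have [||[d1 _ d2]|] := @softmax_dominant R _ props (fun A => pol q T A z j 0)
  (fun A => dpol q A v j 0) (fun A => dpol q A w j 0) (- (2 * N + 1)) 0 0.
- by right.
- move=> A; rewrite propsP => AT.
  have [jA|jA] := boolP (j \in A); last first.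
    right; rewrite /dpol.
    have out u : (invmx (Kmx q A) *m \col_k (if k \in A then - u 0 k else 0)) j 0
        = (Kmx q A *m (invmx (Kmx q A) *m
            \col_k (if k \in A then - u 0 k else 0))) j 0 :> R.
      by rewrite KmxE (negPf jA).
    by rewrite !out !mulKVmx ?Kmx_unit// !mxE (negPf jA).
  left; have := pol_in q_ge0 q_irr T z AT jA.
  under eq_bigr do rewrite mulrBr.
  rewrite sumrB -mulr_suml => e.
  have : \sum_i q j i * pol q T A z i 0 <= (\sum_l q j l) * (T * green_bound q).
    rewrite mulr_suml; apply: ler_sum => i _; rewrite ler_wpM2l//.
    exact: pol_upper.
  move: (q_gt0 j) e zj; set L := \sum_l q j l; set s := \sum_i _.
  set p := pol _ _ _ _ _ _; set G := T * _ => L0 e zj sG.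
  have : L * p <= L * (- (2 * N + 1)) by lra.
  by rewrite ler_pM2l.
- by split.
- rewrite -/N -/(envelope T j z) => le; exfalso.
  have := envelope_ge0 j z; lra.
Qed.

End smoothed_obstacle.

Lemma continuous_scale (R : realType) (V : topologicalType) (f : V -> R) c :
  continuous f -> continuous (fun z => c * f z).
Proof. by move=> fc z; apply: cvgM; [exact: cvg_cst|exact: fc]. Qed.

Section exists_threshold.
Context {R : realType} {n : nat}.
Variable q : 'I_n -> 'I_n -> R.
Hypothesis q_ge0 : forall i j, 0 <= q i j.
Hypothesis q_irr : irreducible_rates q.
Hypothesis q_gt0 : forall i, 0 < \sum_j q i j.

(** The kernels do not involve T, so all conditions are lower bounds on T in terms of q and N. The
    level 2 N + 1 exceeds the loss 2 N of [softmax_dominant] over N entries. *)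
Lemma exists_threshold (N : R) : 0 <= N -> exists T, [/\ 0 < T,
  forall A i j, A != finset.setT -> invmx (Kmx q A) j i = 0 \/
    2 * N + 1 <= invmx (Kmx q A) j i * (T / (2 * \sum_l q i l)),
  forall i, 2 * N + 1 <= T / (2 * \sum_l q i l) &
  forall i, N * \sum_l q i l < T].
Proof.
move=> N0; pose b i := (2 * N + 1) * (2 * \sum_l q i l).
have [T1 T10 h1] := exists_strict_ub
  (fun p : {set 'I_n} * 'I_n * 'I_n => b p.1.2 / invmx (Kmx q p.1.1) p.2 p.1.2).
have [T2 T20 h2] := exists_strict_ub b.
have [T3 T30 h3] := exists_strict_ub (fun i => N * \sum_l q i l).
have le_div T i : b i <= T -> 2 * N + 1 <= T / (2 * \sum_l q i l).
  by rewrite ler_pdivlMr// mulr_gt0.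
exists (T1 + T2 + T3); split; first by rewrite !addr_gt0.
- move=> A i j AT; have [->|K0] := eqVneq (invmx (Kmx q A) j i) 0; first by left.
  right; rewrite mulrA; apply: le_div; rewrite mulrC -ler_pdivrMr.
    by have := h1 (A, i, j); rewrite /= => /ltW/le_trans; apply; lra.
  by rewrite lt_neqAle eq_sym K0 invKmx_ge0.
- by move=> i; apply: le_div; have := h2 i; lra.
- by move=> i; have := h3 i; lra.
Qed.

End exists_threshold.

(** * The field that pushes points away from the boundary *)

Section push.
Context {R : realType} {n : nat}.
Variables (r : 'I_n -> 'I_n -> R) (m : 'I_n -> R).

(* z - \sum_j f j z *: jump_vector r j pushes the coordinates of z that are of
   order T away from 0; close to the face z_i = 0 it is invariant along
   jump_vector r i. *)
Record push_spec (T C Cfar : R) (f : 'I_n -> 'rV[R]_n -> R)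
    (df : 'I_n -> 'rV[R]_n -> 'rV[R]_n -> R)
    (ddf : 'I_n -> 'rV[R]_n -> 'rV[R]_n -> 'rV[R]_n -> R) : Prop := PushSpec {
  ps_gt0 : 0 < T;
  ps_derive : forall j v z, is_derive z v (f j) (df j v z);
  ps_derive2 : forall j v w z, is_derive z w (df j v) (ddf j v w z);
  ps_cont : forall j v w,
    [/\ continuous (f j), continuous (df j v) & continuous (ddf j v w)];
  ps_bounded : forall v w, exists M, forall j z,
    `|df j v z| <= M /\ `|ddf j v w z| <= M;
  ps_le : forall (z : 'rV[R]_n) j, (forall i, 0 <= z 0 i) -> 0 <= f j z <= C;
  ps_pos : forall (z : 'rV[R]_n) k, (forall i, 0 <= z 0 i) ->
    n%:R * T < \sum_j z 0 j ->
    0 < (z - \sum_j f j z *: jump_vector r j) 0 k;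
  ps_near : forall (z : 'rV[R]_n) i j, (forall i, 0 <= z 0 i) ->
    n%:R * T < \sum_j z 0 j -> z 0 i <= T / 2 ->
    df j (jump_vector r i) z = (j == i)%:R;
  ps_far : forall (z : 'rV[R]_n) j v w, (forall i, 0 <= z 0 i) ->
    Cfar <= z 0 j -> df j v z = 0 /\ ddf j v w z = 0 }.

Lemma jump_vectorE j k : jump_vector r j 0 k = r j k - (k == j)%:R * total_rate r j.
Proof.
rewrite /jump_vector summxE.
under eq_bigr do rewrite !mxE mulrBr.
rewrite sumrB -mulr_suml mulrC; congr (_ - _).
by under eq_bigr do rewrite mulrC [k == _]eq_sym; rewrite sum_indicator.
Qed.

Lemma softmax1Z (I : eqType) (s : seq I) l c (d : I -> R) :
  softmax1 s l (fun i => c * d i) = c * softmax1 s l d.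
Proof. by elim: s => [|i s IH] /=; [rewrite mulr0|rewrite IH; ring]. Qed.

Lemma dpolZ (q : 'I_n -> 'I_n -> R) A c v j :
  dpol q A (c *: v) j 0 = c * dpol q A v j 0.
Proof.
have -> : dpol q A (c *: v) = c *: dpol q A v.
  rewrite /dpol scalemxAr; congr (_ *m _); apply/colP => k; rewrite !mxE.
  by case: ifP => _; rewrite ?mulr0// mulrN.
by rewrite mxE.
Qed.

Hypothesis r_ge0 : forall j k, 0 <= r j k.
Hypothesis r_irr : irreducible_rates r.
Hypothesis m_gt0 : forall j, 0 < m j.
Hypothesis m_inv : forall k, \sum_j m j * r j k = m k * total_rate r k.
Hypothesis rate_gt0 : forall j, 0 < total_rate r j.

Lemma exists_push : exists T C Cfar f df ddf, push_spec T C Cfar f df ddf.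
Proof.
(* With these weights, coordinate k of \sum_j m_j p_j v_j is minus the Laplacian of p at k, and
   [balance_vector q i] is m_i v_i. Invariance of m computes the row sums, which then agree with the
   column sums. *)
pose q j i := m i * r i j.
have q_ge0 i j : 0 <= q i j by rewrite mulr_ge0// ltW.
have q_irr : irreducible_rates q.
  move=> j k; rewrite (eq_connect (e' := fun x y => 0 < r y x)); last first.
    by move=> x y; rewrite /q pmulr_rgt0.
  by rewrite connect_rev; exact: r_irr.
have qrow i : \sum_j q i j = m i * total_rate r i by exact: m_inv.
have q_bal i : \sum_j q j i = \sum_j q i j by rewrite qrow -mulr_sumr.
have q_gt0 i : 0 < \sum_j q i j by rewrite qrow mulr_gt0.
have [T [T0 T1 T2 T3]] := exists_threshold q_ge0 q_irr q_gt0
  (ler0n R (size (enum [pred A : {set 'I_n} | A != finset.setT]))).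
have [Cf Cf0 Cfar] := exists_strict_ub
  (fun j => T + (\sum_l q j l) * (T * green_bound q + 2 * (size (enum [pred A : {set 'I_n} | A != finset.setT]))%:R + 1)).
have [Mm Mm0 hm] := exists_strict_ub m.
have bv i : balance_vector q i = m i *: jump_vector r i.
  by apply/rowP => k; rewrite [RHS]mxE jump_vectorE mxE qrow /q; ring.
pose C := T * green_bound q + (size (enum [pred A : {set 'I_n} | A != finset.setT]))%:R.
exists T, (Mm * C), Cf, (fun j z => m j * envelope q T j z),
  (fun j v z => m j * envelope1 q T j v z), (fun j v w z => m j * envelope2 q T j v w z).
split => //.
- by move=> j v z; apply: is_deriveZ_pt; exact: envelope_derive.
- by move=> j v w z; apply: is_deriveZ_pt; exact: envelope1_derive.
- move=> j v w; have [c0 c1 c2] := envelope_continuous q T j v w.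
  by split; exact: continuous_scale.
- move=> v w; have [M hM] := envelope1_bounded q T v w.
  exists (Mm * M) => j z; have [h1 h2] := hM j z.
  by rewrite !normrM (gtr0_norm (m_gt0 j)) !ler_pM// ?ltW// m_gt0.
- move=> z j z0; rewrite mulr_ge0 ?envelope_ge0 ?(ltW (m_gt0 _))//=.
  by rewrite ler_pM ?envelope_ge0 ?(ltW (m_gt0 _)) ?(ltW (hm _)) ?envelope_le.
- move=> z k z0 Tz; have := envelope_pos q_ge0 q_irr q_bal T3 k z0 Tz.
  congr (0 < _); rewrite !mxE summxE; congr (_ + _).
  under [in RHS]eq_bigr do
    rewrite mxE jump_vectorE mulrBr [_ * (_%:R * _)]mulrCA [k == _]eq_sym.
  rewrite sumrB sum_indicator opprB; under eq_bigr do rewrite mulrBr.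
  rewrite sumrB -mulr_suml qrow; congr (_ - _); first by ring.
  by apply: eq_bigr => i _; rewrite /q; ring.
- move=> z i j z0 Tz zi.
  have := envelope1_bvec q_ge0 q_irr q_bal q_gt0 T1 T2 j z0 Tz zi.
  rewrite bv => e; have {e} : m i * envelope1 q T j (jump_vector r i) z = (j == i)%:R.
    rewrite -e /envelope1 -softmax1Z; congr softmax1; apply/funext => A.
    by rewrite dpolZ.
  have [->|ji] := eqVneq j i => //.
  by move/eqP; rewrite mulf_eq0 gt_eqF//= => /eqP ->; rewrite mulr0.
- move=> z j v w z0 zj.
  have [|-> ->] := @envelope1_far _ _ _ q_ge0 q_irr q_gt0 _ T0 z j v w z0.
  + by apply: le_trans zj; exact/ltW/Cfar.
  + by rewrite mulr0.
Qed.

End push.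

Lemma norm_convex_lt (R : realFieldType) (t a b d : R) : 0 <= t <= 1 ->
  `|a| < d -> `|b| < d -> `|(1 - t) * a + t * b| < d.
Proof.
move=> /andP[t0 t1] ad bd; have : Num.max `|a| `|b| < d by rewrite gt_max ad.
apply: le_lt_trans; have : `|a| <= Num.max `|a| `|b| by rewrite le_max lexx.
have : `|b| <= Num.max `|a| `|b| by rewrite le_max lexx orbT.
set M := Num.max _ _; rewrite !ler_norml => /andP[p1 p2] /andP[p3 p4].
by apply/andP; split; nra.
Qed.

(** * Calculus on the simplex *)

Section simplex_topology.
Context {R : realType} {n : nat}.
Implicit Types (x y v w : 'rV[R]_n) (G : 'rV[R]_n -> R).

Lemma open_simplexW x : open_simplex x -> simplex x.
Proof. by case. Qed.

Lemma simplex_gt0 x : simplex x -> (0 < n)%N.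
Proof.
case=> _; case: n x => // x; rewrite big_ord0 => /eqP.
by rewrite eq_sym oner_eq0.
Qed.

Lemma simplex_ball G y e : {within simplex, continuous G} -> simplex y ->
  0 < e -> exists2 d, 0 < d & forall x, simplex x ->
    (forall k, `|y 0 k - x 0 k| < d) -> `|G y - G x| < e.
Proof.
move=> /subspace_continuousP Gc ys e0.
have /cvgrPdist_lt/(_ e e0) := Gc y ys.
rewrite near_withinE => /nbhs_ballP[d /= d0 H]; exists d => // x xs xd.
apply: H => //; split => // i k; rewrite (ord1 i); exact: xd.
Qed.

Lemma simplex_cvg {U} {F : set_system U} {FF : Filter F} G y
    (g : U -> 'rV[R]_n) :
  {within simplex, continuous G} -> simplex y ->
  (forall k, g t 0 k @[t --> F] --> y 0 k) -> (\forall t \near F, simplex (g t)) ->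
  G (g t) @[t --> F] --> G y.
Proof.
move=> Gc ys gy gs; apply/cvgrPdist_lt => e e0.
have [d d0 H] := simplex_ball Gc ys e0.
have gd : \forall t \near F, forall k, `|y 0 k - g t 0 k| < d.
  by apply: filter_forall => k; move/cvgrPdist_lt: (gy k); apply.
by near=> t; apply: H; [near: t|near: t].
Unshelve. all: by end_near. Qed.

Lemma near_open_simplex {U} {F : set_system U} {FF : Filter F} y
    (g : U -> 'rV[R]_n) : open_simplex y ->
  (forall k, g t 0 k @[t --> F] --> y 0 k) ->
  (\forall t \near F, \sum_k g t 0 k = 1) ->
  \forall t \near F, open_simplex (g t).
Proof.
move=> [_ y0] gy g1.
have gp : \forall t \near F, forall k, 0 < g t 0 k.
  by apply: filter_forall => k; exact: (cvgr_gt _ (gy k)).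
near=> t; have g0 : forall k, 0 < g t 0 k by near: t.
split=> //; split=> [k|]; first exact: ltW.
by near: t.
Unshelve. all: by end_near. Qed.

Definition barycenter : 'rV[R]_n := const_mx n%:R^-1.

Lemma barycenter_open : (0 < n)%N -> open_simplex barycenter.
Proof.
move=> n0; split=> [|j]; first exact: path_pt_simplex.
by rewrite mxE invr_gt0 ltr0n.
Qed.

Lemma segment_open x y h : simplex x -> open_simplex y -> 0 < h <= 1 ->
  open_simplex (h *: (y - x) + x).
Proof.
move=> [x0 x1] [[_ y1] y0] /andP[h0 h1].
have p k : 0 < (h *: (y - x) + x) 0 k.
  rewrite !mxE; have := x0 k; have := y0 k => yk xk.
  rewrite (_ : _ + _ = h * y 0 k + (1 - h) * x 0 k); last by ring.
  by rewrite ltr_wpDr ?mulr_ge0 ?mulr_gt0// subr_ge0.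
split=> //; split=> [k|]; first exact: ltW.
under eq_bigr do rewrite !mxE.
by rewrite big_split/= -mulr_sumr sumrB x1 y1 subrr mulr0 add0r.
Qed.

Lemma line_cvg {U} {F : set_system U} {FF : Filter F} (c : U -> R) v x k :
  c t @[t --> F] --> 0 -> (c t *: v + x) 0 k @[t --> F] --> x 0 k.
Proof.
move=> c0; under eq_fun do rewrite !mxE.
suff : c t * v 0 k + x 0 k @[t --> F] --> 0 * v 0 k + x 0 k.
  by rewrite mul0r add0r.
by apply: cvgD; [apply: cvgM => //; exact: cvg_cst|exact: cvg_cst].
Qed.

Lemma within_open_simplex_proper x : simplex x ->
  ProperFilter (within open_simplex (nbhs x)).
Proof.
move=> xs; apply: Build_ProperFilter_ex => P; rewrite /within /= => Px.
have c0 := barycenter_open (simplex_gt0 xs).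
have : \forall t \near (0:R)^'+, P (t *: (barycenter - x) + x).
  have : (t *: (barycenter - x) + x) @[t --> (0:R)^'+] --> x.
    apply: cvg_at_right_filter.
    suff : (t *: (barycenter - x) + x) @[t --> (0:R)] -->
      0 *: (barycenter - x) + x by rewrite scale0r add0r.
    by apply: cvgD; [apply: cvgZr_tmp; exact: cvg_id|exact: cvg_cst].
  move=> /(_ _ Px) Pt; near=> t.
  have : open_simplex (t *: (barycenter - x) + x).
    apply: segment_open => //.
    by apply/andP; split; near: t; [exact: nbhs_right_gt|exact: nbhs_right_le].
  by near: t; exact: Pt.
by move=> /filter_ex[t Pt]; exists (t *: (barycenter - x) + x).
Unshelve. all: by end_near. Qed.

Lemma within_simplex_open_cvg G x : {within simplex, continuous G} ->
  simplex x -> G y @[y --> within open_simplex (nbhs x)] --> G x.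
Proof.
move=> Gc xs; apply: simplex_cvg => //.
  by move=> k; apply: cvg_within_filter; exact: coord_continuous.
by rewrite near_withinE; near=> y; exact: open_simplexW.
Unshelve. all: by end_near. Qed.

Lemma tderiv_eq v F G x : {within simplex, continuous G} ->
  (forall y, open_simplex y -> 'D_v F y = G y) -> simplex x ->
  tderiv v F x = G x.
Proof.
move=> Gc FG xs; have PF := within_open_simplex_proper xs.
apply: cvg_lim => //.
apply: cvg_trans (within_simplex_open_cvg Gc xs); apply: near_eq_cvg.
by rewrite near_withinE; near=> y => /FG.
Unshelve. all: by end_near. Qed.

Lemma eq_on_simplex F G x : {within simplex, continuous F} ->
  {within simplex, continuous G} ->
  (forall y, open_simplex y -> F y = G y) -> simplex x -> F x = G x.
Proof.
move=> Fc Gc FG xs; have PF := within_open_simplex_proper xs.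
apply: (@cvg_unique _ _ (F y @[y --> within open_simplex (nbhs x)])) => //.
  exact: within_simplex_open_cvg.
apply: cvg_trans (within_simplex_open_cvg Gc xs); apply: near_eq_cvg.
by rewrite near_withinE; near=> y => /FG.
Unshelve. all: by end_near. Qed.

End simplex_topology.

(** Parametrising by [0, 1] allows h of either sign, and h = 0. *)
Lemma mvt_line (R : realType) (f df : R -> R) (h : R) :
  (forall t : R, 0 <= t <= 1 -> is_derive (t * h) 1 f (df (t * h))) ->
  exists2 t, 0 <= t <= 1 & f h - f 0 = h * df (t * h).
Proof.
move=> fd; have Fd (t : R) : 0 <= t <= 1 ->
    is_derive t 1 (fun u => f (u * h)) (df (t * h) * h).
  move=> t01; apply: (@is_derive_compR R R f (fun u => u * h) t 1 (df (t * h)) h).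
    exact: fd.
  have := @is_deriveZ_pt R R id t 1 h 1 (is_derive_id _ _).
  by rewrite mulr1; congr is_derive; apply/funext => u; rewrite mulrC.
have [||t] := @MVT_segment R (fun u => f (u * h)) (fun t => df (t * h) * h) 0 1 ler01.
- by move=> t; rewrite in_itv/= => /andP[t0 t1]; apply: Fd; rewrite !ltW.
- apply: derivable_within_continuous => t; rewrite in_itv/= => t01.
  by case: (Fd t t01).
- rewrite in_itv/= => t01; rewrite mul1r mul0r subr0 mulr1 => ->.
  by exists t => //; rewrite mulrC.
Qed.

Section simplex_calculus.
Context {R : realType} {n : nat}.
Implicit Types (x y u v w : 'rV[R]_n) (G H : 'rV[R]_n -> R).

Lemma tangentD u v : tangent u -> tangent v -> tangent (u + v).
Proof.
rewrite /tangent => tu tv; under eq_bigr do rewrite mxE.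
by rewrite big_split/= tu tv addr0.
Qed.

Lemma tangentZ c u : tangent u -> tangent (c *: u).
Proof.
rewrite /tangent => tu; under eq_bigr do rewrite mxE.
by rewrite -mulr_sumr tu mulr0.
Qed.

Lemma tangentB u v : tangent u -> tangent v -> tangent (u - v).
Proof.
by move=> tu tv; rewrite -scaleN1r; apply: tangentD => //; exact: tangentZ.
Qed.

Lemma tangent_sum m (f : 'I_m -> 'rV[R]_n) (P : pred 'I_m) :
  (forall i, tangent (f i)) -> tangent (\sum_(i | P i) f i).
Proof.
move=> tf; elim/big_ind : _ => //; last exact: tangentD.
by rewrite /tangent big1// => i _; rewrite mxE.
Qed.

Lemma tangent_ebase i j : tangent (ebase i - ebase j : 'rV[R]_n).
Proof.
rewrite /tangent; under eq_bigr do rewrite !mxE eqxx/=.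
rewrite sumrB; have e (k : 'I_n) : \sum_l (l == k)%:R = 1 :> R.
  by have := sum_indicator k (fun=> 1 : R); under eq_bigr do rewrite mulr1.
by rewrite !e subrr.
Qed.

Lemma tangent_jump_vector (r : 'I_n -> 'I_n -> R) j : tangent (jump_vector r j).
Proof.
by apply: tangent_sum => k; apply: tangentZ; exact: tangent_ebase.
Qed.

Lemma sum_line v y h : tangent v -> \sum_k (h *: v + y) 0 k = \sum_k y 0 k.
Proof.
move=> tv; under eq_bigr do rewrite !mxE.
by rewrite big_split/= -mulr_sumr tv mulr0 add0r.
Qed.

Lemma mvt_simplex G g v y h : open_simplex y -> open_simplex (h *: v + y) ->
  (forall x, open_simplex x -> is_derive x v G (g x)) ->
  exists t, [/\ 0 <= t <= 1, open_simplex ((t * h) *: v + y) &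
    G (h *: v + y) - G y = h * g ((t * h) *: v + y)].
Proof.
move=> oy oh Gg.
have seg t : 0 <= t <= 1 -> open_simplex ((t * h) *: v + y).
  move=> /andP[]; rewrite le_eqVlt => /predU1P[<- _|t0 t1].
    by rewrite mul0r scale0r add0r.
  have := @segment_open _ _ y (h *: v + y) t (open_simplexW oy) oh.
  by rewrite addrK scalerA t0 t1; apply.
have [t t01 e] := @mvt_line R (fun s => G (s *: v + y))
  (fun s => g (s *: v + y)) h
  (fun t t01 => (is_derive_line _ _ _ _ _).1 (Gg _ (seg t t01))).
exists t; split => //; first exact: seg.
by rewrite scale0r add0r in e.
Qed.

Section C1.
Variable G : 'rV[R]_n -> R.
Hypothesis G1 : Cn 1 G.

Lemma Cn1_continuous : {within simplex, continuous G}.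
Proof. by case: G1. Qed.

Lemma Cn1_derive v x : tangent v -> open_simplex x ->
  is_derive x v G (tderiv v G x).
Proof. by move=> tv ox; case: G1 => _ /(_ v tv)[+ _]; apply. Qed.

Lemma Cn1_tderiv v : tangent v -> {within simplex, continuous (tderiv v G)}.
Proof. by move=> tv; case: G1 => _ /(_ v tv)[_ []]. Qed.

(** A difference quotient whose base point [g t] moves with t: no differentiability off the tangent
    lines is available, but the mean value theorem evaluates the derivative along v, which is
    continuous, at a point close to y. *)
Lemma Cn1_step {U} {F : set_system U} {FF : Filter F} y v
    (s c : U -> R) (g : U -> 'rV[R]_n) (a : R) :
  open_simplex y -> tangent v ->
  (forall k, g t 0 k @[t --> F] --> y 0 k) ->
  (forall t, \sum_k g t 0 k = 1) ->
  c t @[t --> F] --> 0 -> s t * c t @[t --> F] --> a ->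
  s t * (G (c t *: v + g t) - G (g t)) @[t --> F] --> a * tderiv v G y.
Proof.
move=> oy tv gy g1 c0 sa.
(* Where the increment vanishes, the quotient receives its limit as default value, so that the
   factorisation through [s t * c t] holds for every t. *)
pose k t := if c t == 0 then tderiv v G y
  else (G (c t *: v + g t) - G (g t)) / c t.
have -> : (fun t => s t * (G (c t *: v + g t) - G (g t))) =
    (fun t => s t * c t * k t).
  apply/funext => t; rewrite /k; case: eqP => [->|/eqP ct0].
    by rewrite scale0r add0r subrr !mulr0 mul0r.
  by rewrite -mulrA [c t * _]mulrC divfK.
apply: cvgM => //; apply/cvgrPdist_lt => e e0.
have [d d0 H] := simplex_ball (Cn1_tderiv tv) (open_simplexW oy) e0.
have og : \forall t \near F, open_simplex (g t).
  by apply: (near_open_simplex oy gy); exact: nearW.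
have gcy j : (c t *: v + g t) 0 j @[t --> F] --> y 0 j.
  under eq_fun do rewrite !mxE.
  suff : c t * v 0 j + g t 0 j @[t --> F] --> 0 * v 0 j + y 0 j.
    by rewrite mul0r add0r.
  by apply: cvgD => //; apply: cvgM => //; exact: cvg_cst.
have ocg : \forall t \near F, open_simplex (c t *: v + g t).
  by apply: (near_open_simplex oy gcy); apply: nearW => t; rewrite sum_line.
have gd : \forall t \near F, forall j, `|y 0 j - g t 0 j| < d.
  by apply: filter_forall => j; move/cvgrPdist_lt: (gy j); apply.
have gcd : \forall t \near F, forall j, `|y 0 j - (c t *: v + g t) 0 j| < d.
  by apply: filter_forall => j; move/cvgrPdist_lt: (gcy j); apply.
near=> t; rewrite /k; case: eqP => [_|/eqP ct0]; first by rewrite subrr normr0.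
have o1 : open_simplex (g t) by near: t.
have o2 : open_simplex (c t *: v + g t) by near: t.
have [th [/andP[t0 t1] oth ->]] :=
  mvt_simplex o1 o2 (fun x => @Cn1_derive v x tv).
rewrite mulrC mulKf//; apply: H; first exact: open_simplexW.
have d1 : forall j, `|y 0 j - g t 0 j| < d by near: t.
have d2 : forall j, `|y 0 j - (c t *: v + g t) 0 j| < d by near: t.
move=> j; set A := y 0 j - g t 0 j; set B := y 0 j - (c t *: v + g t) 0 j.
have -> : y 0 j - ((th * c t) *: v + g t) 0 j = (1 - th) * A + th * B.
  by rewrite /A /B !mxE; ring.
by apply: norm_convex_lt; rewrite ?t0//; [exact: d1|exact: d2].
Unshelve. all: by end_near. Qed.

(** The increment is made one coordinate at a time along [ebase k - ebase i0]: vertex i0 absorbs the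
    mass, so the intermediate points [gm m h] keep total mass 1, and each stage is an instance of
    [Cn1_step]. *)
Lemma Cn1_curve y u (g : R -> 'rV[R]_n) i0 :
  open_simplex y -> (forall h, tangent (g h - y)) ->
  (forall k, h^-1 * (g h - y) 0 k @[h --> 0^'] --> u 0 k) ->
  h^-1 * (G (g h) - G y) @[h --> 0^'] -->
    \sum_k u 0 k * tderiv (ebase k - ebase i0) G y.
Proof.
move=> oy tg gu; pose e k : 'rV[R]_n := ebase k - ebase i0.
pose z h k := (g h - y) 0 k.
have z0 k : z h k @[h --> (0:R)^'] --> (0:R).
  have : h * (h^-1 * z h k) @[h --> (0:R)^'] --> 0 * u 0 k.
    apply: cvgM; last exact: gu.
    by apply/cvgr0Pnorm_lt => e' e'0; exact: dnbhs0_lt.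
  rewrite mul0r; apply: cvg_trans; apply: near_eq_cvg; near=> h.
  rewrite mulVKf//; near: h; exact: nbhs_dnbhs_neq.
pose gm m h := \sum_(k < n | (k < m)%N) z h k *: e k + y.
have gm1 m h : \sum_k gm m h 0 k = 1.
  have /(sum_line y 1) : tangent (\sum_(k < n | (k < m)%N) z h k *: e k).
    by apply: tangent_sum => k; apply: tangentZ; exact: tangent_ebase.
  by rewrite scale1r => ->; case: oy => -[].
have gmy m j : gm m h 0 j @[h --> (0:R)^'] --> y 0 j.
  under eq_fun do rewrite mxE summxE big_mkcond/=.
  suff H0 : \sum_(k < n) (if (k < m)%N then (z h k *: e k) 0 j else 0)
      @[h --> (0:R)^'] --> \sum_(k < n) (0 : R).
    have s0 : \sum_(k < n) (0 : R) = 0 by rewrite big1.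
    by have := cvgD H0 (cvg_cst (y 0 j)); rewrite s0 add0r; exact.
  apply: cvg_sum_pt => k; case: (k < m)%N; last exact: cvg_cst.
  under eq_fun do rewrite mxE.
  suff : z h k * e k 0 j @[h --> (0:R)^'] --> 0 * e k 0 j by rewrite mul0r.
  by apply: cvgM => //; exact: cvg_cst.
have cl m : (m <= n)%N -> h^-1 * (G (gm m h) - G y) @[h --> (0:R)^'] -->
    \sum_(k < n | (k < m)%N) u 0 k * tderiv (e k) G y.
  elim: m => [_|m IH mn].
    rewrite big_pred0//; apply: cvg_near_cst; apply: nearW => h.
    by rewrite /gm big_pred0// add0r subrr mulr0.
  pose om := Ordinal mn.
  have sp (V : nmodType) (f : 'I_n -> V) : \sum_(k < n | (k < m.+1)%N) f k =
      f om + \sum_(k < n | (k < m)%N) f k.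
    rewrite (bigD1 om)/=; last by rewrite ltnS.
    congr (_ + _); apply: eq_bigl => k.
    by rewrite ltnS [RHS]ltn_neqAle andbC.
  rewrite sp.
  have -> : (fun h => h^-1 * (G (gm m.+1 h) - G y)) = (fun h =>
      h^-1 * (G (z h om *: e om + gm m h) - G (gm m h)) +
      h^-1 * (G (gm m h) - G y)).
    by apply/funext => h; rewrite -mulrDr subrKA /gm sp addrA.
  apply: cvgD; last by apply: IH; exact: ltnW.
  apply: Cn1_step => //; first exact: tangent_ebase.
  exact: gu.
have := cl n (leqnn n); rewrite (eq_bigl xpredT); last by move=> k; rewrite ltn_ord.
apply: cvg_trans; apply: near_eq_cvg; apply: nearW => h /=.
rewrite (_ : gm n h = g h)// /gm -[RHS](subrK y); congr (_ + _).
apply/rowP => j; rewrite summxE.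
under eq_bigr do rewrite !mxE eqxx/= mulrBr mulrC.
rewrite sumrB.
have -> : \sum_(i < n | (i < n)%N) (j == i)%:R * z h i = z h j.
  rewrite (eq_bigl xpredT); last by move=> k; rewrite ltn_ord.
  by under eq_bigr do rewrite eq_sym; rewrite sum_indicator.
rewrite -mulr_suml (eq_bigl xpredT); last by move=> k; rewrite ltn_ord.
by rewrite [X in X * _](tg h) mul0r subr0.
Unshelve. all: by end_near. Qed.

(** [Cn] postulates each direction separately. Linearity in the direction comes from the curve
    formula applied to a straight line, and extends to the boundary by continuity. *)
Lemma tderiv_basis i0 u y : tangent u -> simplex y ->
  tderiv u G y = \sum_k u 0 k * tderiv (ebase k - ebase i0) G y.
Proof.
move=> tu; apply: (@eq_on_simplex _ _ (tderiv u G) (fun y =>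
  \sum_k u 0 k * tderiv (ebase k - ebase i0) G y)); first exact: Cn1_tderiv.
  apply/subspace_continuousP => x xs.
  apply: (cvg_sum_pt (FF := within_filter _ (nbhs_filter x))) => k.
  apply: cvgM; first exact: cvg_cst.
  exact/((subspace_continuousP _ _).1 (Cn1_tderiv (tangent_ebase k i0))).
move=> x ox; have /is_deriveE := Cn1_derive tu ox.
move=> d1; apply: (@cvg_unique _ _ (h^-1 * (G (h *: u + x) - G x) @[h --> (0:R)^'])) => //.
apply: Cn1_curve => //.
  by move=> h; rewrite addrK; exact: tangentZ.
move=> k; apply: cvg_near_cst; near=> h; rewrite addrK mxE mulKf//.
near: h; exact: nbhs_dnbhs_neq.
Unshelve. all: by end_near. Qed.

Lemma tderivD u v y : tangent u -> tangent v -> simplex y ->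
  tderiv (u + v) G y = tderiv u G y + tderiv v G y.
Proof.
move=> tu tv ys; have i0 : 'I_n by exact: (Ordinal (simplex_gt0 ys)).
rewrite !(tderiv_basis i0)//; last exact: tangentD.
by rewrite -big_split/=; apply: eq_bigr => k _; rewrite mxE mulrDl.
Qed.

Lemma tderivZ c u y : tangent u -> simplex y ->
  tderiv (c *: u) G y = c * tderiv u G y.
Proof.
move=> tu ys; have i0 : 'I_n by exact: (Ordinal (simplex_gt0 ys)).
rewrite !(tderiv_basis i0)//; last exact: tangentZ.
by rewrite mulr_sumr; apply: eq_bigr => k _; rewrite mxE mulrA.
Qed.

Lemma tderiv_sum m (f : 'I_m -> 'rV[R]_n) y : (forall i, tangent (f i)) ->
  simplex y -> tderiv (\sum_i f i) G y = \sum_i tderiv (f i) G y.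
Proof.
move=> tf ys; have i0 : 'I_n by exact: (Ordinal (simplex_gt0 ys)).
rewrite (tderiv_basis i0)//; last exact: tangent_sum.
under [RHS]eq_bigr do rewrite (tderiv_basis i0)//.
rewrite exchange_big/=; apply: eq_bigr => k _.
by rewrite summxE mulr_suml.
Qed.

Lemma Cn1_curve_derive y u (g : R -> 'rV[R]_n) :
  open_simplex y -> tangent u -> (forall h, tangent (g h - y)) ->
  (forall k, h^-1 * (g h - y) 0 k @[h --> 0^'] --> u 0 k) ->
  h^-1 * (G (g h) - G y) @[h --> 0^'] --> tderiv u G y.
Proof.
move=> oy tu tg gu; have ys := open_simplexW oy.
have i0 : 'I_n by exact: (Ordinal (simplex_gt0 ys)).
by rewrite (tderiv_basis i0)//; exact: Cn1_curve.
Qed.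

End C1.
End simplex_calculus.

Section second_order.
Context {R : realType} {n : nat}.
Implicit Types (x y u v w : 'rV[R]_n) (G H : 'rV[R]_n -> R).

Lemma simplex_compact : compact (@simplex R n).
Proof.
apply: (@subclosed_compact _ _ [set x : 'rV[R]_n |
  forall i, (`[0, 1]%classic : set R) (x ord0 i)]).
- rewrite (_ : simplex = (\bigcap_(j : 'I_n) [set x : 'rV[R]_n | 0 <= x 0 j]) `&`
    [set x | \sum_j x 0 j = 1]); last first.
    apply/seteqP; split => [x [xs x1]|x [xs x1]]; split=> // j.
      by move=> _; exact: xs.
    exact: (xs j Logic.I).
  apply: closedI.
    apply: closed_bigI => j _.
    apply: (@closed_comp _ _ (fun x : 'rV[R]_n => x 0 j) [set t | 0 <= t]).
      by move=> x _; exact: coord_continuous.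
    exact: closed_ge.
  apply: (@closed_comp _ _ (fun x : 'rV[R]_n => \sum_j x 0 j) [set t | t = 1]).
    move=> x _; apply: (cvg_sum_pt (FF := nbhs_filter x)) => j.
    exact: coord_continuous.
  exact: closed_eq.
- apply: (@rV_compact R n (fun=> `[0, 1]%classic)) => _.
  exact: segment_compact.
- move=> x [x0 x1] i; rewrite /= in_itv/= x0 -x1 (bigD1 i)//= lerDl.
  by rewrite sumr_ge0.
Qed.

Lemma simplex_bounded G : {within simplex, continuous G} ->
  exists M, forall x, simplex x -> `|G x| <= M.
Proof.
move=> Gc; have [[x0 xs0]|nx] := pselect (exists x, @simplex R n x); last first.
  by exists 0 => x xs; exfalso; apply: nx; exists x.
have [||c cs cM] := @EVT_max_rV R n (fun x => `|G x|) simplex _ simplex_compact.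
- by exists x0.
- apply/subspace_continuousP => x xs; apply: cvg_norm.
  exact/((subspace_continuousP _ _).1 Gc).
- by exists `|G c| => x xs; apply: cM; rewrite inE.
Qed.

Lemma Cn2_Cn1 H : Cn 2 H -> Cn 1 H.
Proof.
move=> [Hc H2]; split=> // v tv; have [dH [cH _]] := H2 v tv.
by split.
Qed.

Lemma Cn2_tderiv H v : Cn 2 H -> tangent v -> Cn 1 (tderiv v H).
Proof. by move=> [_ H2] tv; have [_] := H2 v tv. Qed.

(** The mean value theorem is used along u for the increment of H in v, then along v for
    [tderiv u H]. The left-hand side is symmetric in u and v, which yields the symmetry of second
    derivatives in [tderiv_sym]. *)
Lemma second_difference H u v y : Cn 2 H -> tangent u -> tangent v ->
  open_simplex y ->
  h^-1 * h^-1 * (H (h *: u + (h *: v + y)) - H (h *: u + y) -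
    (H (h *: v + y) - H y)) @[h --> 0^'] --> tderiv v (tderiv u H) y.
Proof.
move=> H2 tu tv oy; apply/cvgrPdist_lt => e e0.
have [d d0 Hd] := simplex_ball (Cn1_tderiv (Cn2_tderiv H2 tu) tv)
  (open_simplexW oy) e0.
have small : \forall h \near (0:R)^', forall k,
    `|h| * (`|u 0 k| + `|v 0 k|) < Num.min d (y 0 k).
  apply: filter_forall => k.
  have : `|h| * (`|u 0 k| + `|v 0 k|) @[h --> (0:R)] --> `|0 : R| * (`|u 0 k| + `|v 0 k|).
    by apply: cvgM; [apply: cvg_norm; exact: cvg_id|exact: cvg_cst].
  rewrite normr0 mul0r => c0.
  have m0 : 0 < Num.min d (y 0 k) by rewrite lt_min d0; case: oy => _ ->.
  exact: (nbhs_dnbhs (cvgr_lt _ c0 _ m0)).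
near=> h; have h0 : h != 0 by near: h; exact: nbhs_dnbhs_neq.
have hk : forall k, `|h| * (`|u 0 k| + `|v 0 k|) < Num.min d (y 0 k).
  by near: h.
have pt s t : 0 <= s <= 1 -> 0 <= t <= 1 ->
    open_simplex ((s * h) *: u + ((t * h) *: v + y)) /\
    forall k, `|y 0 k - ((s * h) *: u + ((t * h) *: v + y)) 0 k| < d.
  move=> /andP[s0 s1] /andP[t0 t1].
  have b k : `|(s * h) * u 0 k + (t * h) * v 0 k| < Num.min d (y 0 k).
    apply: le_lt_trans (hk k); apply: (le_trans (ler_normD _ _)).
    rewrite !normrM (ger0_norm s0) (ger0_norm t0) mulrDr -!mulrA.
    by apply: lerD; apply: ler_piMl; rewrite ?mulr_ge0.
  split; last first.
    move=> k; rewrite !mxE; have := b k; rewrite lt_min => /andP[bd _].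
    by rewrite addrA opprD [- (_ + _) + _]addrC addrA subrr add0r normrN.
  have p k : 0 < ((s * h) *: u + ((t * h) *: v + y)) 0 k.
    rewrite !mxE; have := b k; rewrite lt_min => /andP[_].
    by rewrite ltr_norml => /andP[+ _]; lra.
  split=> //; split => [k|]; first exact: ltW.
  by rewrite !sum_line//; case: oy => -[].
have o1 : 0 <= (1:R) <= 1 by rewrite ler01 lexx.
have o0 : 0 <= (0:R) <= 1 by rewrite ler01 lexx.
have ob t : 0 <= t <= 1 -> open_simplex ((t * h) *: u + (h *: v + y)).
  by move=> t01; have [+ _] := pt t 1 t01 o1; rewrite mul1r.
have oa t : 0 <= t <= 1 -> open_simplex ((t * h) *: u + y).
  by move=> t01; have [+ _] := pt t 0 t01 o0; rewrite mul0r scale0r add0r.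
have dH z : open_simplex z -> is_derive z u H (tderiv u H z).
  by move=> oz; exact: (Cn1_derive (Cn2_Cn1 H2) tu oz).
have [t t01 et] := @mvt_line R
  (fun s => H (s *: u + (h *: v + y)) - H (s *: u + y))
  (fun s => tderiv u H (s *: u + (h *: v + y)) - tderiv u H (s *: u + y)) h
  (fun t t01 => is_deriveB_pt
    ((is_derive_line _ _ _ _ _).1 (dH _ (ob t t01)))
    ((is_derive_line _ _ _ _ _).1 (dH _ (oa t t01)))).
have ob' := ob t t01; rewrite addrCA in ob'.
have [s [s01 os es]] := mvt_simplex (oa t t01) ob'
  (fun x => @Cn1_derive _ _ _ (Cn2_tderiv H2 tu) v x tv).
move: et; rewrite !scale0r !add0r => ->; rewrite addrCA es.
rewrite -mulrA mulKf// mulKf//; apply: Hd; first exact: open_simplexW.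
by move=> k; have [_] := pt t s t01 s01; rewrite addrCA; exact.
Unshelve. all: by end_near. Qed.

Lemma tderiv_sym H u v y : Cn 2 H -> tangent u -> tangent v -> simplex y ->
  tderiv u (tderiv v H) y = tderiv v (tderiv u H) y.
Proof.
move=> H2 tu tv; apply: (@eq_on_simplex _ _ (tderiv u (tderiv v H)) (tderiv v (tderiv u H))).
- exact: (Cn1_tderiv (Cn2_tderiv H2 tv) tu).
- exact: (Cn1_tderiv (Cn2_tderiv H2 tu) tv).
move=> x ox; apply: (cvg_unique _ (second_difference H2 tv tu ox)) => //.
have := second_difference H2 tu tv ox; apply: cvg_trans; apply: near_eq_cvg.
apply: nearW => h; rewrite addrCA; ring.
Qed.

(* On the face x_j = 0 the function g is o(1), so that f = g x_j is o(x_j). *)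
Lemma tderiv_vanish (f g : 'rV[R]_n -> R) j w y : Cn 1 f -> {within simplex, continuous g} ->
  (forall x, simplex x -> f x = g x * x 0 j) ->
  tangent w -> simplex y -> y 0 j = 0 -> g y = 0 -> tderiv w f y = 0.
Proof.
(* Two segments run from y to the interior points c and c' = c + k w. At parameter h their points
   differ by h k w, while f differs by o(h), because x_j = O(h) on both and g tends to 0 at y. *)
move=> f1 gc fg tw ys yj gy; pose c : 'rV[R]_n := barycenter.
have co : open_simplex c by exact: barycenter_open (simplex_gt0 ys).
have [k k0 c'o] : exists2 k : R, 0 < k & open_simplex (k *: w + c).
  have : \forall k \near (0:R)^'+, open_simplex (k *: w + c).
    apply: (near_open_simplex co).
      by move=> i; apply: line_cvg; apply: cvg_at_right_filter; exact: cvg_id.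
    by apply: nearW => t; rewrite sum_line//; case: co => -[].
  move=> H; have [|k /= [kgt ko]] := @filter_ex _ ((0:R)^'+) _ (fun k => 0 < k /\ open_simplex (k *: w + c)).
    by near=> t; split; near: t; [exact: nbhs_right_gt|exact: H].
  by exists k.
set c' := k *: w + c in c'o.
pose p (b : 'rV[R]_n) (h : R) := h *: (b - y) + y.
have po b h : open_simplex b -> 0 < h <= 1 -> open_simplex (p b h).
  by move=> ob h01; exact: segment_open.
have h01 : \forall h \near (0:R)^'+, 0 < h <= 1.
  by near=> h; apply/andP; split; near: h; [exact: nbhs_right_gt|exact: nbhs_right_le].
have pc b i : p b h 0 i @[h --> (0:R)^'+] --> y 0 i.
  by apply: line_cvg; apply: cvg_at_right_filter; exact: cvg_id.
have gp b : open_simplex b -> g (p b h) * b 0 j @[h --> (0:R)^'+] --> (0:R).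
  move=> ob; suff : g (p b h) * b 0 j @[h --> (0:R)^'+] --> g y * b 0 j.
    by rewrite gy mul0r.
  apply: cvgM; last exact: cvg_cst.
  apply: simplex_cvg => //; near=> h.
  by apply/open_simplexW/po => //; near: h.
have diff : (g (p c' h) * c' 0 j - g (p c h) * c 0 j) @[h --> (0:R)^'+] --> (0:R).
  suff : (g (p c' h) * c' 0 j - g (p c h) * c 0 j) @[h --> (0:R)^'+] -->
      (0 - 0 : R) by rewrite subr0.
  by apply: cvgB; exact: gp.
apply/eqP; rewrite -normr_le0; apply/ler_addgt0Pl => e e0; rewrite addr0.
have e20 : 0 < e / 2 by rewrite divr_gt0.
have [d d0 Hd] := simplex_ball (Cn1_tderiv f1 tw) ys e20.
have dk0 : 0 < e / 2 * k by rewrite mulr_gt0.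
have : \forall h \near (0:R)^'+, `|tderiv w f y| <= e.
  have near1 : \forall h \near (0:R)^'+,
      `|g (p c' h) * c' 0 j - g (p c h) * c 0 j| < e / 2 * k.
    by move/cvgr0Pnorm_lt : diff; apply.
  have nearp b : \forall h \near (0:R)^'+, forall i, `|y 0 i - p b h 0 i| < d.
    by apply: filter_forall => i; move/cvgrPdist_lt: (pc b i); apply.
  have np := nearp c; have np' := nearp c'.
  near=> h; have hh : 0 < h <= 1 by near: h.
  have h0 : 0 < h by case/andP: hh.
  have pE : p c' h = (h * k) *: w + p c h.
    by rewrite /p /c' -addrA scalerDr scalerA addrA.
  have o1 := po _ _ co hh; have o2 := po _ _ c'o hh; rewrite pE in o2.
  have [t [/andP[t0 t1] ot et]] := mvt_simplex o1 o2 (fun x => @Cn1_derive _ _ _ f1 w x tw).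
  have pj b : p b h 0 j = h * b 0 j by rewrite /p !mxE yj subr0 addr0.
  rewrite -pE !fg ?pE in et; [|exact: open_simplexW|exact: open_simplexW].
  rewrite -pE !pj in et.
  have {}et : g (p c' h) * c' 0 j - g (p c h) * c 0 j =
      k * tderiv w f ((t * (h * k)) *: w + p c h).
    apply: (mulfI (lt0r_neq0 h0)); rewrite mulrA -et; ring.
  have n1 : `|g (p c' h) * c' 0 j - g (p c h) * c 0 j| < e / 2 * k by near: h.
  have n2 : forall i, `|y 0 i - p c h 0 i| < d by near: h.
  have n3 : forall i, `|y 0 i - p c' h 0 i| < d by near: h.
  set xi := (t * (h * k)) *: w + p c h in ot et.
  have n4 i : `|y 0 i - xi 0 i| < d.
    have -> : y 0 i - xi 0 i =
        (1 - t) * (y 0 i - p c h 0 i) + t * (y 0 i - p c' h 0 i).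
      by rewrite pE /xi !mxE; ring.
    by apply: norm_convex_lt; rewrite ?t0.
  have := Hd _ (open_simplexW ot) n4.
  move: n1; rewrite et normrM (gtr0_norm k0) mulrC ltr_pM2r// => n1 n5.
  rewrite -(subrK (tderiv w f xi) (tderiv w f y)).
  by apply: (le_trans (ler_normD _ _)); lra.
by move=> /filter_ex[].
Unshelve. all: by end_near. Qed.

End second_order.

Section continuous_ops.
Context {R : realType} {V : topologicalType}.
Implicit Types f g : V -> R.

Lemma cts_cst (c : R) : continuous (fun _ : V => c).
Proof. by move=> x; exact: cvg_cst. Qed.

Lemma ctsD f g : continuous f -> continuous g -> continuous (fun x => f x + g x).
Proof. by move=> fc gc x; apply: cvgD; [exact: fc|exact: gc]. Qed.

Lemma ctsB f g : continuous f -> continuous g -> continuous (fun x => f x - g x).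
Proof. by move=> fc gc x; apply: cvgB; [exact: fc|exact: gc]. Qed.

Lemma ctsM f g : continuous f -> continuous g -> continuous (fun x => f x * g x).
Proof. by move=> fc gc x; apply: cvgM; [exact: fc|exact: gc]. Qed.

Lemma cts_sum m (f : 'I_m -> V -> R) : (forall i, continuous (f i)) ->
  continuous (fun x => \sum_i f i x).
Proof.
by move=> fc x; apply: (cvg_sum_pt (FF := nbhs_filter x)) => i; exact: fc.
Qed.

Lemma cts_max_inv f c : 0 < c -> continuous f ->
  continuous (fun x => (Num.max (f x) c)^-1).
Proof.
move=> c0 fc x; apply: cvgV; first by rewrite gt_eqF// lt_max c0 orbT.
by apply: (@continuous_max _ _ f (fun=> c)); [exact: fc|exact: cvg_cst].
Qed.

End continuous_ops.

Lemma is_derive_scale (R : realType) (V : normedModType R) (f : V -> R) x v c d :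
  is_derive (c *: x) v f d -> is_derive x v (fun y => f (c *: y)) (c * d).
Proof.
move=> fd; rewrite -[x]add0r -(scale0r v).
apply: (is_derive_line (fun y => f (c *: y)) _ v _ _).2.
have -> : (fun h : R => f (c *: (h *: v + x))) =
    (fun h => (fun s : R => f (s *: v + c *: x)) (c * h)).
  by apply/funext => h; rewrite scalerDr scalerA.
have {}fd : is_derive (c * 0) 1 (fun s : R => f (s *: v + c *: x)) d.
  by apply: (is_derive_line f _ v _ d).1; rewrite mulr0 scale0r add0r.
have lc : is_derive (0:R) 1 (fun h : R => c * h) c.
  have := @is_deriveZ_pt R R id 0 1 c 1 (is_derive_id _ _).
  by rewrite mulr1.
rewrite [c * d]mulrC.
exact: (@is_derive_compR R R (fun s : R => f (s *: v + c *: x))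
  (fun h : R => c * h) 0 1 d c fd lc).
Qed.

Lemma is_derive_simplex_eq (R : realType) n (F G : 'rV[R]_n -> R) x v d :
  (forall y, open_simplex y -> F y = G y) -> open_simplex x -> tangent v ->
  is_derive x v F d -> is_derive x v G d.
Proof.
move=> FG ox tv /is_deriveE Fd; apply/is_deriveE.
apply: cvg_trans Fd; apply: near_eq_cvg.
have o : \forall h \near (0:R)^', open_simplex (h *: v + x).
  apply: (near_open_simplex ox).
    by move=> k; apply: line_cvg; apply/cvgr0Pnorm_lt => e e0; exact: dnbhs0_lt.
  by apply: nearW => h; rewrite sum_line//; case: ox => -[].
by near=> h; rewrite !FG//; near: h.
Unshelve. all: by end_near. Qed.

(** * Approximation of functions on a face *)

Section composition.
Context {R : realType} {n p : nat}.
Variables (r : 'I_n -> 'I_n -> R) (T C Cfar : R).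
Variables (f : 'I_n -> 'rV[R]_n -> R) (df : 'I_n -> 'rV[R]_n -> 'rV[R]_n -> R).
Variable ddf : 'I_n -> 'rV[R]_n -> 'rV[R]_n -> 'rV[R]_n -> R.
Hypothesis psh : push_spec r T C Cfar f df ddf.
Variable U : 'M[R]_(n, p).
Hypothesis U_ge0 : forall k i, 0 <= U k i.
Hypothesis U_sum : forall k, \sum_i U k i = 1.
Hypothesis U_onto : forall i, exists k, 0 < U k i.
Variable e : R.
Hypothesis e_gt0 : 0 < e.
Hypothesis e_lt : e * (n%:R * T) < 1.

Local Notation vj := (jump_vector r).
Let W j : 'rV[R]_p := vj j *m U.
Let a j (x : 'rV[R]_n) := e * f j (e^-1 *: x).
Let da j v (x : 'rV[R]_n) := df j v (e^-1 *: x).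
Let dda j v w (x : 'rV[R]_n) := e^-1 * ddf j v w (e^-1 *: x).

Definition pushmap (x : 'rV[R]_n) : 'rV[R]_p :=
  (x - \sum_j (e * f j (e^-1 *: x)) *: jump_vector r j) *m U.

(** The derivative of [G \o pushmap] along v, as an expression continuous up to the boundary; this
    is what identifies [tderiv] on the closed simplex. *)
Definition chain1 (G : 'rV[R]_p -> R) v (x : 'rV[R]_n) : R :=
  tderiv (v *m U) G (pushmap x) -
  \sum_j df j v (e^-1 *: x) * tderiv (jump_vector r j *m U) G (pushmap x).

Definition chain2 (H : 'rV[R]_p -> R) v w (x : 'rV[R]_n) : R :=
  chain1 (tderiv (v *m U) H) w x -
  \sum_j (df j v (e^-1 *: x) * chain1 (tderiv (jump_vector r j *m U) H) w x +
          tderiv (jump_vector r j *m U) H (pushmap x) *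
            (e^-1 * ddf j v w (e^-1 *: x))).

Lemma tangent_mulU v : tangent v -> tangent (v *m U).
Proof.
rewrite /tangent => tv; under eq_bigr do rewrite mxE.
rewrite exchange_big/=; under eq_bigr do rewrite -mulr_sumr U_sum mulr1.
exact: tv.
Qed.

Let tW j : tangent (W j).
Proof. by apply: tangent_mulU; exact: tangent_jump_vector. Qed.

Let scaled_ge0 (x : 'rV[R]_n) : simplex x -> forall i, 0 <= (e^-1 *: x) 0 i.
Proof. by case=> x0 _ i; rewrite mxE mulr_ge0// invr_ge0 ltW. Qed.

Let scaled_sum (x : 'rV[R]_n) : simplex x ->
  n%:R * T < \sum_j (e^-1 *: x) 0 j.
Proof.
case=> _ x1; under eq_bigr do rewrite mxE.
by rewrite -mulr_sumr x1 mulr1 -[ltRHS]mul1r ltr_pdivlMr// mulrC.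
Qed.

Lemma pushmap_open x : simplex x -> open_simplex (pushmap x).
Proof.
move=> xs; pose y := x - \sum_j (e * f j (e^-1 *: x)) *: vj j.
have y0 k : 0 < y 0 k.
  have := ps_pos psh k (scaled_ge0 xs) (scaled_sum xs).
  rewrite -(pmulr_rgt0 _ e_gt0); congr (0 < _).
  rewrite /y !mxE !summxE mulrBr mulVKf ?gt_eqF//; congr (_ - _).
  by rewrite mulr_sumr; apply: eq_bigr => j _; rewrite !mxE mulrA.
have y1 : \sum_k y 0 k = 1.
  rewrite /y; under eq_bigr do rewrite !mxE.
  rewrite sumrB; case: xs => _ ->.
  have : tangent (\sum_j (e * f j (e^-1 *: x)) *: vj j).
    by apply: tangent_sum => j; apply: tangentZ; exact: tangent_jump_vector.
  by rewrite /tangent => ->; rewrite subr0.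
have p0 i : 0 < pushmap x 0 i.
  rewrite mxE; have [k Uk] := U_onto i.
  rewrite (bigD1 k)//= -/y; apply: ltr_wpDr; last exact: (mulr_gt0 (y0 k) Uk).
  by apply: sumr_ge0 => l _; apply: mulr_ge0 => //; exact/ltW/y0.
split=> //; split => [i|]; first exact: ltW.
under eq_bigr do rewrite mxE.
rewrite exchange_big/= -{}y1; apply: eq_bigr => k _.
by rewrite -mulr_sumr U_sum mulr1.
Qed.

Lemma pushmapE x : pushmap x = x *m U - \sum_j a j x *: W j.
Proof.
rewrite /pushmap mulmxBl mulmx_suml; congr (_ - _).
by apply: eq_bigr => j _; rewrite -scalemxAl.
Qed.

Lemma a_derive j v x : is_derive x v (a j) (da j v x).
Proof.
have := is_deriveZ_pt e (is_derive_scale (ps_derive psh j v (e^-1 *: x))).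
by rewrite mulVKf ?gt_eqF.
Qed.

Lemma da_derive j v w x : is_derive x w (da j v) (dda j v w x).
Proof. exact: is_derive_scale (ps_derive2 psh j v w _). Qed.

Let scale_cont (h : 'rV[R]_n -> R) : continuous h ->
  continuous (fun x : 'rV[R]_n => h (e^-1 *: x)).
Proof.
move=> hc x; apply: (@continuous_comp _ _ _ (fun x : 'rV[R]_n => e^-1 *: x) h).
  exact: scaler_continuous.
exact: hc.
Qed.

Lemma pushmap_coord_derive x v k : is_derive x v (fun x => pushmap x 0 k)
  ((v *m U - \sum_j da j v x *: W j) 0 k).
Proof.
have E u (c : 'I_n -> R) : (u *m U - \sum_j c j *: W j) 0 k =
    \sum_l U l k * u 0 l - \sum_j W j 0 k * c j.
  rewrite [LHS]mxE [X in X + _]mxE [X in _ + X]mxE summxE; congr (_ - _).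
    by apply: eq_bigr => l _; rewrite mulrC.
  by apply: eq_bigr => l _; rewrite [LHS]mxE mulrC.
have -> : (fun x => pushmap x 0 k) = (fun x : 'rV[R]_n =>
    \sum_l U l k * x 0 l - \sum_j W j 0 k * a j x).
  by apply/funext => y; rewrite pushmapE E.
rewrite E; apply: is_deriveB_pt; apply: is_derive_sum_pt => j;
  apply: is_deriveZ_pt; last exact: a_derive.
apply/is_deriveE; apply: cvg_near_cst; near=> h.
rewrite !mxE addrK mulKf//; near: h; exact: nbhs_dnbhs_neq.
Unshelve. all: by end_near. Qed.

(** It holds at boundary points too: f is differentiable on the whole space, and the image of a line
    through x is a curve through an interior point, to which [Cn1_curve_derive] applies. *)
Lemma chain1_derive G v x : Cn 1 G -> tangent v -> simplex x ->
  is_derive x v (G \o pushmap) (chain1 G v x).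
Proof.
move=> G1 tv xs; have po := pushmap_open xs.
have tdv : tangent (v *m U - \sum_j da j v x *: W j).
  apply: tangentB; first exact: tangent_mulU.
  by apply: tangent_sum => j; exact: tangentZ.
have -> : chain1 G v x = tderiv (v *m U - \sum_j da j v x *: W j) G (pushmap x).
  rewrite -scaleN1r (tderivD G1) ?(tderivZ G1) ?(tderiv_sum G1) ?mulN1r//;
    try exact: open_simplexW.
  - congr (_ - _); apply: eq_bigr => j _; rewrite (tderivZ G1)//.
    exact: open_simplexW.
  - by move=> j; exact: tangentZ.
  - by apply: tangent_sum => j; exact: tangentZ.
  - exact: tangent_mulU.
  - by apply: tangentZ; apply: tangent_sum => j; exact: tangentZ.
apply/is_deriveE; apply: (Cn1_curve_derive G1 (g := fun h => pushmap (h *: v + x)) po tdv).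
  move=> h; rewrite !pushmapE.
  rewrite (_ : _ - _ = (h *: v) *m U - (\sum_j a j (h *: v + x) *: W j -
      \sum_j a j x *: W j)).
    apply: tangentB; first by apply: tangent_mulU; exact: tangentZ.
    by apply: tangentB; apply: tangent_sum => j; exact: tangentZ.
  by rewrite mulmxDl; apply/rowP => k; rewrite !mxE; ring.
move=> k; have /is_deriveE := pushmap_coord_derive x v k.
apply: cvg_trans; apply: near_eq_cvg; apply: nearW => h /=.
by rewrite [in RHS]mxE [X in _ = _ * (_ + X)]mxE.
Qed.

Lemma pushmap_coordE x k :
  pushmap x 0 k = \sum_l U l k * x 0 l - \sum_j W j 0 k * a j x.
Proof.
rewrite pushmapE [LHS]mxE [X in X + _]mxE [X in _ + X]mxE summxE; congr (_ - _).
  by apply: eq_bigr => l _; rewrite mulrC.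
by apply: eq_bigr => l _; rewrite [LHS]mxE mulrC.
Qed.

Lemma a_continuous j : continuous (a j).
Proof.
by apply: continuous_scale; apply: scale_cont; have [] := ps_cont psh j 0 0.
Qed.

Lemma comp_pushmap_continuous (G : 'rV[R]_p -> R) : {within simplex, continuous G} ->
  {within simplex, continuous (fun x : 'rV[R]_n => G (pushmap x))}.
Proof.
move=> Gc; apply/subspace_continuousP => x xs.
apply: (simplex_cvg (g := pushmap)) => //.
- exact/open_simplexW/pushmap_open.
- move=> k; apply: cvg_within_filter.
  have pc : continuous (fun x : 'rV[R]_n => pushmap x 0 k); last exact: pc.
  have -> : (fun x : 'rV[R]_n => pushmap x 0 k) = (fun x : 'rV[R]_n =>
      \sum_l U l k * x 0 l - \sum_j W j 0 k * a j x).
    by apply/funext => y; exact: pushmap_coordE.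
  apply: ctsB; apply: cts_sum => j; apply: continuous_scale.
    by move=> y; exact: coord_continuous.
  exact: a_continuous.
- by rewrite near_withinE; near=> y => ys; exact/open_simplexW/pushmap_open.
Unshelve. all: by end_near. Qed.

Let da_within j v : {within simplex, continuous (da j v)}.
Proof.
apply: continuous_subspaceT; apply: scale_cont.
by have [] := ps_cont psh j v 0.
Qed.

Lemma chain1_continuous G v : Cn 1 G -> tangent v ->
  {within simplex, continuous (chain1 G v)}.
Proof.
move=> G1 tv; apply: ctsB.
  exact: (comp_pushmap_continuous (Cn1_tderiv G1 (tangent_mulU tv))).
apply: cts_sum => j; apply: ctsM; first exact: da_within.
exact: (comp_pushmap_continuous (Cn1_tderiv G1 (tW j))).
Qed.

Section C2.
Variable H : 'rV[R]_p -> R.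
Hypothesis H2 : Cn 2 H.

Let DH v : tangent v -> Cn 1 (tderiv (v *m U) H).
Proof. by move=> tv; apply: (Cn2_tderiv H2); exact: tangent_mulU. Qed.

Let DW j : Cn 1 (tderiv (W j) H).
Proof. exact: (Cn2_tderiv H2). Qed.

Lemma chain2_continuous v w : tangent v -> tangent w ->
  {within simplex, continuous (chain2 H v w)}.
Proof.
move=> tv tw; apply: ctsB; first by apply: chain1_continuous => //; exact: DH.
apply: cts_sum => j; apply: ctsD; apply: ctsM.
- exact: da_within.
- by apply: chain1_continuous => //; exact: DW.
- exact: (comp_pushmap_continuous (Cn1_tderiv (Cn2_Cn1 H2) (tW j))).
- apply: continuous_subspaceT; apply: continuous_scale; apply: scale_cont.
  by have [] := ps_cont psh j v w.
Qed.

Lemma chain2_derive v w x : tangent v -> tangent w -> simplex x ->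
  is_derive x w (chain1 H v) (chain2 H v w x).
Proof.
move=> tv tw xs; apply: is_deriveB_pt.
  by apply: (chain1_derive (DH tv)).
apply: is_derive_sum_pt => j; apply: is_deriveM_pt; first exact: da_derive.
exact: (chain1_derive (DW j)).
Qed.

Let F := H \o pushmap.

Lemma tderiv_comp v x : tangent v -> simplex x -> tderiv v F x = chain1 H v x.
Proof.
move=> tv; apply: tderiv_eq.
  by apply: chain1_continuous => //; exact: Cn2_Cn1.
move=> y oy; have := chain1_derive (Cn2_Cn1 H2) tv (open_simplexW oy).
by move=> d; rewrite derive_val.
Qed.

Let tderiv_comp_derive v w x : tangent v -> tangent w -> open_simplex x ->
  is_derive x w (tderiv v F) (chain2 H v w x).
Proof.
move=> tv tw ox; apply: (is_derive_simplex_eq (F := chain1 H v)) => //.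
  by move=> y /open_simplexW ys; rewrite tderiv_comp.
exact/chain2_derive/open_simplexW.
Qed.

Lemma tderiv2_comp v w x : tangent v -> tangent w -> simplex x ->
  tderiv w (tderiv v F) x = chain2 H v w x.
Proof.
move=> tv tw; apply: tderiv_eq; first exact: chain2_continuous.
by move=> y oy; have d := tderiv_comp_derive tv tw oy; rewrite derive_val.
Qed.

Lemma within_simplex_eq (G1 G2 : 'rV[R]_n -> R) :
  (forall x, simplex x -> G1 x = G2 x) ->
  {within simplex, continuous G2} -> {within simplex, continuous G1}.
Proof.
move=> G12; apply: subspace_eq_continuous => x /set_mem xs; exact/esym/G12.
Qed.

Lemma Cn2_comp : Cn 2 F.
Proof.
have c1 v : tangent v -> {within simplex, continuous (tderiv v F)}.
  move=> tv; apply: (within_simplex_eq (fun x => tderiv_comp tv)).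
  by apply: chain1_continuous => //; exact: Cn2_Cn1.
split; first by apply: comp_pushmap_continuous; case: H2.
move=> v tv; split=> [x ox|].
  rewrite tderiv_comp//; last exact: open_simplexW.
  by apply: chain1_derive => //; [exact: Cn2_Cn1|exact: open_simplexW].
split; first exact: c1.
move=> w tw; split=> [x ox|].
  by rewrite tderiv2_comp//; [exact: tderiv_comp_derive|exact: open_simplexW].
split=> //; apply: (within_simplex_eq (fun x => tderiv2_comp tv tw)).
exact: chain2_continuous.
Qed.

Lemma chain1_near x j : simplex x -> x 0 j <= e * T / 2 ->
  chain1 H (vj j) x = 0.
Proof.
move=> xs xj; rewrite /chain1.
have E i : df i (vj j) (e^-1 *: x) = (i == j)%:R.
  apply: (ps_near psh) => //; [exact: scaled_ge0|exact: scaled_sum|].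
  by rewrite mxE ler_pdivrMl// mulrA.
under eq_bigr do rewrite E.
by rewrite sum_indicator subrr.
Qed.

Lemma gen_domain_comp : gen_domain r F.
Proof.
split; first exact: Cn2_comp.
move=> j; pose c := e * T / 2.
have c0 : 0 < c by rewrite divr_gt0// mulr_gt0// (ps_gt0 psh).
have tj := tangent_jump_vector r j.
(* The numerator vanishes for x_j <= c, so x_j may be replaced by max(x_j, c), which stays away from
   0. *)
apply: (within_simplex_eq (G2 := fun x => chain1 H (vj j) x * (Num.max (x 0 j) c)^-1)).
  move=> x xs; rewrite tderiv_comp//; case: xs (xs) => x0 _ xs.
  have [xc|cx] := leP (x 0 j) c.
    by rewrite chain1_near// !mul0r; case: ifP.
  by rewrite (lt_trans c0 cx).
apply: ctsM; first by apply: chain1_continuous => //; exact: Cn2_Cn1.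
apply: continuous_subspaceT; apply: cts_max_inv => // x.
exact: coord_continuous.
Qed.

End C2.
End composition.

Section bounded_on.
Context {R : realType} {S : Type} (D : S -> Prop).
Implicit Types f g : S -> R.

Definition bounded_on f := exists C, forall s, D s -> `|f s| <= C.

Lemma bounded_onD f g : bounded_on f -> bounded_on g ->
  bounded_on (fun s => f s + g s).
Proof.
move=> [C hC] [C' hC']; exists (C + C') => s Ds.
by apply: (le_trans (ler_normD _ _)); apply: lerD; [exact: hC|exact: hC'].
Qed.

Lemma bounded_onB f g : bounded_on f -> bounded_on g ->
  bounded_on (fun s => f s - g s).
Proof.
move=> [C hC] [C' hC']; exists (C + C') => s Ds.
by apply: (le_trans (ler_normB _ _)); apply: lerD; [exact: hC|exact: hC'].
Qed.

Lemma bounded_onM f g : bounded_on f -> bounded_on g ->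
  bounded_on (fun s => f s * g s).
Proof.
move=> [C hC] [C' hC']; exists (C * C') => s Ds.
by rewrite normrM; apply: ler_pM => //; [exact: hC|exact: hC'].
Qed.

Lemma bounded_on_cst c : bounded_on (fun=> c).
Proof. by exists `|c|. Qed.

Lemma bounded_on_sum m (f : 'I_m -> S -> R) : (forall i, bounded_on (f i)) ->
  bounded_on (fun s => \sum_i f i s).
Proof.
elim: m f => [|m IH] f bf.
  by under eq_fun do rewrite big_ord0; exact: bounded_on_cst.
under eq_fun do rewrite big_ord_recr.
by apply: bounded_onD; [exact: IH|exact: bf].
Qed.

End bounded_on.

Lemma cvg0_bounded (R : realType) (u v : nat -> R) (M : R) :
  (forall k, `|u k| <= M) -> v k @[k --> \oo] --> (0:R) ->
  u k * v k @[k --> \oo] --> (0:R).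
Proof.
move=> uM v0; apply/cvgr0Pnorm_lt => e e0.
have M0 : 0 <= M := le_trans (normr_ge0 _) (uM 0%N).
have d0 : 0 < e / (M + 1) by rewrite divr_gt0// ltr_wpDl.
move/cvgr0Pnorm_lt : v0 => /(_ _ d0) H.
near=> k; have vk : `|v k| < e / (M + 1) by near: k; exact: H.
rewrite normrM; apply: (@le_lt_trans _ _ (M * `|v k|)).
  exact: ler_wpM2r.
move: vk; rewrite ltr_pdivlMr ?ltr_wpDl// => vk.
have := normr_ge0 (v k); lra.
Unshelve. all: by end_near. Qed.

(** * Uniform bounds and limits on the face *)

Section face.
Context {R : realType} {n : nat} (B : {set 'I_n}).
Local Notation p := #|B|.
Implicit Types y : 'rV[R]_p.

Lemma sum_extend_coord y (F : 'I_n -> R) :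
  \sum_k extend_coord y 0 k * F k = \sum_i y 0 i * F (enum_val i).
Proof.
rewrite (bigID (mem B))/= [X in _ + X]big1 ?addr0; last first.
  by move=> k kB; rewrite extend_coord_out// mul0r.
rewrite big_enum_val; apply: eq_bigr => i _; by rewrite extend_coord_in.
Qed.

Lemma extend_coord_simplex y : simplex y -> simplex (extend_coord y).
Proof.
move=> [y0 y1]; split=> [j|].
  have [jB|jB] := boolP (j \in B); last by rewrite extend_coord_out.
  by rewrite -(enum_rankK_in jB jB) extend_coord_in.
rewrite -y1; have := sum_extend_coord y (fun=> 1).
by under eq_bigr do rewrite mulr1; under [RHS]eq_bigr do rewrite mulr1.
Qed.

Variables (r : 'I_n -> 'I_n -> R) (T C Cfar : R).
Variables (f : 'I_n -> 'rV[R]_n -> R) (df : 'I_n -> 'rV[R]_n -> 'rV[R]_n -> R).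
Variable ddf : 'I_n -> 'rV[R]_n -> 'rV[R]_n -> 'rV[R]_n -> R.
Hypothesis psh : push_spec r T C Cfar f df ddf.
Variable U : 'M[R]_(n, p).
Hypothesis U_ge0 : forall k i, 0 <= U k i.
Hypothesis U_sum : forall k, \sum_i U k i = 1.
Hypothesis U_in : forall i i', U (enum_val i) i' = (i == i')%:R.
Variable rB : 'I_p -> 'I_p -> R.
Hypothesis W_in : forall i, jump_vector r (enum_val i) *m U = jump_vector rB i.
Hypothesis W_out : forall j, j \notin B -> jump_vector r j *m U = 0.
Variable H : 'rV[R]_p -> R.
Hypothesis HD : gen_domain rB H.

Local Notation W j := (jump_vector r j *m U).
Local Notation ext := (@extend_coord R n B).
Local Notation Psi := (pushmap r f U).

Let H2 : Cn 2 H. Proof. by case: HD. Qed.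

Let U_onto i : exists k, 0 < U k i.
Proof. by exists (enum_val i); rewrite U_in eqxx ltr01. Qed.

Let tW j : tangent (W j).
Proof. by apply: tangent_mulU => //; exact: tangent_jump_vector. Qed.

Lemma extend_coord_mulU y : ext y *m U = y.
Proof.
apply/rowP => i; rewrite mxE sum_extend_coord.
by under eq_bigr do rewrite U_in mulrC; rewrite sum_indicator.
Qed.

(** The domain condition on H as a factorisation, with g vanishing on the face y_j = 0. Outside B
    both sides are 0, which lets the later sums run over all of S. *)
Lemma face_derivative j : exists g : 'rV[R]_p -> R, {within simplex, continuous g} /\
  forall y, simplex y -> tderiv (W j) H y = g y * ext y 0 j /\
    (ext y 0 j = 0 -> g y = 0).
Proof.
have [jB|jB] := boolP (j \in B); last first.
  exists (fun=> 0); split; first by apply: continuous_subspaceT => x; exact: cst_continuous.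
  move=> y ys; split=> //; rewrite W_out// mul0r.
  rewrite -(scale0r (0 : 'rV[R]_p)) (tderivZ (Cn2_Cn1 H2)) ?mul0r//.
  by rewrite /tangent big1// => i _; rewrite mxE.
rewrite -(enum_rankK_in jB jB); set i := enum_rank_in _ _.
rewrite W_in; case: HD => _ /(_ i); set g := fun x : 'rV_p => _ => gc.
exists g; split=> // y ys; rewrite extend_coord_in; split; last first.
  by rewrite /g => ->; rewrite ltxx.
have tv := tangent_jump_vector rB i.
apply: (@eq_on_simplex _ _ (tderiv (jump_vector rB i) H) (fun y => g y * y 0 i)) => //.
- exact: (Cn1_tderiv (Cn2_Cn1 H2)).
- apply: ctsM => //; apply: continuous_subspaceT => x; exact: coord_continuous.
- by move=> x [_ x0]; rewrite /g x0 divfK// gt_eqF.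
Qed.

Let tderiv0 (G : 'rV[R]_p -> R) y : Cn 1 G -> simplex y -> tderiv 0 G y = 0.
Proof.
move=> G1 ys; rewrite -(scale0r (0 : 'rV[R]_p)) (tderivZ G1) ?mul0r//.
by rewrite /tangent big1// => i _; rewrite mxE.
Qed.

(** On {y_j = 0} the coefficients [df j] are bounded but need not tend to 0; the terms of [chain2]
    that they multiply have these limits. *)
Lemma face_derivative2 j w y : tangent w -> simplex y -> ext y 0 j = 0 ->
  tderiv w (tderiv (W j) H) y = 0 /\ tderiv (W j) (tderiv w H) y = 0.
Proof.
move=> tw ys yj; rewrite [X in _ /\ X](_ : _ = (tderiv w (tderiv (W j) H) y = 0)).
  suff -> : tderiv w (tderiv (W j) H) y = 0 by [].
  have [jB|jB] := boolP (j \in B); last first.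
    by rewrite (tderiv_sym H2 tw (tW j) ys) W_out// tderiv0//; exact: Cn2_tderiv.
  have [g [gc gH]] := face_derivative j.
  have ji := enum_rankK_in jB jB; set i := enum_rank_in jB j in ji.
  have e z : ext z 0 j = z 0 i by rewrite -ji extend_coord_in.
  apply: (@tderiv_vanish _ _ _ g i) => //.
  - exact: (Cn2_tderiv H2 (tW j)).
  - by move=> x xs; have [-> _] := gH x xs; rewrite e.
  - by rewrite -e.
  - by have [_ ->] := gH y ys.
by rewrite (tderiv_sym H2 tw (tW j) ys).
Qed.

Let Cp : R := (\sum_j \sum_i `|W j 0 i|) * C.

Let scaled_ge0 e (x : 'rV[R]_n) : 0 < e -> simplex x -> forall i, 0 <= (e^-1 *: x) 0 i.
Proof. by move=> e0 [x0 _] i; rewrite mxE mulr_ge0// invr_ge0 ltW. Qed.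

Let C_ge0 y : simplex y -> 0 <= C.
Proof.
move=> ys; have n0 := simplex_gt0 (extend_coord_simplex ys).
have /andP[] := ps_le psh (Ordinal n0) (scaled_ge0 ltr01 (extend_coord_simplex ys)).
exact: le_trans.
Qed.

Let Cp_ge0 y : simplex y -> 0 <= Cp.
Proof.
move=> ys; rewrite mulr_ge0 ?(C_ge0 ys)//.
by apply: sumr_ge0 => k _; apply: sumr_ge0.
Qed.

Lemma pushmap_ext_dist e y i : 0 < e -> simplex y ->
  `|Psi e (ext y) 0 i - y 0 i| <= e * Cp.
Proof.
move=> e0 ys; rewrite pushmap_coordE.
have -> : \sum_l U l i * ext y 0 l = y 0 i.
  rewrite -[in RHS](extend_coord_mulU y) mxE.
  by apply: eq_bigr => l _; rewrite mulrC.
rewrite addrC addKr normrN; apply: (le_trans (ler_norm_sum _ _ _)).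
rewrite /Cp mulrCA mulr_suml; apply: ler_sum => j _; rewrite normrM.
have /andP[f0 fC] := ps_le psh j (scaled_ge0 e0 (extend_coord_simplex ys)).
apply: ler_pM => //.
  by rewrite (bigD1 i)//= lerDl sumr_ge0.
by rewrite ger0_norm ?mulr_ge0 ?(ltW e0)// ler_pM2l.
Qed.

Lemma ext_pushmap_le e y j : 0 < e -> simplex y ->
  ext (Psi e (ext y)) 0 j <= ext y 0 j + e * Cp.
Proof.
move=> e0 ys; have [jB|jB] := boolP (j \in B); last first.
  rewrite !extend_coord_out// add0r mulr_ge0 ?(ltW e0)//.
  exact: Cp_ge0 ys.
rewrite -(enum_rankK_in jB jB) !extend_coord_in -lerBlDl.
exact: (le_trans (ler_norm _) (pushmap_ext_dist _ e0 ys)).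
Qed.

Let adm (s : R * 'rV[R]_p) := [/\ 0 < s.1, s.1 * (n%:R * T) < 1 & simplex s.2].

Let Psi_open s : adm s -> open_simplex (Psi s.1 (ext s.2)).
Proof.
move=> [e0 eT ys]; apply: (pushmap_open psh) => //.
exact: extend_coord_simplex.
Qed.

(** The factorisation of [face_derivative] at the pushed point, whose coordinate j exceeds the
    original one by at most e times [Cp]. *)
Lemma face_derivative_le : exists2 Mg, 0 <= Mg & forall s j, adm s ->
  `|tderiv (W j) H (Psi s.1 (ext s.2))| <= Mg * (ext s.2 0 j + s.1 * Cp).
Proof.
have bg j : exists M, 0 <= M /\ forall s, adm s ->
    `|tderiv (W j) H (Psi s.1 (ext s.2))| <= M * (ext s.2 0 j + s.1 * Cp).
  have [g [gc gH]] := face_derivative j; have [M hM] := simplex_bounded gc.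
  have M0 s : adm s -> 0 <= M.
    by move=> As; apply: le_trans (hM _ (open_simplexW (Psi_open As))).
  (* If no pair is admissible, nothing forces M to be nonnegative, which the sum over j below
     requires. *)
  exists `|M|; split=> // s As; have Ps := open_simplexW (Psi_open As).
  have [-> _] := gH _ Ps; rewrite normrM; apply: ler_pM => //.
    by apply: le_trans (hM _ Ps) _; exact: ler_norm.
  rewrite ger0_norm; last by case: (extend_coord_simplex Ps).
  by case: As => e0 _ ys; exact: ext_pushmap_le.
have {}bg j := cid (bg j).
exists (\sum_j sval (bg j)).
  by apply: sumr_ge0 => j _; have [] := svalP (bg j).
move=> s j As; have [Mj0 hj] := svalP (bg j).
apply: (le_trans (hj s As)); apply: ler_wpM2r.
  case: As => e0 _ ys; apply: addr_ge0; last first.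
    by apply: mulr_ge0; [exact: ltW|exact: Cp_ge0 ys].
  by case: (extend_coord_simplex ys).
rewrite [leRHS](bigD1 j)//= lerDl; apply: sumr_ge0 => k _.
by have [] := svalP (bg k).
Qed.

Let scaled_entry e y j : (e^-1 *: ext y) 0 j = e^-1 * ext y 0 j.
Proof. by rewrite mxE. Qed.

Let bnd_Psi G : {within simplex, continuous G} ->
  bounded_on adm (fun s => G (Psi s.1 (ext s.2)) : R).
Proof.
move=> Gc; have [M hM] := simplex_bounded Gc; exists M => s As.
exact/hM/open_simplexW/Psi_open.
Qed.

Let bnd_df j v : bounded_on adm (fun s => df j v (s.1^-1 *: ext s.2)).
Proof.
by have [M hM] := ps_bounded psh v 0; exists M => s _; have [] := hM j (s.1^-1 *: ext s.2).
Qed.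

Let bnd_chain1 G v : Cn 1 G -> tangent v ->
  bounded_on adm (fun s => chain1 r f df U s.1 G v (ext s.2)).
Proof.
move=> G1 tv; apply: bounded_onB.
  by apply: (bnd_Psi (Cn1_tderiv G1 (tangent_mulU _ tv))).
apply: bounded_on_sum => j; apply: bounded_onM => //.
exact: (bnd_Psi (Cn1_tderiv G1 (tW j))).
Qed.

(** Here h is of order 1 / e. It vanishes for x_j >= e [Cfar], and below this level the derivative
    of H is O(e) and compensates. *)
Let bnd_far (h : R -> 'rV[R]_n -> R) j :
  (forall s, adm s -> Cfar <= s.1^-1 * ext s.2 0 j -> h s.1 (ext s.2) = 0) ->
  bounded_on adm (fun s => s.1 * h s.1 (ext s.2)) ->
  bounded_on adm (fun s => tderiv (W j) H (Psi s.1 (ext s.2)) * h s.1 (ext s.2)).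
Proof.
move=> hfar [M hM]; have [Mg Mg0 hMg] := face_derivative_le.
exists (Mg * (`|Cfar| + Cp) * M) => s As; have [e0 _ ys] := As.
have [far|near] := leP Cfar (s.1^-1 * ext s.2 0 j).
  rewrite hfar// mulr0 normr0; apply: mulr_ge0.
    by apply: mulr_ge0 => //; apply: addr_ge0 => //; exact: Cp_ge0 ys.
  exact: le_trans (hM s As).
have -> : tderiv (W j) H (Psi s.1 (ext s.2)) * h s.1 (ext s.2) =
    (tderiv (W j) H (Psi s.1 (ext s.2)) / s.1) * (s.1 * h s.1 (ext s.2)).
  by rewrite mulrA divfK// gt_eqF.
rewrite normrM; apply: ler_pM => //; last exact: hM.
rewrite normrM normfV (gtr0_norm e0) ler_pdivrMr// -mulrA.
apply: (le_trans (hMg s j As)); rewrite ler_wpM2l// mulrDl lerD//; last first.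
  by rewrite mulrC.
apply: (@le_trans _ _ (Cfar * s.1)); last by rewrite ler_pM2r// ler_norm.
by move: near; rewrite mulrC ltr_pdivrMr// => /ltW.
Qed.

Let bnd_ddf j v w : bounded_on adm (fun s => tderiv (W j) H (Psi s.1 (ext s.2)) *
  (s.1^-1 * ddf j v w (s.1^-1 *: ext s.2))).
Proof.
apply: (bnd_far (h := fun e x => e^-1 * ddf j v w (e^-1 *: x))).
  move=> s [e0 _ ys] far.
  have [|_ ->] := ps_far psh (j := j) v w (scaled_ge0 e0 (extend_coord_simplex ys)).
    by rewrite scaled_entry.
  by rewrite mulr0.
have [M hM] := ps_bounded psh v w; exists M => s [e0 _ _].
by rewrite mulVKf ?gt_eqF//; have [] := hM j (s.1^-1 *: ext s.2).
Qed.

Lemma chain2_bounded v w : tangent v -> tangent w ->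
  bounded_on adm (fun s => chain2 r f df ddf U s.1 H v w (ext s.2)).
Proof.
move=> tv tw; apply: bounded_onB.
  exact: (bnd_chain1 (Cn2_tderiv H2 (tangent_mulU U_sum tv)) tw).
apply: bounded_on_sum => j; apply: bounded_onD => //.
apply: bounded_onM => //.
exact: (bnd_chain1 (Cn2_tderiv H2 (tW j)) tw).
Qed.

(** For x_j <= e T / 2 the derivative vanishes. Otherwise e <= 2 x_j / T, so the main term, of order
    x_j + e, and the correction, of order e, are both O(x_j). *)
Lemma drift_bounded c j : bounded_on adm (fun s =>
  if ext s.2 0 j != 0 then c / ext s.2 0 j *
    chain1 r f df U s.1 H (jump_vector r j) (ext s.2) else 0).
Proof.
have [Mg Mg0 hMg] := face_derivative_le.
have T0 := ps_gt0 psh; have tj := tangent_jump_vector r j.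
have [M hM] : bounded_on adm (fun s => \sum_l
    tderiv (W l) H (Psi s.1 (ext s.2)) *
      (s.1^-1 * df l (jump_vector r j) (s.1^-1 *: ext s.2))).
  apply: bounded_on_sum => l.
  apply: (bnd_far (h := fun e x => e^-1 * df l (jump_vector r j) (e^-1 *: x))).
    move=> s [e0 _ ys] far.
    have [|-> _] := ps_far psh (j := l) (jump_vector r j) 0
        (scaled_ge0 e0 (extend_coord_simplex ys)).
      by rewrite scaled_entry.
    by rewrite mulr0.
  have [M hM] := bnd_df l (jump_vector r j); exists M => s As.
  by case: (As) => e0 _ _; rewrite mulVKf ?gt_eqF//; exact: hM.
exists (`|c| * (Mg * (1 + 2 / T * Cp) + 2 / T * M)) => s As.
have [e0 eT ys] := As; have xs := extend_coord_simplex ys.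
have Cp0 := Cp_ge0 ys; have M0 : 0 <= M by exact: le_trans (hM s As).
have rhs0 : 0 <= Mg * (1 + 2 / T * Cp) + 2 / T * M.
  have T2 : 0 <= 2 / T by rewrite divr_ge0// ltW.
  by apply: addr_ge0; apply: mulr_ge0 => //; apply: addr_ge0 => //; exact: mulr_ge0.
case: ifPn => [x0|_]; last by rewrite normr0; exact: mulr_ge0.
have xj : 0 < ext s.2 0 j by rewrite lt_def x0/=; case: xs.
have [near|far] := leP (ext s.2 0 j) (s.1 * T / 2).
  by rewrite (chain1_near psh)// mulr0 normr0; exact: mulr_ge0.
have ex : s.1 <= 2 / T * ext s.2 0 j.
  by rewrite mulrAC ler_pdivlMr//; move: far => /ltW far; lra.
rewrite -mulrA normrM; apply: ler_wpM2l => //.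
rewrite normrM normfV (gtr0_norm xj) ler_pdivrMl//.
apply: (le_trans (ler_normB _ _)); rewrite [leRHS]mulrDr; apply: lerD.
  apply: (le_trans (hMg s j As)); rewrite [leRHS]mulrCA; apply: ler_wpM2l => //.
  rewrite [leRHS]mulrDr mulr1 lerD2l [leRHS]mulrA; apply: ler_wpM2r => //.
  by rewrite mulrC.
set S := \sum_l _.
have -> : S = s.1 * \sum_l tderiv (W l) H (Psi s.1 (ext s.2)) *
      (s.1^-1 * df l (jump_vector r j) (s.1^-1 *: ext s.2)).
  rewrite mulr_sumr; apply: eq_bigr => l _.
  by rewrite mulrCA mulVKf ?gt_eqF// mulrC.
rewrite normrM (gtr0_norm e0) [leRHS]mulrA; apply: ler_pM => //; [exact: ltW| |exact: hM].
by rewrite mulrC.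
Qed.

Section limit.
Variables (eps : nat -> R) (y : 'rV[R]_p).
Hypothesis eps_gt0 : forall k, 0 < eps k.
Hypothesis eps_lt : forall k, eps k * (n%:R * T) < 1.
Hypothesis eps_cvg : eps k @[k --> \oo] --> (0:R).
Hypothesis ys : simplex y.

Let adm_eps k : adm (eps k, y). Proof. by split; [exact: eps_gt0|exact: eps_lt|exact: ys]. Qed.

Let epsM c : eps k * c @[k --> \oo] --> (0:R).
Proof. by have := cvgM eps_cvg (cvg_cst c); rewrite mul0r; exact. Qed.

Lemma pushmap_cvg G : {within simplex, continuous G} ->
  (G (Psi (eps k) (ext y)) : R) @[k --> \oo] --> G y.
Proof.
move=> Gc; apply: (simplex_cvg (g := fun k => Psi (eps k) (ext y))) => //.
  move=> i; apply/cvgrPdist_le => e e0.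
  move/cvgr0Pnorm_le : (epsM Cp) => /(_ _ e0) H'.
  near=> k; rewrite distrC; apply: (le_trans (pushmap_ext_dist i (eps_gt0 k) ys)).
  by apply: (le_trans (ler_norm _)); near: k; exact: H'.
by apply: nearW => k; exact/open_simplexW/(Psi_open (adm_eps k)).
Unshelve. all: by end_near. Qed.

Let near_far j : ext y 0 j != 0 ->
  \forall k \near \oo, Cfar <= (eps k)^-1 * ext y 0 j.
Proof.
move=> y0; have yj : 0 < ext y 0 j.
  by rewrite lt_def y0/=; case: (extend_coord_simplex ys).
have H' := cvgr_lt _ (epsM Cfar) _ yj.
by near=> k; rewrite ler_pdivlMl//; apply: ltW; near: k; exact: H'.
Unshelve. all: by end_near. Qed.

Let ext_scaled_ge0 k i : 0 <= ((eps k)^-1 *: ext y) 0 i.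
Proof. exact/scaled_ge0/extend_coord_simplex. Qed.

(** If y_j > 0, the point y / e_k ends up in the far region of j, where [df j] is 0; if y_j = 0, a
    bounded factor meets one that tends to 0. *)
Let df_cvg j v (c : nat -> R) (l : R) : c k @[k --> \oo] --> l ->
  (ext y 0 j = 0 -> l = 0) ->
  df j v ((eps k)^-1 *: ext y) * c k @[k --> \oo] --> (0:R).
Proof.
move=> cl l0; have [yj|yj] := eqVneq (ext y 0 j) 0; last first.
  apply: cvg_near_cst; have := near_far yj; apply: filterS => k far.
  have [|-> _] := ps_far psh (j := j) v 0 (ext_scaled_ge0 k).
    by rewrite scaled_entry.
  by rewrite mul0r.
have [M hM] := ps_bounded psh v 0.
apply: (@cvg0_bounded _ _ _ M); first by move=> k; have [] := hM j ((eps k)^-1 *: ext y).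
by rewrite -(l0 yj).
Qed.

(** When y_j = 0, coordinate j of the pushed point is at most e_k times [Cp], which absorbs the
    factor 1 / e_k; the remaining factor g tends to g y = 0. *)
Let ddf_cvg j v w : tderiv (W j) H (Psi (eps k) (ext y)) *
  ((eps k)^-1 * ddf j v w ((eps k)^-1 *: ext y)) @[k --> \oo] --> (0:R).
Proof.
have [yj|yj] := eqVneq (ext y 0 j) 0; last first.
  apply: cvg_near_cst; have := near_far yj; apply: filterS => k far.
  have [|_ ->] := ps_far psh (j := j) v w (ext_scaled_ge0 k).
    by rewrite scaled_entry.
  by rewrite !mulr0.
have [g [gc gH]] := face_derivative j; have [M hM] := ps_bounded psh v w.
have Ps k := open_simplexW (Psi_open (adm_eps k)).
have -> : (fun k => tderiv (W j) H (Psi (eps k) (ext y)) *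
    ((eps k)^-1 * ddf j v w ((eps k)^-1 *: ext y))) = (fun k =>
    (ext (Psi (eps k) (ext y)) 0 j * (eps k)^-1 *
      ddf j v w ((eps k)^-1 *: ext y)) * g (Psi (eps k) (ext y))).
  by apply/funext => k; have [-> _] := gH _ (Ps k); rewrite /=; ring.
apply: (@cvg0_bounded _ _ _ (Cp * M)); last first.
  by have [_ /(_ yj) <-] := gH y ys; exact: pushmap_cvg.
move=> k; rewrite normrM; apply: ler_pM => //; last by have [] := hM j ((eps k)^-1 *: ext y).
rewrite normrM normfV (gtr0_norm (eps_gt0 k)) ler_pdivrMr// ger0_norm.
  by have := ext_pushmap_le j (eps_gt0 k) ys; rewrite yj add0r mulrC.
by case: (extend_coord_simplex (Ps k)).
Qed.

Lemma chain1_cvg G v : Cn 1 G -> tangent v ->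
  (forall j, ext y 0 j = 0 -> tderiv (W j) G y = 0) ->
  chain1 r f df U (eps k) G v (ext y) @[k --> \oo] --> tderiv (v *m U) G y.
Proof.
move=> G1 tv G0.
suff S0 : \sum_j df j v ((eps k)^-1 *: ext y) *
    tderiv (W j) G (Psi (eps k) (ext y)) @[k --> \oo] --> \sum_(j < n) (0:R).
  have := cvgB (pushmap_cvg (Cn1_tderiv G1 (tangent_mulU U_sum tv))) S0.
  by rewrite [\sum_(j < n) (0:R)]big1// subr0; exact.
apply: cvg_sum_pt => j.
exact: (df_cvg v (pushmap_cvg (Cn1_tderiv G1 (tW j))) (G0 j)).
Qed.

Lemma chain2_cvg v w : tangent v -> tangent w ->
  chain2 r f df ddf U (eps k) H v w (ext y) @[k --> \oo] -->
    tderiv (w *m U) (tderiv (v *m U) H) y.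
Proof.
move=> tv tw; have tvU := tangent_mulU U_sum tv; have twU := tangent_mulU U_sum tw.
suff S0 : \sum_j (df j v ((eps k)^-1 *: ext y) *
      chain1 r f df U (eps k) (tderiv (W j) H) w (ext y) +
    tderiv (W j) H (Psi (eps k) (ext y)) *
      ((eps k)^-1 * ddf j v w ((eps k)^-1 *: ext y))) @[k --> \oo] -->
    \sum_(j < n) (0 + 0 : R).
  have C1 : chain1 r f df U (eps k) (tderiv (v *m U) H) w (ext y) @[k --> \oo] -->
      tderiv (w *m U) (tderiv (v *m U) H) y.
    apply: chain1_cvg => //; first exact: (Cn2_tderiv H2 tvU).
    by move=> j yj; have [] := face_derivative2 tvU ys yj.
  have s0 : \sum_(j < n) (0 + 0 : R) = 0 by rewrite big1// => i _; rewrite addr0.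
  by have := cvgB C1 S0; rewrite s0 subr0; exact.
apply: cvg_sum_pt => j; apply: cvgD; last exact: ddf_cvg.
apply: df_cvg.
  apply: chain1_cvg => //; first exact: (Cn2_tderiv H2 (tW j)).
  by move=> l yl; have [] := face_derivative2 (tW j) ys yl.
by move=> yj; have [] := face_derivative2 twU ys yj.
Qed.

End limit.

End face.

(** * Summation by parts and the second-order term *)

Section dirichlet_form.
Context {R : realType} {p : nat}.
Variable beta : 'rV[R]_p -> 'rV[R]_p -> R.
Hypothesis betaD : forall u v w, tangent u -> tangent v -> tangent w ->
  beta (u + v) w = beta u w + beta v w.
Hypothesis betaZ : forall c u w, tangent u -> tangent w ->
  beta (c *: u) w = c * beta u w.
Hypothesis betaC : forall u w, tangent u -> tangent w -> beta u w = beta w u.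

Let betaB u v w : tangent u -> tangent v -> tangent w ->
  beta (u - v) w = beta u w - beta v w.
Proof.
move=> tu tv tw; rewrite -scaleN1r betaD//; last exact: tangentZ.
by rewrite betaZ// mulN1r.
Qed.

Let beta_sum N (g : 'I_N -> 'rV[R]_p) w : (forall i, tangent (g i)) -> tangent w ->
  beta (\sum_i g i) w = \sum_i beta (g i) w.
Proof.
elim: N g => [|N IH] g tg tw.
  rewrite !big_ord0 -(scale0r (0 : 'rV[R]_p)) betaZ ?mul0r//.
  by rewrite /tangent big1// => i _; rewrite mxE.
rewrite !big_ord_recr/= betaD//; last by apply: tangent_sum.
by rewrite IH.
Qed.

(* Integration by parts against an invariant measure. *)
Lemma dirichlet_form N (r : 'I_N -> 'I_N -> R) (m : 'I_N -> R)
    (V : 'I_N -> 'rV[R]_p) :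
  (forall k, \sum_j m j * r j k = m k * total_rate r k) ->
  (forall j, tangent (V j)) ->
  \sum_j \sum_k m j * r j k * beta (V k - V j) (V k - V j) =
  - 2 * \sum_j m j * beta (\sum_k r j k *: (V k - V j)) (V j).
Proof.
move=> m_inv tV; have tVB k j : tangent (V k - V j) by exact: tangentB.
(* The difference of the two squares sums to 0 by invariance, without reversibility; the cross term
   remains. *)
have E k j : beta (V k - V j) (V k - V j) =
    (beta (V k) (V k) - beta (V j) (V j)) - 2 * beta (V k - V j) (V j).
  rewrite betaB// (betaC (tV k))// (betaC (tV j) (tVB k j)) !betaB//.
  by rewrite (betaC (tV j) (tV k)); ring.
under eq_bigr do under eq_bigr do rewrite E mulrBr mulrBr.
under eq_bigr do rewrite sumrB sumrB.
rewrite sumrB sumrB.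
have -> : \sum_j \sum_k m j * r j k * beta (V k) (V k) =
    \sum_j \sum_k m j * r j k * beta (V j) (V j).
  rewrite exchange_big/=; apply: eq_bigr => k _.
  by rewrite -!mulr_suml m_inv -mulr_sumr.
rewrite subrr sub0r mulNr mulr_sumr; congr (- _); apply: eq_bigr => j _.
rewrite beta_sum//; last by move=> k; exact: tangentZ.
by rewrite !mulr_sumr; apply: eq_bigr => k _; rewrite betaZ//; ring.
Qed.

End dirichlet_form.

Section approximation.
Context {R : realType} {n : nat} (B : {set 'I_n}).
Local Notation p := #|B|.
Variables (b : R) (r : 'I_n -> 'I_n -> R) (m : 'I_n -> R).
Hypothesis m_inv : forall k, \sum_j m j * r j k = m k * total_rate r k.
Variables (T C Cfar : R).
Variables (f : 'I_n -> 'rV[R]_n -> R) (df : 'I_n -> 'rV[R]_n -> 'rV[R]_n -> R).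
Variable ddf : 'I_n -> 'rV[R]_n -> 'rV[R]_n -> 'rV[R]_n -> R.
Hypothesis psh : push_spec r T C Cfar f df ddf.
Variable U : 'M[R]_(n, p).
Hypothesis U_ge0 : forall k i, 0 <= U k i.
Hypothesis U_sum : forall k, \sum_i U k i = 1.
Hypothesis U_in : forall i i', U (enum_val i) i' = (i == i')%:R.
Variable rB : 'I_p -> 'I_p -> R.
Hypothesis W_in : forall i, jump_vector r (enum_val i) *m U = jump_vector rB i.
Hypothesis W_out : forall j, j \notin B -> jump_vector r j *m U = 0.
Variable H : 'rV[R]_p -> R.
Hypothesis HD : gen_domain rB H.

Local Notation W j := (jump_vector r j *m U).
Local Notation ext := (@extend_coord R n B).
Local Notation mB := (fun i : 'I_p => m (enum_val i)).

Let H2 : Cn 2 H. Proof. by case: HD. Qed.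

(** Invariance says \sum_j m_j v_j = 0; apply U, which kills the v_j with j outside B. *)
Lemma trace_invariant k : \sum_j mB j * rB j k = mB k * total_rate rB k.
Proof.
have E0 : \sum_j m j *: jump_vector r j = 0.
  apply/rowP => l; rewrite summxE [RHS]mxE.
  under eq_bigr do rewrite mxE jump_vectorE mulrBr mulrCA [l == _]eq_sym.
  by rewrite sumrB sum_indicator m_inv subrr.
have : (\sum_j m j *: W j) 0 k = 0.
  under eq_bigr do rewrite scalemxAl.
  by rewrite -mulmx_suml E0 mul0mx mxE.
rewrite (bigID (mem B))/= [X in _ + X]big1 ?addr0; last first.
  by move=> j /W_out ->; rewrite scaler0.
rewrite big_enum_val summxE => e.
have : \sum_i (mB i * rB i k - (i == k)%:R * (mB i * total_rate rB i)) = 0.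
  rewrite -[RHS]e; apply: eq_bigr => i _.
  by rewrite [RHS]mxE W_in jump_vectorE mulrBr [_ * (_%:R * _)]mulrCA [k == _]eq_sym.
by rewrite sumrB sum_indicator => /eqP; rewrite subr_eq0 => /eqP.
Qed.

(** The summands do not match one by one. After summation by parts only the drift vectors enter, and
    U sends them to 0 outside B and to those of the trace inside B. *)
Lemma face_second_order y : simplex y ->
  \sum_j \sum_k m j * r j k * tderiv ((ebase k - ebase j) *m U)
      (tderiv ((ebase k - ebase j) *m U) H) y =
  \sum_i \sum_k mB i * rB i k * tderiv (ebase k - ebase i)
      (tderiv (ebase k - ebase i) H) y.
Proof.
move=> ys; have i0 : 'I_p by exact: Ordinal (simplex_gt0 ys).
(* Subtracting a fixed vertex makes these vectors tangent and keeps their differences. *)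
pose V k : 'rV[R]_p := ebase k *m U - ebase i0.
pose V' i : 'rV[R]_p := ebase i - ebase i0.
have tV k : tangent (V k).
  rewrite /tangent /V -rowE; under eq_bigr do rewrite !mxE eqxx/=.
  rewrite sumrB U_sum; apply/eqP; rewrite subr_eq0; apply/eqP.
  by have := sum_indicator i0 (fun=> 1 : R); under eq_bigr do rewrite mulr1.
have tV' i : tangent (V' i) by exact: tangent_ebase.
have E k j : (ebase k - ebase j) *m U = V k - V j.
  by rewrite mulmxBl /V opprB addrA subrK.
have E' (k i : 'I_p) : ebase k - ebase i = V' k - V' i :> 'rV[R]_p.
  by rewrite /V' opprB addrA subrK.
pose beta u w := tderiv u (tderiv w H) y.
have bD u v w : tangent u -> tangent v -> tangent w ->
    beta (u + v) w = beta u w + beta v w.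
  by move=> tu tv tw; exact: (tderivD (Cn2_tderiv H2 tw) tu tv ys).
have bZ c u w : tangent u -> tangent w -> beta (c *: u) w = c * beta u w.
  by move=> tu tw; exact: (tderivZ (Cn2_tderiv H2 tw) c tu ys).
have bC u w : tangent u -> tangent w -> beta u w = beta w u.
  by move=> tu tw; exact: (tderiv_sym H2 tu tw ys).
transitivity (\sum_j \sum_k m j * r j k * beta (V k - V j) (V k - V j)).
  by apply: eq_bigr => j _; apply: eq_bigr => k _; rewrite E.
transitivity (\sum_i \sum_k mB i * rB i k * beta (V' k - V' i) (V' k - V' i));
  last by apply: eq_bigr => i _; apply: eq_bigr => k _; rewrite -E'.
have trB := trace_invariant.
move: beta bD bZ bC => beta bD bZ bC.
rewrite (dirichlet_form bD bZ bC m_inv tV).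
rewrite (dirichlet_form bD bZ bC trB tV'); congr (_ * _).
have WE j : \sum_k r j k *: (V k - V j) = W j.
  rewrite /jump_vector mulmx_suml; apply: eq_bigr => k _.
  by rewrite -E scalemxAl.
have WE' i : \sum_k rB i k *: (V' k - V' i) = jump_vector rB i.
  by apply: eq_bigr => k _; rewrite -E'.
rewrite (bigID (mem B))/= [X in _ + X]big1 ?addr0; last first.
  move=> j jB; rewrite WE W_out// -(scale0r (0 : 'rV[R]_p)) bZ ?mul0r ?mulr0//.
  by rewrite /tangent big1// => i _; rewrite mxE.
rewrite big_enum_val; apply: eq_bigr => i _; rewrite WE WE' W_in.
congr (_ * beta _ _).
rewrite /V /V' -rowE; congr (_ - _); apply/rowP => i'.
by rewrite !mxE eqxx U_in eq_sym.
Qed.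

Lemma face_first_order y :
  \sum_j (if ext y 0 j != 0 then m j / ext y 0 j * tderiv (W j) H y else 0) =
  \sum_i (if y 0 i != 0 then mB i / y 0 i * tderiv (jump_vector rB i) H y else 0).
Proof.
rewrite (bigID (mem B))/= [X in _ + X]big1 ?addr0; last first.
  by move=> j jB; rewrite extend_coord_out// eqxx.
rewrite big_enum_val; apply: eq_bigr => i _.
by rewrite extend_coord_in W_in.
Qed.

Lemma face_approximation : exists F : nat -> 'rV[R]_n -> R,
  [/\ forall k, gen_domain r (F k),
    exists M, forall k y, simplex y ->
      `|F k (ext y)| <= M /\ `|gen b m r (F k) (ext y)| <= M &
    forall y, simplex y -> F k (ext y) @[k --> \oo] --> H y /\
      gen b m r (F k) (ext y) @[k --> \oo] --> gen b mB rB H y].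
Proof.
have T0 := ps_gt0 psh; have nT : 0 <= n%:R * T by rewrite mulr_ge0// ltW.
(* The prefactor ensures e_k n T < 1, so that the rescaled mass 1 / e_k exceeds n T, as the obstacle
   problem requires. *)
pose eps (k : nat) : R := (n%:R * T + 1)^-1 * harmonic k.
have c0 : 0 < n%:R * T + 1 by rewrite ltr_wpDl.
have eps_gt0 k : 0 < eps k by rewrite mulr_gt0 ?invr_gt0.
have eps_lt k : eps k * (n%:R * T) < 1.
  rewrite /eps -mulrA ltr_pdivrMl// mulr1; apply: (@le_lt_trans _ _ (n%:R * T)).
    rewrite -[leRHS]mul1r ler_wpM2r// /harmonic/= invf_le1// ler1n//.
  by rewrite ltrDl.
have eps_cvg : eps k @[k --> \oo] --> (0:R).
  have := cvgM (cvg_cst (n%:R * T + 1)^-1) (@cvg_harmonic R).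
  by rewrite mulr0; exact.
have U_onto i : exists k, 0 < U k i.
  by exists (enum_val i); rewrite U_in eqxx ltr01.
pose F k := H \o pushmap r f U (eps k).
have tj j := tangent_jump_vector r j.
have tde (k j : 'I_n) : tangent (ebase k - ebase j : 'rV[R]_n) by exact: tangent_ebase.
have genE k y : simplex y -> gen b m r (F k) (ext y) =
    b * (\sum_j (if ext y 0 j != 0 then m j / ext y 0 j *
      chain1 r f df U (eps k) H (jump_vector r j) (ext y) else 0)) +
    2^-1 * (\sum_j \sum_l m j * r j l * chain2 r f df ddf U (eps k) H
      (ebase l - ebase j) (ebase l - ebase j) (ext y)).
  move=> /extend_coord_simplex xs; rewrite /gen; congr (_ * _ + _ * _).
    apply: eq_bigr => j _; case: ifP => // _.
    by rewrite (tderiv_comp psh U_ge0 U_sum U_onto (eps_gt0 k) (eps_lt k) H2).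
  apply: eq_bigr => j _; apply: eq_bigr => l _.
  by rewrite (tderiv2_comp psh U_ge0 U_sum U_onto (eps_gt0 k) (eps_lt k) H2).
have admE k (y : 'rV[R]_p) : simplex y -> [/\ 0 < (eps k, y).1,
    (eps k, y).1 * (n%:R * T) < 1 & simplex (eps k, y).2].
  by move=> ys; split; [exact: eps_gt0|exact: eps_lt|exact: ys].
exists F; split.
- move=> k.
  exact: (gen_domain_comp psh U_ge0 U_sum U_onto (eps_gt0 k) (eps_lt k) H2).
- have [M1 h1] := simplex_bounded (Cn1_continuous (Cn2_Cn1 H2)).
  have [M2 h2] := bounded_on_sum (fun j =>
    drift_bounded psh U_ge0 U_sum U_in W_in W_out HD (m j) j).
  have [M3 h3] := bounded_on_sum (fun j => bounded_on_sum (fun l =>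
    bounded_onM (bounded_on_cst _ (m j * r j l))
    (chain2_bounded psh U_ge0 U_sum U_in W_in W_out HD (tde l j) (tde l j)))).
  exists (Num.max M1 (`|b| * M2 + 2^-1 * M3)) => k y ys.
  rewrite !le_max; split; apply/orP; [left|right].
    apply/h1/open_simplexW.
    apply: (pushmap_open psh) => //; exact: extend_coord_simplex.
  rewrite genE//; apply: (le_trans (ler_normD _ _)); apply: lerD; rewrite normrM.
    by apply: ler_wpM2l => //; exact: (h2 _ (admE k y ys)).
  rewrite ger0_norm ?invr_ge0//; apply: ler_wpM2l; first by rewrite invr_ge0.
  exact: (h3 _ (admE k y ys)).
- move=> y ys; split.
    exact: (pushmap_cvg psh U_ge0 U_sum U_in eps_gt0 eps_lt eps_cvg ys
      (Cn1_continuous (Cn2_Cn1 H2))).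
  under eq_fun do rewrite genE//.
  rewrite /gen -face_first_order -face_second_order//.
  apply: cvgD; apply: cvgM; do ?exact: cvg_cst.
    apply: cvg_sum_pt => j; case: ifP => _; last exact: cvg_cst.
    apply: cvgM; first exact: cvg_cst.
    apply: (chain1_cvg psh U_ge0 U_sum U_in eps_gt0 eps_lt eps_cvg ys (Cn2_Cn1 H2) (tj j)).
    move=> l yl; have [g [_ gH]] := face_derivative W_in W_out HD l.
    by have [-> _] := gH y ys; rewrite yl mulr0.
  apply: cvg_sum_pt => j; apply: cvg_sum_pt => l.
  apply: cvgM; first exact: cvg_cst.
  exact: (chain2_cvg psh U_ge0 U_sum U_in W_in W_out HD eps_gt0 eps_lt eps_cvg ys).
Qed.

End approximation.

(** * Rates of the trace process *)

Section real_probability.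
Context {R : realType} {d : measure_display} {Omega : measurableType d}.
Variable P : probability Omega R.
Implicit Types A C : set Omega.

Definition pr A : R := fine (P A).

Lemma prE A : measurable A -> P A = (pr A)%:E.
Proof. by move=> mA; rewrite /pr fineK// fin_num_measure. Qed.

Lemma pr_ge0 A : 0 <= pr A. Proof. by rewrite /pr fine_ge0. Qed.

Lemma prU A C : measurable A -> measurable C -> (forall w, A w -> ~ C w) ->
  pr (A `|` C) = pr A + pr C.
Proof.
move=> mA mC AC; apply: EFin_inj; rewrite -prE; last exact: measurableU.
rewrite EFinD -!prE// measureU//.
by apply/seteqP; split => // w [] /AC.
Qed.

Lemma pr_le A C : measurable A -> measurable C -> A `<=` C -> pr A <= pr C.
Proof.
by move=> mA mC AC; rewrite -lee_fin -!prE//; apply: le_measure; rewrite ?inE.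
Qed.

Lemma prU_le A C : measurable A -> measurable C -> pr (A `|` C) <= pr A + pr C.
Proof.
move=> mA mC; have -> : A `|` C = A `|` (C `\` A).
  apply/seteqP; split => w [Aw|]; [by left| |by left|by move=> []; right].
  by have [Aw|nAw] := pselect (A w); [left|right].
have mD : measurable (C `\` A) by exact: measurableD.
rewrite prU//; last by move=> w Aw [].
by rewrite lerD2l; apply: pr_le => // w [].
Qed.

Lemma pr0 : pr set0 = 0. Proof. by rewrite /pr measure0. Qed.

Lemma prT : pr setT = 1. Proof. by rewrite /pr probability_setT. Qed.

Lemma pr_full A G : measurable A -> measurable G -> pr G = 1 ->
  pr (A `&` G) = pr A.
Proof.
move=> mA mG G1; have mAG : measurable (A `&` G) by exact: measurableI.
have mAD : measurable (A `\` G) by exact: measurableD.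
have mC : measurable (~` G) by exact: measurableC.
have e : pr A = pr (A `&` G) + pr (A `\` G).
  by rewrite -prU//; [rewrite setUIDK|move=> w [_ Gw] []].
have : pr setT = pr G + pr (~` G).
  by rewrite -prU// ?setUv// => w Gw; exact.
rewrite prT G1 => h; have /eqP := h.
rewrite -subr_eq0 opprD addrA subrr sub0r oppr_eq0 => /eqP c0.
have : pr (A `\` G) <= pr (~` G) by apply: pr_le => // w [].
rewrite c0 => le0; have := pr_ge0 (A `\` G); lra.
Qed.

Lemma pr_partition (T : finType) (g : Omega -> T) A : measurable A ->
  (forall t, measurable [set w | g w = t]) ->
  pr A = \sum_t pr (A `&` [set w | g w = t]).
Proof.
move=> mA mg.
have H (s : seq T) : uniq s -> measurable [set w | A w /\ g w \in s] /\
    pr [set w | A w /\ g w \in s] = \sum_(t <- s) pr (A `&` [set w | g w = t]).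
  elim: s => [_|t s IH /= /andP[ts us]].
    rewrite big_nil (_ : [set _ | _] = set0) ?pr0//.
    by apply/seteqP; split => // w [].
  have [ms es] := IH us.
  rewrite big_cons -es.
  have -> : [set w | A w /\ g w \in t :: s] =
      (A `&` [set w | g w = t]) `|` [set w | A w /\ g w \in s].
    apply/seteqP; split => w /=.
      by rewrite in_cons => -[Aw /orP[/eqP|]]; [left|right].
    by rewrite in_cons => -[[Aw ->]|[Aw ->]]; rewrite ?eqxx ?orbT.
  split; first by apply: measurableU => //; exact: measurableI.
  rewrite prU//; first exact: measurableI.
  by move=> w [_ /= gt] [_]; rewrite gt (negPf ts).
have [_] := H (enum T) (enum_uniq T); rewrite big_enum/= => <-; congr pr.
by apply/seteqP; split => [w Aw|w []//]; split => //; rewrite mem_enum.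
Qed.

End real_probability.

Section measurable_predicates.
Context {d : measure_display} {Omega : measurableType d}.
Implicit Types Q : Omega -> Prop.
Local Notation mp Q := (measurable [set w | Q w]).

Lemma mp_cst (c : Prop) : mp (fun _ : Omega => c).
Proof.
have [h|h] := pselect c.
  by rewrite (_ : [set _ | _] = setT)//; apply/seteqP; split.
by rewrite (_ : [set _ | _] = set0)//; apply/seteqP; split => // w /h.
Qed.

Lemma mp_and Q Q' : mp Q -> mp Q' -> mp (fun w => Q w /\ Q' w).
Proof. exact: measurableI. Qed.

Lemma mp_or Q Q' : mp Q -> mp Q' -> mp (fun w => Q w \/ Q' w).
Proof. exact: measurableU. Qed.

Lemma mp_not Q : mp Q -> mp (fun w => ~ Q w).
Proof. exact: measurableC. Qed.

Lemma mp_imp (c : Prop) Q : mp Q -> mp (fun w => c -> Q w).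
Proof.
move=> mQ; have [h|h] := pselect c.
  rewrite (_ : [set _ | _] = [set w | Q w])//; apply/seteqP; split => w /=.
    by apply.
  by [].
rewrite (_ : [set _ | _] = setT)//; apply/seteqP; split => w //= _ /h.
Qed.

Lemma mp_all (Q : nat -> Omega -> Prop) : (forall i, mp (Q i)) ->
  mp (fun w => forall i, Q i w).
Proof.
move=> mQ; rewrite (_ : [set _ | _] = \bigcap_i [set w | Q i w]).
  exact: bigcapT_measurable.
by apply/seteqP; split => w /= h; [move=> i _; exact: h|move=> i; exact: (h i Logic.I)].
Qed.

Lemma mp_ex (Q : nat -> Omega -> Prop) : (forall i, mp (Q i)) ->
  mp (fun w => exists i, Q i w).
Proof.
move=> mQ; rewrite (_ : [set _ | _] = \bigcup_i [set w | Q i w]).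
  exact: bigcupT_measurable.
by apply/seteqP; split => w /= [i]; [exists i|exists i].
Qed.

Lemma mp_fin (T : finType) (g : Omega -> T) (D : T -> Prop) :
  (forall t, mp (fun w => g w = t)) -> mp (fun w => D (g w)).
Proof.
move=> mg; rewrite (_ : [set _ | _] = \bigcup_(t in [set t | D t]) [set w | g w = t]).
  by apply: fin_bigcup_measurable; [exact: finite_finset|move=> t _; exact: mg].
by apply/seteqP; split => w /=; [move=> Dg; exists (g w)|move=> [t Dt ->]].
Qed.

End measurable_predicates.

(** * Return to B in terms of the jump chain *)

Section jump_chain.
Context {R : realType} {n : nat} {d : measure_display}
  {Omega : measurableType d}.
Variables (r : 'I_n -> 'I_n -> R) (j : 'I_n) (P : probability Omega R).
Variables (X : R -> Omega -> 'I_n) (Y : nat -> Omega -> 'I_n).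
Variable tau : nat -> Omega -> R.
Hypothesis jh : jump_hold r j P X Y tau.
Hypothesis r_diag : forall j, r j j = 0.
Local Notation mp Q := (measurable [set w | Q w]).

Let jp i l := r i l / total_rate r i.

Let mY i s : mp (fun w => Y i w = s). Proof. exact: (jh_measY jh). Qed.

Let mYD i (D : 'I_n -> Prop) : mp (fun w => D (Y i w)).
Proof. exact: (@mp_fin _ _ _ (Y i) D (mY i)). Qed.

Let pr_path N (k : nat -> 'I_n) :
  pr P [set w | forall i, (i <= N)%N -> Y i w = k i] =
  (k 0%N == j)%:R * \prod_(0 <= i < N) jp (k i) (k i.+1).
Proof.
rewrite /pr (_ : [set _ | _] =
    [set w | forall i, (i <= N)%N -> Y i w = k i /\ 0 < tau i w]).
  rewrite (jh_law jh N k (t := fun=> 0))//=.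
  by rewrite [X in _ * X]big1 ?mulr1// => i _; rewrite mulr0 expR0.
apply/seteqP; split => w /= h i iN; last by have [] := h i iN.
by split; [exact: h|exact: (jh_gt0 jh)].
Qed.

Let prefix N w : {ffun 'I_N.+1 -> 'I_n} := [ffun i : 'I_N.+1 => Y i w].

Let prefixE N w t : (prefix N w = t) <-> forall i : 'I_N.+1, Y i w = t i.
Proof.
split=> [<- i|h]; first by rewrite ffunE.
by apply/ffunP => i; rewrite ffunE.
Qed.

Let m_prefix N t : mp (fun w => prefix N w = t).
Proof.
rewrite (_ : [set _ | _] = \bigcap_(i in [set: 'I_N.+1]) [set w | Y i w = t i]).
  by apply: fin_bigcap_measurable => [|i _]; [exact: finite_finset|exact: mY].
apply/seteqP; split => w /=; first by move=> /prefixE h i _; exact: h.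
by move=> h; apply/prefixE => i; exact: h.
Qed.

(** The law is only prescribed on full prefixes, so an event of the past is split over the finitely
    many prefixes. *)
Let markov_step N (D : {ffun 'I_N.+1 -> 'I_n} -> Prop) i l :
  pr P [set w | D (prefix N w) /\ Y N w = i /\ Y N.+1 w = l] =
  pr P [set w | D (prefix N w) /\ Y N w = i] * jp i l.
Proof.
have mD : mp (fun w => D (prefix N w)) by exact: (mp_fin D (@m_prefix N)).
have m1 : mp (fun w => D (prefix N w) /\ Y N w = i) by exact: mp_and.
have m2 : mp (fun w => D (prefix N w) /\ Y N w = i /\ Y N.+1 w = l).
  by apply: mp_and => //; exact: mp_and.
rewrite (pr_partition P m2 (@m_prefix N)) (pr_partition P m1 (@m_prefix N)).
rewrite mulr_suml; apply: eq_bigr => t _.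
have [[Dt ti]|nt] := pselect (D t /\ t ord_max = i); last first.
  rewrite [X in pr P X = _](_ : _ = set0); last first.
    apply/seteqP; split => w //= -[[Dw [Yi _]] pw]; apply: nt.
    by rewrite -pw ffunE.
  rewrite [X in _ = pr P X * _](_ : _ = set0) ?pr0 ?mul0r//.
  apply/seteqP; split => w //= -[[Dw Yi] pw]; apply: nt.
  by rewrite -pw ffunE.
pose k m := if (m <= N)%N then t (inord m) else l.
have kt (m : 'I_N.+1) : k m = t m by rewrite /k -ltnS ltn_ord inord_val.
have kN : k N = i by rewrite (kt ord_max).
rewrite (_ : _ `&` _ = [set w | forall m, (m <= N.+1)%N -> Y m w = k m]); last first.
  apply/seteqP; split => w /=.
    move=> [[_ [_ Yl]] /prefixE pw] m; rewrite leq_eqVlt => /predU1P[->|mN].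
      by rewrite Yl /k ltnn.
    by have := pw (Ordinal mN); rewrite -kt.
  move=> h; have pw : prefix N w = t.
    by apply/prefixE => m; rewrite h ?kt// ltnW// ltn_ord.
  by rewrite pw; split => //; split => //; rewrite !h// kN /k ltnn.
rewrite [in RHS](_ : _ `&` _ = [set w | forall m, (m <= N)%N -> Y m w = k m]); last first.
  apply/seteqP; split => w /=.
    move=> [_ /prefixE pw] m mN.
    by have := pw (Ordinal (mN : (m < N.+1)%N)); rewrite -kt.
  move=> h; have pw : prefix N w = t.
    by apply/prefixE => m; rewrite h ?kt// -ltnS ltn_ord.
  by rewrite pw; split => //; split => //; rewrite !h// kN.
rewrite !pr_path big_nat_recr//= mulrA; congr (_ * jp _ _); first exact: kN.
by rewrite /k ltnn.
Qed.

Variable B : {set 'I_n}.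

(** For l in B a first return at step N; for l outside B the event of being at l without having
    returned yet. One recursion then serves both. *)
Definition first_passage N l : set Omega :=
  [set w | Y 0%N w = j /\ (forall i, (0 < i < N)%N -> Y i w \notin B) /\ Y N w = l].

Lemma first_passage_measurable N l : measurable (first_passage N l).
Proof.
apply: mp_and; first exact: mY.
apply: mp_and; last exact: mY.
by apply: mp_all => i; apply: mp_imp; exact: (mYD i (fun s => s \notin B)).
Qed.

Let a N l := pr P (first_passage N l).

Let a_ge0 N l : 0 <= a N l. Proof. exact: pr_ge0. Qed.

Let a1 l : a 1%N l = jp j l.
Proof.
pose k m := if m == 0%N then j else l.
have := pr_path 1 k; rewrite big_nat1 /k/= eqxx mul1r => <-; congr pr.
apply/seteqP; split => w /=.
  by move=> [Y0 [_ Y1]] [|[|]].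
move=> h; split; first exact: (h 0%N).
by split; [case=> [|[|]]|exact: (h 1%N)].
Qed.

Let aS N l : (0 < N)%N -> a N.+1 l = \sum_(i | i \notin B) a N i * jp i l.
Proof.
move=> N0; rewrite /a (pr_partition P (first_passage_measurable N.+1 l) (mY N)).
rewrite (bigID (mem B))/= big1 ?add0r; last first.
  move=> i iB; rewrite (_ : _ `&` _ = set0) ?pr0//; apply/seteqP; split => w //=.
  by move=> [[_ [h _]] Yi]; have := h N; rewrite N0 ltnSn Yi iB => /(_ isT).
apply: eq_bigr => i iB.
pose D (t : {ffun 'I_N.+1 -> 'I_n}) := t ord0 = j /\
  forall m : 'I_N.+1, (0 < m < N)%N -> t m \notin B.
have DE w : D (prefix N w) <-> Y 0%N w = j /\ (forall i, (0 < i < N)%N -> Y i w \notin B).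
  rewrite /D ffunE; split=> -[Y0 h]; split=> // m mN; last first.
    by rewrite ffunE; exact: h.
  have mN' : (m < N.+1)%N by case/andP: mN => _ /ltnW.
  by have := h (Ordinal mN') mN; rewrite ffunE.
have -> : first_passage N.+1 l `&` [set w | Y N w = i] =
    [set w | D (prefix N w) /\ Y N w = i /\ Y N.+1 w = l].
  apply/seteqP; split => w /=.
    move=> [[Y0 [h Yl]] Yi]; split=> //; apply/DE; split=> // m /andP[m0 mN].
    by apply: h; rewrite m0 (ltn_trans mN).
  move=> [/DE[Y0 h] [Yi Yl]]; split=> //; split=> //; split=> // m /andP[m0].
  rewrite ltnS leq_eqVlt => /predU1P[->|mN]; first by rewrite Yi.
  by apply: h; rewrite m0.
rewrite markov_step; congr (pr P _ * _).
by apply/seteqP; split => w /=; [move=> [/DE[Y0 h] Yi]|move=> [Y0 [h Yi]]; split=> //; apply/DE].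
Qed.

Let S i w : R := \sum_(0 <= l < i) tau l w.

Let S0 w : S 0 w = 0. Proof. by rewrite /S big_geq. Qed.

Let S_lt i i' w : (i < i')%N -> S i w < S i' w.
Proof.
elim: i' => // i' IH; rewrite ltnS leq_eqVlt /S big_nat_recr//= => /predU1P[->|/IH h].
  by rewrite ltrDl (jh_gt0 jh).
by apply: (lt_trans h); rewrite ltrDl (jh_gt0 jh).
Qed.

Let S_le i i' w : (i <= i')%N -> S i w <= S i' w.
Proof. by rewrite leq_eqVlt => /predU1P[->//|/(S_lt w)/ltW]. Qed.

Let S_inj w : injective (S ^~ w).
Proof.
move=> i i' e; case: (ltngtP i i') => // /(S_lt w); by rewrite e ltxx.
Qed.

Let S_cover w t : 0 <= t -> exists i, S i w <= t < S i.+1 w.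
Proof.
move=> t0; have [N tN] : exists N, t < S N w.
  have /cvgryPgt/(_ t) := jh_nonexpl jh w.
  by move=> /filter_ex[N tN]; exists N.
have ex : exists N, t < S N w by exists N.
case: (ex_minnP ex) => -[|i]; first by rewrite S0 ltNge t0.
move=> ti mini; exists i; rewrite ti andbT leNgt; apply/negP => /mini.
by rewrite ltnn.
Qed.

Let X_Y w i t : S i w <= t < S i.+1 w -> X t w = Y i w.
Proof. exact: (jh_path jh). Qed.

Let X0 w : X 0 w = Y 0%N w.
Proof. by apply: X_Y; rewrite S0 lexx/= -(S0 w) S_lt. Qed.

Let first_index (Q : pred 'I_n) i0 w N := [/\ (i0 <= N)%N, Q (Y N w) &
  forall i, (i0 <= i < N)%N -> ~~ Q (Y i w)].

Let first_indexP (Q : pred 'I_n) i0 w : (exists N, first_index Q i0 w N) \/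
  forall i, (i0 <= i)%N -> ~~ Q (Y i w).
Proof.
have [ex|nex] := pselect (exists N, (i0 <= N)%N && Q (Y N w)); last first.
  by right => i ii; apply/negP => Qi; apply: nex; exists i; rewrite ii.
left; case: (ex_minnP ex) => N /andP[iN QN] minN; exists N; split=> // i /andP[ii iN'].
by apply/negP => Qi; have := minN i; rewrite ii Qi leqNgt iN' => /(_ isT).
Qed.

Let first_index_uniq (Q : pred 'I_n) i0 w N N' : first_index Q i0 w N -> first_index Q i0 w N' -> N = N'.
Proof.
move=> [iN QN hN] [iN' QN' hN']; case: (ltngtP N N') => // lt.
  by have := hN' N; rewrite iN lt QN => /(_ isT).
by have := hN N'; rewrite iN' lt QN' => /(_ isT).
Qed.

(** Hitting time, first jump and return time all take this form, with different Q and starting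
    index; [time_infE] reads them off the jump chain. *)
Let time_inf (Q : pred 'I_n) i0 w : \bar R :=
  ereal_inf [set t%:E | t in [set t | S i0 w <= t /\ Q (X t w)]].

Let S_ge0 i w : 0 <= S i w. Proof. by rewrite -(S0 w) S_le. Qed.

Let time_infE (Q : pred 'I_n) i0 w N : first_index Q i0 w N ->
  time_inf Q i0 w = (S N w)%:E.
Proof.
move=> [iN QN hN]; apply/eqP; rewrite eq_le; apply/andP; split.
  apply: ereal_inf_lbound; exists (S N w) => //; split; first exact: S_le.
  by rewrite (@X_Y w N) ?lexx ?S_lt.
apply: le_ereal_inf_tmp => _ [t [St Qt] <-]; rewrite lee_fin leNgt; apply/negP => tN.
have [i /andP[it ti]] := S_cover w (le_trans (S_ge0 i0 w) St).
have ii : (i0 <= i)%N.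
  by rewrite leqNgt; apply/negP => /(S_le w) h; have := lt_le_trans ti (le_trans h St); rewrite ltxx.
have iN' : (i < N)%N.
  by rewrite ltnNge; apply/negP => /(S_le w) h; have := lt_le_trans tN (le_trans h it); rewrite ltxx.
by have := hN i; rewrite ii iN' -(@X_Y w i t) ?it// Qt => /(_ isT).
Qed.

Let time_inf_oo (Q : pred 'I_n) i0 w : (forall i, (i0 <= i)%N -> ~~ Q (Y i w)) ->
  time_inf Q i0 w = +oo%E.
Proof.
move=> h; rewrite /time_inf (_ : [set _ | _ in _] = set0) ?ereal_inf0//.
apply/seteqP; split => // x [t [St Qt] _] /=.
have [i /andP[it ti]] := S_cover w (le_trans (S_ge0 i0 w) St).
have ii : (i0 <= i)%N.
  by rewrite leqNgt; apply/negP => /(S_le w) h'; have := lt_le_trans ti (le_trans h' St); rewrite ltxx.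
by have := h i ii; rewrite -(@X_Y w i t) ?it// Qt.
Qed.

Let hitE (A : {set 'I_n}) w : hitting_time X A w = time_inf (mem A) 0 w.
Proof. by rewrite /time_inf S0. Qed.

Let first_jumpE w : first_jump X w = time_inf (fun s => s != Y 0%N w) 0 w.
Proof. by rewrite /time_inf S0 /first_jump X0. Qed.

(** The first change of state of the path is the first index s at which Y leaves Y 0; s is not 1
    when Y 1 = Y 0, an event of probability 0 because r j j = 0. *)
Let ret w N := exists s, first_index (fun x => x != Y 0%N w) 0 w s /\
  first_index (mem B) s w N.

Let retP w : (exists N, ret w N /\ return_time X B w = (S N w)%:E) \/
  ((forall N, ~ ret w N) /\ return_time X B w = +oo%E).
Proof.
rewrite /return_time.
have [[s hs]|h] := first_indexP (fun x => x != Y 0%N w) 0 w; last first.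
  right; split=> [N [s [[_ Ys _] _]]|]; first by have := h s (leq0n _); rewrite Ys.
  rewrite first_jumpE time_inf_oo// (_ : [set _ | _ in _] = set0) ?ereal_inf0//.
  by apply/seteqP; split => // x [t [+ _] _]; rewrite leye_eq.
have -> : [set t%:E | t in [set t | (first_jump X w <= t%:E)%E /\ X t w \in B]] =
    [set t%:E | t in [set t | S s w <= t /\ X t w \in B]].
  by rewrite first_jumpE (time_infE hs); under eq_set do rewrite lee_fin.
rewrite -/(time_inf (mem B) s w).
have [[N hN]|h] := first_indexP (mem B) s w.
  by left; exists N; split; [exists s|rewrite (time_infE hN)].
right; split; last by rewrite time_inf_oo.
move=> N [s' [hs' [sN' YN _]]]; rewrite (first_index_uniq hs' hs) in sN'.
by have := h N sN'; rewrite YN.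
Qed.

Variable k : 'I_n.

Let hit w N := first_index (mem [set k]%SET) 0 w N.

Let hitP w : (exists N, hit w N /\ hitting_time X [set k]%SET w = (S N w)%:E) \/
  ((forall N, ~ hit w N) /\ hitting_time X [set k]%SET w = +oo%E).
Proof.
rewrite hitE; have [[N hN]|h] := first_indexP (mem [set k]%SET) 0 w.
  by left; exists N; split=> //; exact: time_infE.
right; split; last exact: time_inf_oo.
by move=> N [_ YN _]; have := h N (leq0n _); rewrite YN.
Qed.

Let event w := hitting_time X [set k]%SET w = return_time X B w.

Let ret_uniq w N N' : ret w N -> ret w N' -> N = N'.
Proof.
move=> [s [hs hN]] [s' [hs' hN']].
by rewrite (first_index_uniq hs' hs) in hN'; exact: first_index_uniq hN hN'.
Qed.

(** Distinct indices have distinct jump times, so finite times agree only at a common index. The two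
    times also agree when both are +oo; [event_sub] places this case among the paths that stay
    outside B. *)
Let eventP w : event w <-> (exists N, hit w N /\ ret w N) \/
  ((forall N, ~ hit w N) /\ (forall N, ~ ret w N)).
Proof.
rewrite /event; have [[N [hN ->]]|[nh ->]] := hitP w;
  have [[N' [rN ->]]|[nr ->]] := retP w; split=> //.
- by move=> [/S_inj NN']; left; exists N; split=> //; rewrite NN'.
- move=> [[M [hM rM]]|[/(_ N)//]].
  by rewrite (first_index_uniq hN hM) (ret_uniq rN rM).
- by move=> [[M [_ /nr]]//|[/(_ N)]].
- by move=> [[M [/nh]]//|[_ /(_ N')]].
- by move=> _; right.
Qed.

Let m_first_index (Q : 'I_n -> pred 'I_n) i0 N :
  mp (fun w => first_index (Q (Y 0%N w)) i0 w N).
Proof.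
have mQ i : mp (fun w => Q (Y 0%N w) (Y i w)).
  have m2 (t : 'I_n * 'I_n) : mp (fun w => (Y 0%N w, Y i w) = t).
    rewrite (_ : [set _ | _] = [set w | Y 0%N w = t.1 /\ Y i w = t.2]).
      by apply: mp_and; exact: mY.
    by apply/seteqP; split => w /=; [move=> <-|case: t => b1 b2 /= [-> ->]].
  exact: (@mp_fin _ _ _ (fun w => (Y 0%N w, Y i w)) (fun t => Q t.1 t.2) m2).
rewrite (_ : [set _ | _] = [set w | (i0 <= N)%N /\ (Q (Y 0%N w) (Y N w) /\
    forall i, (i0 <= i < N)%N -> ~ Q (Y 0%N w) (Y i w))]).
  apply: mp_and; first exact: mp_cst.
  by apply: mp_and => //; apply: mp_all => i; apply: mp_imp; exact: mp_not.
apply/seteqP; split => w /=.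
  by move=> [h1 h2 h3]; split=> //; split=> // i /h3/negP.
by move=> [h1 [h2 h3]]; split=> // i /h3/negP.
Qed.

Lemma trace_event_measurable :
  mp (fun w => hitting_time X [set k]%SET w = return_time X B w).
Proof.
have mh N : mp (fun w => hit w N).
  exact: (m_first_index (fun _ => mem [set k]%SET)).
have mr N : mp (fun w => ret w N).
  apply: mp_ex => s; apply: mp_and.
    exact: (m_first_index (fun x0 x => x != x0)).
  exact: (m_first_index (fun _ => mem B)).
rewrite (_ : [set _ | _] = [set w | (exists N, hit w N /\ ret w N) \/
  ((forall N, ~ hit w N) /\ (forall N, ~ ret w N))]).
  apply: mp_or; first by apply: mp_ex => N; exact: mp_and.
  by apply: mp_and; apply: mp_all => N; exact: mp_not.
by apply/seteqP; split => w /=; [move/eventP|move=> h; apply/eventP].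
Qed.

Hypotheses (kB : k \in B) (jk : j != k).
Variables u h : 'I_n -> R.
Hypothesis u_in : forall l, l \in B -> u l = (l == k)%:R.
Hypothesis u_out : forall l, l \notin B ->
  u l = \sum_i r l i / total_rate r l * u i.
Hypothesis u_ge0 : forall l, 0 <= u l.
Hypothesis u_le1 : forall l, u l <= 1.
Hypothesis h_ge0 : forall l, 0 <= h l.
Hypothesis h_out : forall l, l \notin B ->
  h l = 1 + \sum_(i | i \notin B) r l i / total_rate r l * h i.

(** The almost sure event on which the first change of state happens at index 1. *)
Let good w := Y 0%N w = j /\ Y 1%N w <> j.
Let back N w := exists M, (0 < M <= N)%N /\ first_passage M k w.
Let stay N w := Y 0%N w = j /\ forall i, (0 < i <= N)%N -> Y i w \notin B.

Let m_good : mp good.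
Proof. by apply: mp_and; [exact: mY|exact: mp_not]. Qed.

Let m_back N : mp (back N).
Proof.
apply: mp_ex => M; apply: mp_and; first exact: mp_cst.
exact: first_passage_measurable.
Qed.

Let m_stay N : mp (stay N).
Proof.
apply: mp_and; first exact: mY.
by apply: mp_all => i; apply: mp_imp; exact: (mYD i (fun s => s \notin B)).
Qed.

Let pr_good : pr P [set w | good w] = 1.
Proof.
have m0 : mp (fun w => Y 0%N w = j) by exact: mY.
have e0 : pr P [set w | Y 0%N w = j] = 1.
  have := pr_path 0 (fun=> j); rewrite eqxx big_geq// mulr1; apply: etrans; congr pr.
  by apply/seteqP; split => w /=; [move=> Y0 [|]|move=> h'; exact: (h' 0%N)].
have e1 : pr P (first_passage 1 j) = 0 by rewrite -/(a 1 j) a1 /jp r_diag mul0r.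
rewrite -e0 (_ : [set w | Y 0%N w = j] = [set w | good w] `|` first_passage 1 j).
  rewrite prU ?e1 ?addr0//; first exact: first_passage_measurable.
  by move=> w [_ Y1] [_ [_]].
apply/seteqP; split => w /=; last by move=> [[]|[]].
move=> Y0; have [Y1|/eqP Y1] := eqVneq (Y 1%N w) j; last by left.
by right; split=> //; split=> // -[|[|]].
Qed.

Let back_sub N : [set w | back N w] `&` [set w | good w] `<=` [set w | event w].
Proof.
move=> w [[M [/andP[M0 MN] [Y0 [out YM]]]] [_ Y1]]; apply/eventP; left.
exists M; split.
  have memk l : mem [set k]%SET l = (l == k).
    by rewrite -[LHS]/(l \in [set k]%SET) inE.
  split; rewrite ?YM ?memk// => -[_|i /= iM]; first by rewrite memk Y0.
  by rewrite inE; apply: contraNneq (out i.+1 iM) => ->.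
exists 1%N; split.
  by split=> //= [|[|]//]; rewrite Y0 ?eqxx//; exact/eqP.
by split=> //=; rewrite YM.
Qed.

Let event_sub N : [set w | event w] `&` [set w | good w] `<=`
  [set w | back N w] `|` [set w | stay N w].
Proof.
move=> w [/eventP ev [Y0 Y1]].
have r1 : first_index (fun x => x != Y 0%N w) 0 w 1.
  by split=> //= [|[|]//]; rewrite Y0 ?eqxx//; exact/eqP.
have [[M [M1 YM outM]]|out] := first_indexP (mem B) 1 w; last first.
  by right; split=> // i /andP[i0 _]; exact: out.
have [MN|NM] := leqP M N; last first.
  by right; split=> // i /andP[i0 iN]; apply: outM; rewrite i0 (leq_ltn_trans iN).
have rM : ret w M by exists 1%N.
case: ev => [[N' [hN' rN']]|[_ /(_ M)]//]; left; exists M; rewrite M1 MN.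
split=> //; split=> //; split=> //.
by rewrite (ret_uniq rM rN'); have [_ YN _] := hN'; apply/finset.set1P.
Qed.

Let g N := \sum_(l | l \notin B) a N l.

Let pr_stay N : (0 < N)%N -> pr P [set w | stay N w] = g N.
Proof.
move=> N0; rewrite (pr_partition P (m_stay N) (mY N)) (bigID (mem B))/=.
rewrite big1 ?add0r => [|l lB]; last first.
  rewrite (_ : _ `&` _ = set0) ?pr0//; apply/seteqP; split => w //=.
  by move=> [[_ out] Yl]; have := out N; rewrite N0 leqnn Yl lB => /(_ isT).
apply: eq_bigr => l lB; congr pr; apply/seteqP; split => w /=.
  move=> [[Y0 out] Yl]; split=> //; split=> // i /andP[i0 iN].
  by apply: out; rewrite i0 ltnW.
move=> [Y0 [out Yl]]; split=> //; split=> // i /andP[i0].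
rewrite leq_eqVlt => /predU1P[->|iN]; first by rewrite Yl.
by apply: out; rewrite i0.
Qed.

Let pr_back N : pr P [set w | back N w] = \sum_(1 <= M < N.+1) a M k.
Proof.
elim: N => [|N IH].
  rewrite big_geq// (_ : [set _ | _] = set0) ?pr0//; apply/seteqP; split => w //=.
  by move=> [[|M] [/andP[]]].
rewrite big_nat_recr//= -IH -prU//; last first.
- move=> w [M [/andP[M0 MN] [_ [_ YM]]]] [_ [out _]].
  by have := out M; rewrite M0 ltnS MN YM kB => /(_ isT).
- exact: first_passage_measurable.
congr pr; apply/seteqP; split => w /=.
  move=> [M [/andP[M0]]]; rewrite leq_eqVlt => /predU1P[->|MN]; first by right.
  by move=> fM; left; exists M; rewrite M0.
move=> [[M [/andP[M0 MN] fM]]|fN]; last by exists N.+1; rewrite ltnSn.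
by exists M; rewrite M0 leqW.
Qed.

Let split_u (c : 'I_n -> R) :
  \sum_l c l * u l = c k + \sum_(l | l \notin B) c l * u l.
Proof.
rewrite (bigID (mem B))/=; congr (_ + _).
rewrite (bigD1 k)//= u_in// eqxx mulr1 big1 ?addr0// => l /andP[lB lk].
by rewrite u_in// (negPf lk) mulr0.
Qed.

Let hit_expansion N : \sum_l jp j l * u l =
  \sum_(1 <= M < N.+2) a M k + \sum_(l | l \notin B) a N.+1 l * u l.
Proof.
elim: N => [|N IH].
  by rewrite big_nat1 -split_u; apply: eq_bigr => l _; rewrite a1.
rewrite IH [in RHS]big_nat_recr//= -addrA -(split_u (a N.+2)); congr (_ + _).
under eq_bigr => l lB do rewrite u_out// mulr_sumr.
rewrite exchange_big/=; apply: eq_bigr => i _.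
by rewrite aS// mulr_suml; apply: eq_bigr => l _; rewrite mulrA.
Qed.

(** Unrolling the equation of h, the expected number of steps before B is entered, bounds the
    partial sums of the probabilities of still being outside B. *)
Let stay_summable N :
  \sum_(1 <= M < N.+1) g M <= \sum_(l | l \notin B) a 1 l * h l.
Proof.
have -> : \sum_(l | l \notin B) a 1 l * h l =
    \sum_(1 <= M < N.+1) g M + \sum_(l | l \notin B) a N.+1 l * h l.
  elim: N => [|N IH]; first by rewrite big_geq// add0r.
  rewrite IH [in RHS]big_nat_recr//= -addrA; congr (_ + _).
  under eq_bigr => l lB do rewrite h_out// mulrDr mulr1 mulr_sumr.
  rewrite big_split/=; congr (_ + _); rewrite exchange_big/=.
  apply: eq_bigr => i iB; rewrite aS// mulr_suml.
  by apply: eq_bigr => l _; rewrite mulrA.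
by rewrite lerDl sumr_ge0// => l _; rewrite mulr_ge0.
Qed.

(** Here u is the probability of entering B at k. Iterating its one-step equation gives the
    probability of a return at k within N + 1 steps plus a remainder, and the event itself is known
    up to the same error: the probability g of still being outside B. *)
Lemma trace_event_prob :
  pr P [set w | hitting_time X [set k]%SET w = return_time X B w] =
  \sum_l r j l / total_rate r j * u l.
Proof.
set x := \sum_l _; rewrite -[X in pr P X]/[set w | event w].
have mE : mp event by exact: trace_event_measurable.
have le N : `|pr P [set w | event w] - x| <= g N.+1.
  have lo : pr P [set w | back N.+1 w] <= pr P [set w | event w].
    rewrite -(pr_full (m_back N.+1) m_good pr_good).
    by apply: pr_le; [exact: measurableI|exact: mE|exact: back_sub].
  have hi : pr P [set w | event w] <= pr P [set w | back N.+1 w] + g N.+1.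
    rewrite -(pr_full mE m_good pr_good) -pr_stay//.
    apply: le_trans (_ : pr P ([set w | back N.+1 w] `|` [set w | stay N.+1 w]) <= _).
      apply: pr_le; [exact: measurableI|exact: measurableU|exact: event_sub].
    exact: prU_le.
  have := hit_expansion N; rewrite -/x -pr_back => xE.
  have r0 : 0 <= \sum_(l | l \notin B) a N.+1 l * u l.
    by apply: sumr_ge0 => l _; rewrite mulr_ge0.
  have r1 : \sum_(l | l \notin B) a N.+1 l * u l <= g N.+1.
    by apply: ler_sum => l _; rewrite -[leRHS]mulr1 ler_wpM2l.
  by rewrite ler_norml; apply/andP; split; lra.
(* A positive discrepancy would bound every g (N + 1) from below, and the partial sums of g would
   outgrow C. *)
apply/eqP; rewrite -subr_eq0 -normr_eq0; set dl := `|_| in le *.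
have [//|d0] := eqVneq dl 0; have dp : 0 < dl by rewrite lt_def d0 normr_ge0.
pose C := \sum_(l | l \notin B) a 1 l * h l.
have [M CM] : exists M : nat, C / dl < M%:R.
  exists (Num.truncn (C / dl)).+1; exact: truncnS_gt.
have := stay_summable M; rewrite -/C.
suff : M%:R * dl <= \sum_(1 <= M0 < M.+1) g M0.
  by move: CM; rewrite ltr_pdivrMr// => h1 h2 h3; have := le_trans h2 h3; lra.
rewrite big_add1/= big_mkord mulr_natl -[X in _ *+ X]card_ord -sumr_const.
by apply: ler_sum => i _; exact: le.
Qed.

End jump_chain.

(** * The entrance law into B and the trace rates *)

Section trace_matrix.
Context {R : realType} {n : nat} {d : measure_display}
  {Omega : measurableType d}.
Variables (r : 'I_n -> 'I_n -> R) (PC : 'I_n -> probability Omega R).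
Variable X : R -> Omega -> 'I_n.
Hypothesis r_ge0 : forall j k, 0 <= r j k.
Hypothesis r_irr : irreducible_rates r.
Hypothesis rate_gt0 : forall j, 0 < total_rate r j.
Hypothesis r_diag : forall j, r j j = 0.
Hypothesis X_chain : forall j, markov_chain r j (PC j) X.
Variable B : {set 'I_n}.
Hypothesis B_neq0 : (0 < #|B|)%N.

Let A := (~: B)%SET.

Let AT : A != finset.setT.
Proof.
apply/eqP => /setP AT; have i : 'I_#|B| by exact: Ordinal B_neq0.
by have := AT (enum_val i); rewrite !inE enum_valP.
Qed.

Let K := Kmx r A.
Let K_unit : K \in unitmx. Proof. exact: Kmx_unit. Qed.

(* U k i is the probability that the chain started at k enters B at i. *)
Let U : 'M[R]_(n, #|B|) :=
  invmx K *m \matrix_(k, i) (k == enum_val i)%:R.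

Let KU i k : (K *m col i U) k 0 = (k == enum_val i)%:R.
Proof. by rewrite colE mulmxA mulKVmx// -colE !mxE. Qed.

Let U_out k i : k \notin B -> \sum_l r k l * (U k i - U l i) = 0.
Proof.
move=> kB; have := KU i k; rewrite KmxE inE kB.
have -> : (k == enum_val i) = false.
  by apply: contraNF kB => /eqP ->; exact: enum_valP.
move=> e; rewrite -[RHS]e; apply: eq_bigr => l _.
by rewrite [in RHS]mxE [X in _ = _ * (_ - X)]mxE.
Qed.

Let U_in k i : k \in B -> U k i = (k == enum_val i)%:R.
Proof. by move=> kB; have := KU i k; rewrite KmxE inE kB/= mxE. Qed.

Let U_ge0 k i : 0 <= U k i.
Proof.
have := @Kmx_ge0 _ _ r r_ge0 r_irr A (col i U) AT _ k; rewrite mxE; apply=> l.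
by rewrite KU.
Qed.

Let U_sum k : \sum_i U k i = 1.
Proof.
(* The row sums and the constant 1 have the same boundary values and are both harmonic outside B, so
   f solves the homogeneous Dirichlet problem. *)
pose f : 'cV[R]_n := \col_j (\sum_i U j i - 1).
have Kf l : (K *m f) l 0 = 0.
  rewrite KmxE inE; case: ifPn => lB.
    transitivity (\sum_i \sum_j r l j * (U l i - U j i)).
      rewrite exchange_big/=; apply: eq_bigr => j _.
      by rewrite !mxE -mulr_sumr sumrB; congr (_ * _); ring.
    by rewrite big1// => i _; exact: U_out.
  rewrite negbK in lB; rewrite mxE; apply/eqP; rewrite subr_eq0; apply/eqP.
  rewrite (bigD1 (enum_rank_in lB l))//= U_in// enum_rankK_in// eqxx big1 ?addr0//.
  move=> i il; rewrite U_in//; case: eqP => // e; case/eqP: il.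
  by apply: enum_val_inj; rewrite enum_rankK_in.
have f0 := Kmx_ge0 r_ge0 r_irr AT (f := f); have f1 := Kmx_ge0 r_ge0 r_irr AT (f := - f).
have a0 : 0 <= f k 0 by apply: f0 => l; rewrite Kf.
have a1 : 0 <= - f k 0.
  have : 0 <= (- f) k 0 by apply: f1 => l; rewrite mulmxN mxE Kf oppr0.
  by rewrite mxE.
by move: a0 a1; rewrite mxE; lra.
Qed.

(** The right-hand side is the total rate instead of 1, which counts the expected number of jumps
    before B, not the expected time. *)
Let htime : 'cV[R]_n := invmx K *m \col_k if k \in A then total_rate r k else 0.

Let Kh k : (K *m htime) k 0 = if k \in A then total_rate r k else 0.
Proof. by rewrite mulKVmx// mxE. Qed.

Let h_ge0 k : 0 <= htime k 0.
Proof.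
apply: (Kmx_ge0 r_ge0 r_irr AT) => l; rewrite Kh.
by case: ifP => // _; exact/ltW/rate_gt0.
Qed.

Let h_in k : k \in B -> htime k 0 = 0.
Proof. by move=> kB; have := Kh k; rewrite KmxE inE kB. Qed.

Let h_out k : k \notin B ->
  htime k 0 = 1 + \sum_(i | i \notin B) r k i / total_rate r k * htime i 0.
Proof.
move=> kB; have := Kh k; rewrite KmxE inE kB/=.
under eq_bigr do rewrite mulrBr.
rewrite sumrB -mulr_suml -/(total_rate r k) => e.
have l0 := rate_gt0 k; apply: (mulfI (lt0r_neq0 l0)).
rewrite mulrDr mulr1 mulr_sumr -[LHS](subrK (\sum_i r k i * htime i 0)) e.
rewrite (bigID (mem B))/= [X in _ + (X + _) = _]big1 ?add0r; last first.
  by move=> i iB; rewrite h_in// mulr0.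
by congr (_ + _); apply: eq_bigr => i _; field; exact: lt0r_neq0.
Qed.

Let trace_rateE i i' : i != i' ->
  trace_rate r PC X i i' = \sum_l r (enum_val i) l * U l i'.
Proof.
move=> ii'; rewrite /trace_rate; case: eqP => [/enum_val_inj e|/eqP jk].
  by rewrite e eqxx in ii'.
have [Y [tau jh]] := X_chain (enum_val i).
have := trace_event_prob jh r_diag (enum_valP i') jk
  (u := fun l => U l i') (h := fun l => htime l 0).
rewrite /pr => ->.
- rewrite mulr_sumr; apply: eq_bigr => l _.
  by field; exact: lt0r_neq0.
- by move=> l lB; rewrite U_in.
- move=> l lB; have l0 := rate_gt0 l; apply: (mulfI (lt0r_neq0 l0)).
  have := U_out i' lB; under eq_bigr do rewrite mulrBr.
  rewrite sumrB -mulr_suml -/(total_rate r l) => /eqP.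
  rewrite subr_eq0 => /eqP ->; rewrite mulr_sumr; apply: eq_bigr => m _.
  by field; exact: lt0r_neq0.
- by move=> l; exact: U_ge0.
- move=> l; rewrite -(U_sum l) (bigD1 i')//= lerDl.
  by apply: sumr_ge0 => m _; exact: U_ge0.
- exact: h_ge0.
- exact: h_out.
Qed.

Let mulU k i : (jump_vector r k *m U) 0 i = \sum_l r k l * (U l i - U k i).
Proof.
rewrite mxE; under eq_bigr do rewrite jump_vectorE mulrBl -mulrA.
rewrite sumrB sum_indicator; under [RHS]eq_bigr do rewrite mulrBr.
by rewrite sumrB -mulr_suml.
Qed.

Lemma exists_trace_matrix : exists U : 'M[R]_(n, #|B|),
  [/\ forall k i, 0 <= U k i, forall k, \sum_i U k i = 1,
    forall i i', U (enum_val i) i' = (i == i')%:R,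
    forall i, jump_vector r (enum_val i) *m U =
      jump_vector (trace_rate r PC X (B := B)) i &
    forall j, j \notin B -> jump_vector r j *m U = 0].
Proof.
have Uin i i' : U (enum_val i) i' = (i == i')%:R.
  by rewrite U_in ?enum_valP// (inj_eq enum_val_inj).
exists U; split=> //; last first.
  move=> j jB; apply/rowP => i; rewrite mulU [RHS]mxE.
  apply: oppr_inj; rewrite oppr0 -sumrN -[RHS](U_out i jB).
  by apply: eq_bigr => l _; rewrite -mulrN opprB.
move=> i; have rii : trace_rate r PC X i i = 0 by rewrite /trace_rate eqxx.
apply/rowP => i'; rewrite jump_vectorE mulU.
have E : \sum_l r (enum_val i) l * (U l i' - U (enum_val i) i') =
    \sum_l r (enum_val i) l * U l i' - (i == i')%:R * total_rate r (enum_val i).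
  under eq_bigr do rewrite mulrBr Uin.
  by rewrite sumrB -mulr_suml mulrC.
rewrite E; have [->|ii'] := eqVneq i i'; last first.
  by rewrite !mul0r !subr0 trace_rateE.
(* Diagonal entry: excursions that come back to the starting state are no jumps of the trace, and
   account for the difference between the two total rates. *)
rewrite {1}/trace_rate eqxx !mul1r sub0r /total_rate (bigD1 i')//=.
rewrite [trace_rate _ _ _ _ _](_ : _ = 0) ?add0r; last by rewrite /trace_rate eqxx.
rewrite (eq_bigr (fun i0 => \sum_l r (enum_val i') l * U l i0)); last first.
  by move=> i0 i0i; rewrite trace_rateE// eq_sym.
rewrite exchange_big/= -sumrB -sumrN; apply: eq_bigr => l _.
rewrite -mulr_sumr -[X in _ - X]mulr1 -(U_sum l) [in LHS](bigD1 i')//=.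
by rewrite mulrDr opprD addrA subrr add0r.
Qed.

End trace_matrix.

(** * Passage to the limit in the martingale problem *)

Section extended_paths.
Context {R : realType} {n : nat}.
Variable B : {set 'I_n}.
Hypothesis B_gt0 : (0 < #|B|)%N.
Local Notation cpathB := (cpath R #|B|).
Local Notation cpathn := (cpath R n).

Lemma extend_path_subproof (u : cpathB) :
  exists w : cpathn, forall t, w t = extend_coord (u t).
Proof.
have c : continuous (fun t => extend_coord (u t)).
  move=> t; apply/cvg_ballP => e e0.
  have /cvg_ballP/(_ e e0) := @path_continuous _ _ u t.
  apply: filterS => s [_ su]; split=> // i k; rewrite (ord1 i).
  have [kB|kB] := boolP (k \in B); last first.
    by rewrite (extend_coord_out _ kB) (extend_coord_out _ kB); exact: ballxx.
  by rewrite -(enum_rankK_in kB kB) !extend_coord_in; exact: su.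
have s t : (0 < n)%N -> simplex (extend_coord (u t)).
  by move=> _; apply: extend_coord_simplex; exact: path_simplex.
have z t : t <= 0 -> extend_coord (u t) = extend_coord (u 0).
  by move=> t0; rewrite path_neg.
by exists (CPath c s z).
Qed.

Definition extend_path (u : cpathB) : cpathn := projT1 (cid (extend_path_subproof u)).

Lemma extend_pathE u t : extend_path u t = extend_coord (u t).
Proof. by rewrite /extend_path; case: cid. Qed.

Lemma face_image_preimage (A : set cpathn) :
  face_image (extend_path @^-1` A) = A `&` face_paths B.
Proof.
apply/seteqP; split=> [w [u Au wu]|w [Aw /(restr_path_subproof B_gt0)[u wu]]].
  have -> : w = extend_path u by apply: path_eqP => t; rewrite wu extend_pathE.
  by split=> // t j jB; rewrite extend_pathE extend_coord_out.
exists u => //; rewrite /preimage/= (_ : extend_path u = w)//.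
by apply: path_eqP => t; rewrite wu extend_pathE.
Qed.

Lemma sub_coord_sigma (I : set R) (p : nat) (G : set (set (cpath R p))) :
  sigma_algebra setT G ->
  (forall s j A, I s -> measurable A -> G [set w : cpath R p | A (w s 0 j)]) ->
  <<s coord_events I >> `<=` G.
Proof.
by move=> sG h; apply: smallest_sub => // _ [s [j [A [Is mA ->]]]]; exact: h.
Qed.

Lemma coord_sigma_event (I : set R) (p : nat) s (j : 'I_p) (A : set R) : I s ->
  measurable A -> <<s coord_events I >> [set w : cpath R p | A (w s 0 j)].
Proof. by move=> Is mA; apply: sub_sigma_algebra; exists s, j, A. Qed.

Lemma preimage_extend_path (I : set R) (A : set cpathn) :
  <<s coord_events I >> A -> <<s coord_events I >> (extend_path @^-1` A).
Proof.
move: A; apply: sub_coord_sigma => [|s j A Is mA].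
  have [h0 hC hU] := smallest_sigma_algebra setT (coord_events (n := #|B|) I).
  split=> [|A /hC //|F hF]; first by rewrite preimage_set0.
  by rewrite preimage_bigcup; exact: hU.
have [jB|jB] := boolP (j \in B).
  have e u : extend_path u s 0 j = u s 0 (enum_rank_in jB j).
    by rewrite extend_pathE -[in LHS](enum_rankK_in jB jB) extend_coord_in.
  rewrite (_ : _ @^-1` _ = [set u : cpathB | A (u s 0 (enum_rank_in jB j))]).
    exact: coord_sigma_event.
  by apply/funext => u; rewrite /preimage/= e.
have e u : extend_path u s 0 j = 0 by rewrite extend_pathE extend_coord_out.
have [h0 hC _] := smallest_sigma_algebra setT (coord_events (n := #|B|) I).
have [A0|A0] := pselect (A 0).
  rewrite (_ : _ @^-1` _ = setT `\` set0); first exact: hC.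
  by apply/seteqP; split => u; rewrite /preimage/= ?e// => _; split.
rewrite (_ : _ @^-1` _ = set0)//; apply/seteqP; split => u //.
by rewrite /preimage/= e.
Qed.

(** Each event of the face filtration comes from an ambient event of the same time, on which the
    martingale property under P can be tested. *)
Lemma extend_path_sigma (I : set R) (A : set cpathB) :
  <<s coord_events I >> A ->
  exists2 A', <<s coord_events I >> A' & A = extend_path @^-1` A'.
Proof.
have [h0 hC hU] := smallest_sigma_algebra setT (coord_events (n := n) I).
move: A; apply: sub_coord_sigma => [|s i A Is mA].
  split=> [|A [A' /hC hA ->]|F hF].
  - by exists set0.
  - by exists (setT `\` A').
  - have [F' hF'] := choice (fun k => let: ex_intro2 A' h e := hF k in
      ex_intro (fun A' => <<s coord_events I >> A' /\ F k = extend_path @^-1` A')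
        A' (conj h e)).
    exists (\bigcup_k F' k); first by apply: hU => k; exact: (hF' k).1.
    by rewrite preimage_bigcup; apply: eq_bigcupr => k _; exact: (hF' k).2.
exists [set w : cpathn | A (w s 0 (enum_val i))]; first exact: coord_sigma_event.
by apply/funext => u; rewrite /preimage/= extend_pathE extend_coord_in.
Qed.

Lemma measurable_extend_path : measurable_fun setT extend_path.
Proof. by move=> _ A mA; rewrite setTI; exact: preimage_extend_path. Qed.

Variable P : probability cpathn R.
Hypothesis P_face : P (face_paths B) = 1%E.

Lemma face_law_extend (A : set cpathn) : measurable A ->
  face_law P (extend_path @^-1` A) = P A.
Proof.
move=> mA; rewrite /face_law face_image_preimage.
have mF := measurable_face_paths (R := R) B.
rewrite -[LHS]/(P (A `&` face_paths B)) (prE P mA) (prE P (measurableI _ _ mA mF)).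
by rewrite pr_full// /pr P_face.
Qed.

Lemma face_lawT : face_law P [set: cpathB] = 1%E.
Proof.
by rewrite -(preimage_setT extend_path) face_law_extend// probability_setT.
Qed.

(** The image of [face_law P] under [extend_path] is P on measurable sets, since the face paths have
    full mass. *)
Lemma integral_face_law (A : set cpathn) (f : cpathn -> \bar R) : measurable A ->
  measurable_fun [set: cpathn] f -> (face_law P).-integrable setT (fun u : cpathB => f (extend_path u)) ->
  (\int[face_law P]_(u in extend_path @^-1` A) f (extend_path u) =
   \int[P]_(w in A) f w)%E.
Proof.
move=> mA mf fi.
rewrite -[LHS](@integral_pushforward _ _ _ _ _ extend_path)//.
- pose Q : {measure set cpathn -> \bar R} :=
    pushforward (face_law P) extend_path.
  rewrite -[LHS]/(integral (Q measurable_extend_path) A f).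
  by apply: eq_measure_integral => C mC _; exact: face_law_extend.
- exact: measurable_extend_path.
- by apply: (@integrableS _ _ _ _ setT) => //; exact: preimage_extend_path.
Qed.

End extended_paths.

Section bounded_convergence.
Context {R : realType} {d : measure_display} {T : measurableType d}.
Variables (mu : {measure set T -> \bar R}) (D : set T).
Hypotheses (mD : measurable D) (muD : (mu D < +oo)%E).

Lemma bounded_le_integrable (g : T -> R) M : measurable_fun D g ->
  (forall x, D x -> `|g x| <= M) -> mu.-integrable D (EFin \o g).
Proof.
move=> mg gM; apply: measurable_bounded_integrable => //.
by exists M; split=> [|x Mx y Dy /=]; [exact: num_real|exact/(le_trans (gM y Dy))/ltW].
Qed.

Variables (g_ : nat -> T -> R) (g : T -> R) (M : R).
Hypotheses (mg : forall k, measurable_fun D (g_ k))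
  (g_le : forall k x, D x -> `|g_ k x| <= M)
  (g_cvg : forall x, D x -> g_ k x @[k --> \oo] --> g x).

Lemma bounded_cvg_le x : D x -> `|g x| <= M.
Proof.
move=> Dx; have /cvg_norm h := g_cvg Dx.
rewrite -(cvg_lim (@Rhausdorff R) h); apply: limr_le; first by apply/cvg_ex; exists `|g x|.
by apply: nearW => k; exact: g_le.
Qed.

Lemma bounded_cvg_measurable : measurable_fun D g.
Proof. exact: measurable_fun_cvg mg g_cvg. Qed.

Lemma bounded_cvg_integral :
  (\int[mu]_(x in D) (g_ k x)%:E)%E @[k --> \oo] --> (\int[mu]_(x in D) (g x)%:E)%E.
Proof.
apply: (@dominated_cvg _ _ _ mu D mD (fun k x => (g_ k x)%:E) (EFin \o g) (cst M%:E)).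
- by move=> k; exact/measurable_EFinP.
- by move=> x Dx; apply: cvg_EFin; [exact: nearW|exact: g_cvg].
- by [].
- exact: (@bounded_le_integrable (cst M) `|M|).
- by move=> k x Dx; rewrite lee_fin; exact: g_le.
Qed.

End bounded_convergence.

Section martingale_limit.
Context {R : realType} {d : measure_display} {Omega : measurableType d}.
Variables (Q : {measure set Omega -> \bar R}) (G : R -> set (set Omega)).
Hypothesis Q_fin : (Q setT < +oo)%E.
Hypothesis G_measurable : forall t, <<s G t >> `<=` measurable.
Variables (M_ : nat -> R -> Omega -> R) (M : R -> Omega -> R) (C : R -> R).
Hypothesis M_adapted : forall k t A, 0 <= t -> measurable A ->
  <<s G t >> (M_ k t @^-1` A).
Hypothesis M_mean : forall k s t A, 0 <= s <= t -> <<s G s >> A ->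
  (\int[Q]_(w in A) (M_ k t w)%:E = \int[Q]_(w in A) (M_ k s w)%:E)%E.
Hypothesis M_le : forall k t w, 0 <= t -> `|M_ k t w| <= C t.
Hypothesis M_cvg : forall t w, 0 <= t -> M_ k t w @[k --> \oo] --> M t w.

Lemma martingale_limit : martingale Q (fun t => <<s G t >>) M.
Proof.
have mM k t : 0 <= t -> measurable_fun setT (M_ k t).
  by move=> t0 _ A mA; rewrite setTI; apply: (G_measurable (t := t)); exact: M_adapted.
have iM A t : 0 <= t -> measurable A ->
    (\int[Q]_(w in A) (M_ k t w)%:E)%E @[k --> \oo] -->
    (\int[Q]_(w in A) (M t w)%:E)%E.
  move=> t0 mA; apply: (@bounded_cvg_integral _ _ _ Q A mA _ _ _ (C t)).
  - by apply: le_lt_trans Q_fin; apply: le_measure; rewrite ?inE.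
  - by move=> k; apply: measurable_funTS; exact: mM.
  - by move=> k w _; exact: M_le.
  - by move=> w _; exact: M_cvg.
move=> t t0; split.
- apply: (bounded_le_integrable _ Q_fin (M := C t)) => //.
    apply: (bounded_cvg_measurable (g_ := M_ ^~ t)) => [k|w _]; first exact: mM.
    exact: M_cvg.
  move=> w _; apply: (bounded_cvg_le (D := setT) (g_ := M_ ^~ t)) => //.
    by move=> k x _; exact: M_le.
  by move=> x _; exact: M_cvg.
- move=> A mA.
  (* Adaptedness passes to the limit as measurability on the space equipped with the sigma-algebra
     of time t. *)
  have : measurable_fun (T := g_sigma_algebraType (G t)) setT (M t).
    apply: (@measurable_fun_cvg _ (g_sigma_algebraType (G t)) R setT (fun k => M_ k t)) => [k|w _]; last exact: M_cvg.
    by move=> _ D mD; rewrite setTI; exact: M_adapted.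
  by move=> /(_ measurableT A mA); rewrite setTI.
- move=> s /andP[s0 st] A FA.
  have mA : measurable A by exact: G_measurable FA.
  have h1 := iM A t t0 mA; have h2 := iM A s s0 mA.
  rewrite (_ : (fun k => _) = fun k => (\int[Q]_(w in A) (M_ k s w)%:E)%E) in h1.
    exact: cvg_unique h1 h2.
  by apply/funext => k; apply: M_mean => //; rewrite s0.
Qed.

End martingale_limit.

Section path_functionals.
Context {R : realType} {n : nat}.

(** The domain condition is exactly continuity of the singular drift terms; on the simplex, x_j != 0
    means x_j > 0. This makes the time integrand measurable. *)
Lemma gen_continuous b (m : 'I_n -> R) r (H : 'rV[R]_n -> R) :
  gen_domain r H -> {within simplex, continuous (gen b m r H)}.
Proof.
move=> [H2 Hd].
pose drift j (x : 'rV[R]_n) :=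
  if 0 < x 0 j then tderiv (jump_vector r j) H x / x 0 j else 0.
pose g (x : 'rV[R]_n) := b * (\sum_j m j * drift j x) +
  2^-1 * (\sum_j \sum_k m j * r j k *
    tderiv (ebase k - ebase j) (tderiv (ebase k - ebase j) H) x).
apply: (@subspace_eq_continuous _ _ _ g).
  move=> x /set_mem [x0 _]; rewrite /gen /g; congr (_ * _ + _).
  apply: eq_bigr => j _; rewrite /drift lt_def x0 andbT.
  by case: ifP => _; rewrite ?mulr0// mulrAC mulrA.
apply: ctsD.
  apply: ctsM; first exact: cts_cst.
  by apply: cts_sum => j; apply: ctsM; [exact: cts_cst|exact: Hd].
apply: ctsM; first exact: cts_cst.
apply: cts_sum => j; apply: cts_sum => k; apply: ctsM; first exact: cts_cst.
have tv := tangent_ebase (R := R) k j.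
by have [_ h] := Cn2_tderiv H2 tv; have [_ []] := h _ tv.
Qed.

Lemma path_continuous_comp (w : cpath R n) (G : 'rV[R]_n -> R) : (0 < n)%N ->
  {within simplex, continuous G} -> continuous (fun s => G (w s)).
Proof.
move=> n0 Gc s; apply: simplex_cvg => //.
- exact: path_simplex.
- move=> k.
  apply: (@continuous_comp _ _ _ w (fun y : 'rV[R]_n => y 0 k)).
    exact: path_continuous.
  exact: coord_continuous.
- by apply: nearW => t; exact: path_simplex.
Qed.

End path_functionals.

Section time_integral.
Context {R : realType}.
Variable t : R.
Hypothesis t_ge0 : 0 <= t.
Local Notation mu := (@lebesgue_measure R).

Let muE : mu `[0, t] = t%:E.
Proof.
rewrite lebesgue_measure_itv/= lte_fin lt_def t_ge0 andbT sube0.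
by case: eqP => // ->.
Qed.

Let mu_fin : (mu `[0%R, t] < +oo)%E. Proof. by rewrite muE ltry. Qed.

Lemma time_integral_le (g : R -> R) M : measurable_fun `[0, t] g ->
  (forall s, 0 <= s <= t -> `|g s| <= M) ->
  `|\int[mu]_(s in `[0, t]) g s| <= M * t.
Proof.
move=> mg gM; have ig : mu.-integrable `[0, t] (EFin \o g).
  by apply: (bounded_le_integrable _ mu_fin (M := M)) => // s /=; rewrite in_itv/=; exact: gM.
apply: (le_trans (le_normr_Rintegral _ ig)) => //.
have -> : M * t = \int[mu]_(s in `[0, t]) M.
  by rewrite Rintegral_cst//; congr (M * _); exact: (esym (congr1 fine muE)).
apply: le_Rintegral => //.
- exact: integrable_norm.
- exact: (bounded_le_integrable _ mu_fin (M := `|M|)).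
Qed.

Lemma time_integral_cvg (g_ : nat -> R -> R) (g : R -> R) M :
  (forall k, measurable_fun `[0, t] (g_ k)) ->
  (forall k s, 0 <= s <= t -> `|g_ k s| <= M) ->
  (forall s, 0 <= s <= t -> g_ k s @[k --> \oo] --> g s) ->
  \int[mu]_(s in `[0, t]) g_ k s @[k --> \oo] --> \int[mu]_(s in `[0, t]) g s.
Proof.
move=> mg gM gc.
have gM' k s : `[0, t]%classic s -> `|g_ k s| <= M by rewrite /= in_itv/=; exact: gM.
have gc' s : `[0, t]%classic s -> g_ k s @[k --> \oo] --> g s by rewrite /= in_itv/=; exact: gc.
apply: fine_cvg; rewrite /= [X in _ --> X]fineK.
  exact: (bounded_cvg_integral _ mu_fin mg gM' gc').
apply: integrable_fin_num => //; apply: (bounded_le_integrable _ mu_fin (M := M)) => //.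
  exact: bounded_cvg_measurable mg gc'.
by move=> s; exact: bounded_cvg_le gM' gc' s.
Qed.

End time_integral.

Definition mp_process (R : realType) p b (q : 'I_p -> R) (s : 'I_p -> 'I_p -> R)
    (G : 'rV[R]_p -> R) (t : R) (w : cpath R p) :=
  G (w t) - \int[lebesgue_measure]_(u in `[0, t]) gen b q s G (w u).

Section face_process.
Context {R : realType} {n : nat}.
Variables (B : {set 'I_n}) (b : R) (r : 'I_n -> 'I_n -> R) (m : 'I_n -> R).
Variable P : probability (cpath R n) R.
Hypothesis B_gt0 : (0 < #|B|)%N.
Hypothesis P_face : P (face_paths B) = 1%E.
Hypothesis P_sol : solves_mp b m r P.
Local Notation cpathB := (cpath R #|B|).
Local Notation E := (extend_path B_gt0).

Lemma face_law_starts_at (x : 'rV[R]_n) : (forall j, j \notin B -> x 0 j = 0) ->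
  starts_at x P -> starts_at (restr_coord B x) (face_law P).
Proof.
move=> x0 Px; rewrite /starts_at -Px.
have mA : measurable [set w : cpath R n | w 0 = x].
  rewrite (_ : [set _ | _] = \bigcap_(j in [set: 'I_n])
      [set w : cpath R n | [set x 0 j] (w 0 0 j)]).
    apply: fin_bigcap_measurable => [|j _]; first exact: finite_finset.
    exact: measurable_coord.
  apply/seteqP; split=> w /= h; first by move=> j _ /=; rewrite h.
  by apply/rowP => j; exact: (h j Logic.I).
apply: etrans (face_law_extend B_gt0 P_face mA); congr face_law.
apply/seteqP; split=> u /=; rewrite extend_pathE.
  by move=> ->; rewrite restr_coordK.
by rewrite -{1}(restr_coordK x0) => /extend_coord_inj.
Qed.

Variables (rB : 'I_#|B| -> 'I_#|B| -> R) (mB : 'I_#|B| -> R).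
Variables (H : 'rV[R]_#|B| -> R) (F : nat -> 'rV[R]_n -> R) (M : R).
Hypothesis F_dom : forall k, gen_domain r (F k).
Hypothesis F_le : forall k y, simplex y -> `|F k (extend_coord (B := B) y)| <= M /\
  `|gen b m r (F k) (extend_coord (B := B) y)| <= M.
Hypothesis F_cvg : forall y, simplex y ->
  F k (extend_coord (B := B) y) @[k --> \oo] --> H y /\
  gen b m r (F k) (extend_coord (B := B) y) @[k --> \oo] --> gen b mB rB H y.

Let n_gt0 : (0 < n)%N.
Proof. by rewrite (leq_trans B_gt0)// -[leqRHS]card_ord max_card. Qed.

Let pathS (u : cpathB) t : simplex (u t). Proof. exact: path_simplex. Qed.

Let gen_measurable k (u : cpathB) (t : R) :
  measurable_fun `[0, t] (fun s => gen b m r (F k) (E u s)).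
Proof.
apply: measurable_funTS; apply: continuous_measurable_fun.
by apply: path_continuous_comp => //; exact: gen_continuous.
Qed.

Lemma face_law_martingale : martingale (face_law P) coord_filtration
  (mp_process b mB rB H).
Proof.
pose M_ k t u := mp_process b m r (F k) t (E u).
have coord_sub p (t : R) : coord_filtration (n := p) t `<=` measurable.
  apply: sub_coord_sigma; first exact: sigma_algebra_measurable.
  by move=> s j A _ mA; exact: measurable_coord.
have Fw k t u : F k (E u t) = F k (extend_coord (u t)) by rewrite extend_pathE.
have gw k t u : gen b m r (F k) (E u t) = gen b m r (F k) (extend_coord (u t)).
  by rewrite extend_pathE.
have adapted k t A : 0 <= t -> measurable A ->
    coord_filtration t (M_ k t @^-1` A).
  move=> t0 mA; have [_ + _] := P_sol (F_dom k) t0.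
  by move=> /(_ A mA); exact: preimage_extend_path.
have M_le k t u : 0 <= t -> `|M_ k t u| <= M + M * t.
  move=> t0; apply: (le_trans (ler_normB _ _)); apply: lerD.
    by rewrite Fw; exact: (F_le k (pathS u t)).1.
  apply: time_integral_le => // s _.
  by rewrite gw; exact: (F_le k (pathS u s)).2.
have Q_fin : (face_law P [set: cpathB] < +oo)%E.
  by rewrite (face_lawT B_gt0 P_face) ltry.
pose G (t : R) := coord_events (R := R) (n := #|B|) [set s | 0 <= s <= t].
have mean k s t A : 0 <= s <= t -> <<s G s >> A ->
    (\int[face_law P]_(u in A) (M_ k t u)%:E = \int[face_law P]_(u in A) (M_ k s u)%:E)%E.
  move=> /andP[s0 st] FA.
  have [A' FA' ->] := extend_path_sigma B_gt0 FA.
  have mA' : measurable A' by exact: coord_sub FA'.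
  have t0 := le_trans s0 st.
  (* The expectations are transported to P, where each [F k] lies in the domain of the martingale
     problem. *)
  have int_eq v : 0 <= v -> (\int[face_law P]_(u in E @^-1` A') (M_ k v u)%:E =
      \int[P]_(w in A') (mp_process b m r (F k) v w)%:E)%E.
    move=> v0; have [Pi _ _] := P_sol (F_dom k) v0.
    apply: (integral_face_law P_face mA' (f := fun w => (mp_process b m r (F k) v w)%:E)).
      by case/integrableP: Pi.
    apply: (bounded_le_integrable _ Q_fin (M := M + M * v)) => //.
      by move=> _ C mC; rewrite setTI; apply: (coord_sub _ v); exact: adapted.
    by move=> u _; exact: M_le.
  rewrite (int_eq t t0) (int_eq s s0); have [_ _ h] := P_sol (F_dom k) t0.
  by apply: h => //; rewrite s0.
have cvg t u : 0 <= t -> M_ k t u @[k --> \oo] --> mp_process b mB rB H t u.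
  move=> t0; apply: cvgB.
    by under eq_fun do rewrite Fw; exact: (F_cvg (pathS u t)).1.
  apply: (time_integral_cvg t0 (M := M)) => [k|k s _|s _]; first exact: gen_measurable.
    by rewrite gw; exact: (F_le k (pathS u s)).2.
  by under eq_fun do rewrite gw; exact: (F_cvg (pathS u s)).2.
exact: (@martingale_limit _ _ _ (face_law P) G Q_fin (@coord_sub _) M_
  (mp_process b mB rB H) (fun t => M + M * t) adapted mean M_le cvg).
Qed.

End face_process.

(** * Positivity of the invariant measure and of the total rates *)

Section rates.
Context {R : realType} {n : nat}.
Variable r : 'I_n -> 'I_n -> R.
Hypothesis r_ge0 : forall j k, 0 <= r j k.
Hypothesis r_irr : irreducible_rates r.

(** Positivity spreads along edges: if m_l = 0, the invariance equation at l makes every m_k r(k, l)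
    vanish. *)
Lemma invariant_measure_gt0 (m : 'I_n -> R) : invariant_measure r m ->
  forall j, 0 < m j.
Proof.
move=> [m_ge0 [i mi] m_inv] j.
apply: (connect_preserved (P := fun k => 0 < m k) _ (r_irr i j)); last first.
  by rewrite lt_def mi m_ge0.
move=> k l rkl mk; rewrite lt_def m_ge0 andbT; apply/eqP => ml0.
have := m_inv l; rewrite ml0 mul0r => /eqP.
rewrite psumr_eq0; last by move=> o _; rewrite mulr_ge0.
move=> /allP/(_ k (mem_index_enum k))/=.
by rewrite mulf_eq0 !gt_eqF.
Qed.

Lemma total_rate_gt0 : (1 < n)%N -> forall j, 0 < total_rate r j.
Proof.
move=> n1 j; have [k jk] : exists k, k != j.
  have : (0 < #|predC1 j|)%N by rewrite cardC1 card_ord -subn1 subn_gt0.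
  by move=> /card_gt0P[k]; exists k.
rewrite lt_def sumr_ge0 ?andbT// psumr_eq0//; apply/negP => /allP r0.
case/eqP: jk; apply: (connect_preserved (P := eq^~ j) _ (r_irr j k)) => //.
move=> i l ril ij; move: ril.
by rewrite ij (eqP (r0 l (mem_index_enum l))) ltxx.
Qed.

End rates.

Theorem proposition2p4 (R : realType) (L : nat)
  (r : 'I_L -> 'I_L -> R) (m : 'I_L -> R) (b : R)
  (r_ge0 : forall j k, 0 <= r j k)
  (r_diag : forall j, r j j = 0)
  (r_irr : irreducible_rates r)
  (m_inv : invariant_measure r m)
  (b_gt1 : 1 < b)
  (* PC j is the law, when started at j, of the chain X with rates r *)
  (d : measure_display) (Omega : measurableType d)
  (PC : 'I_L -> probability Omega R) (X : R -> Omega -> 'I_L)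
  (X_chain : forall j, markov_chain r j (PC j) X)
  (* PS y is the solution of the martingale problem starting at y *)
  (PS : 'rV[R]_L -> probability (cpath R L) R)
  (PS_sol : forall y, simplex y -> is_unique_solution b m r y (PS y))
  (PS_abs : forall y, simplex y ->
    PS y (face_paths (~: zero_set y)%SET) = 1%E)
  (x : 'rV[R]_L) (x_simplex : simplex x)
  (A_neq0 : zero_set x != finset.set0) :
  let B := (~: zero_set x)%SET in
  (1 < #|B|)%N ->
  let mB := fun i : 'I_#|B| => m (enum_val i) in
  let rB := trace_rate r PC X (B := B) in
  [/\ face_law (PS x) [set: cpath R #|B|] = 1%E,
      starts_at (restr_coord B x) (face_law (PS x)) &
      solves_mp b mB rB (face_law (PS x))].
Proof.
move=> B B1 mB rB; have B0 : (0 < #|B|)%N by exact: ltnW.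
have L1 : (1 < L)%N by rewrite (leq_trans B1)// -[leqRHS]card_ord max_card.
have [x_start x_sol _] := PS_sol x x_simplex.
have x_face := PS_abs x x_simplex.
have m_gt0 := invariant_measure_gt0 r_ge0 r_irr m_inv.
have rate_gt0 := total_rate_gt0 r_ge0 r_irr L1.
have m_inv' : forall k, \sum_j m j * r j k = m k * total_rate r k by case: m_inv.
split.
- exact: (face_lawT B0 x_face).
- apply: (face_law_starts_at B0 x_face) => // j.
  by rewrite !inE negbK => /eqP.
- move=> H HD.
  have [U [U_ge0 U_sum U_in W_in W_out]] :=
    exists_trace_matrix r_ge0 r_irr rate_gt0 r_diag X_chain B0.
  have [T [C [Cfar [f [df [ddf psh]]]]]] :=
    exists_push r_ge0 r_irr m_gt0 m_inv' rate_gt0.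
  have [F [F_dom [M F_le] F_cvg]] :=
    face_approximation b m_inv' psh U_ge0 U_sum U_in W_in W_out HD.
  exact: (face_law_martingale B0 x_face x_sol F_dom F_le F_cvg).
Qed.
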